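(* Let $f,g$ belong to the class $\mathcal{K}$ of general meromorphic functions. Suppose that $f$ commutes with $g$ (that is, $f\circ g=g\circ f$) and that $f=g+c$ for some constant $c$. Then $\mathcal{J}(f)=\mathcal{J}(g)$ and $\mathcal{F}(f)=\mathcal{F}(g)$.
   Context: Let $\widehat{\mathbb{C}}=\mathbb{C}\cup\{\infty\}$ be the Riemann sphere. Class $\mathcal{K}$: a function $f$ belongs to $\mathcal{K}$ if there is a countable compact set $A(f)\subset\widehat{\mathbb{C}}$ such that $f$ is an analytic function on $\widehat{\mathbb{C}}\setminus A(f)$ (with values in $\widehat{\mathbb{C}}$, so poles are allowed), but on no proper superset of $\widehat{\mathbb{C}}\setminus A(f)$; thus $A(f)$ is the set of (non-removable, essential) singularities of $f$. The class $\mathcal{K}$ is closed under composition; for example $f^2=f\circ f\in\mathcal{K}$ with $A(f^2)=A(f)\cup f^{-1}(A(f))$. The identity $f\circ g=g\circ f$ means equality wherever both sides are defined. Fatou and Julia sets: for $f\in\mathcal{K}$, the Fatou set $\mathcal{F}(f)$ is the set of points of $\widehat{\mathbb{C}}$ having a neighborhood on which all iterates $f^n$, $n\ge 0$, are defined and form a normal family (with respect to the spherical metric). The Julia set is $\mathcal{J}(f)=\widehat{\mathbb{C}}\setminus\mathcal{F}(f)$.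
   Formalization: The formal theorem adds the assumption that, if c is nonzero, neither f nor g is the identity map: for g(z)=z and f(z)=z+c the claim as stated fails, since J(g) is empty while J(f) is the point at infinity. *)

(* Defs.v *)
From HB Require Import structures.
From mathcomp Require Import all_boot all_order all_algebra.
From mathcomp Require Import complex.
From mathcomp Require Import all_classical all_reals all_analysis.

Set Implicit Arguments.
Unset Strict Implicit.
Unset Printing Implicit Defensive.

Import Order.TTheory GRing.Theory Num.Theory.
Import numFieldNormedType.Exports.

Local Open Scope classical_set_scope.
Local Open Scope ring_scope.

(* The field R[i], packed as a numClosedFieldType so that it inherits the
   norm topology (and complex differentiability) of MathComp-Analysis. *)
Definition cplx (R : realType) : numClosedFieldType := R[i].

(* The Riemann sphere; [None] is the point at infinity. *)
Definition sphere (R : realType) := one_point_compactification (cplx R).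

Section RiemannSphere.
Context {R : realType}.
Implicit Types (z w : sphere R) (c : cplx R) (f h : sphere R -> sphere R).

(* 1/z, the change of chart between the finite plane and infinity. *)
Definition sphere_inv z : sphere R :=
  if z is Some u then (if u == 0 then None else Some u^-1) else Some 0.

Definition sphere_shift z c : sphere R :=
  if z is Some u then Some (u + c) else None.

(* Each point p has a preferred chart: the identity if p is finite, 1/z if p is
   infinity. Both charts are involutions of the sphere, so [chart p] serves also
   as its own inverse. *)
Definition chart (p z : sphere R) : sphere R :=
  if p is None then sphere_inv z else z.

Definition affine z : cplx R := odflt 0 z.

(* Continuity at z guarantees that, near z, the values of h lie in the domain of
   the chart at h z, where [affine] forgets nothing. *)
Definition holomorphic_at h z : Prop :=
  {for z, continuous h} /\
  \forall u \near affine (chart z z),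
    derivable (fun v : cplx R => affine (chart (h z) (h (chart z (Some v))))) u 1.

Definition holomorphic_on (D : set (sphere R)) h : Prop :=
  forall z, D z -> holomorphic_at h z.

Definition modulus (u : cplx R) : R := Normc.normc (u : R[i]).

Definition chordal_dist z w : R :=
  match z, w with
  | Some u, Some v => 2 * modulus (u - v) /
      (Num.sqrt (1 + modulus u ^+ 2) * Num.sqrt (1 + modulus v ^+ 2))
  | Some u, None | None, Some u => 2 / Num.sqrt (1 + modulus u ^+ 2)
  | None, None => 0
  end.

(* Great-circle distance on the unit sphere, whose chords have length
   [chordal_dist]. *)
Definition spherical_dist z w : R := 2 * asin (chordal_dist z w / 2).

Definition locally_uniformly_cvg (U : set (sphere R))
    (u : nat -> sphere R -> sphere R) h : Prop :=
  forall z, U z -> exists V : set (sphere R), [/\ open V, V z &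
    forall e : R, 0 < e ->
      \forall n \near \oo, forall w, V w -> U w -> spherical_dist (u n w) (h w) < e].

Definition normal_family (U : set (sphere R))
    (F : set (sphere R -> sphere R)) : Prop :=
  forall u : nat -> sphere R -> sphere R, (forall n, F (u n)) ->
  exists (s : nat -> nat) h,
    {homo s : m n / (m < n)%N} /\ locally_uniformly_cvg U (u \o s) h.

End RiemannSphere.

(* A partial self-map of the sphere, undefined exactly on [sing]; the values of
   the underlying total function at points of [sing] are meaningless. *)
Record sphere_map (R : realType) := SphereMap {
  sing : set (sphere R);
  sphere_map_fun :> sphere R -> sphere R
}.

Section ClassK.
Context {R : realType}.
Implicit Types (f g : sphere_map R) (c : cplx R).

Definition class_K f : Prop :=
  [/\ countable (sing f), compact (sing f), holomorphic_on (~` sing f) f &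
    forall (D : set (sphere R)) (h : sphere R -> sphere R),
      ~` sing f `<` D -> (forall z, ~ sing f z -> h z = f z) ->
      ~ holomorphic_on D h].

Definition commutes f g : Prop :=
  forall z, ~ sing g z -> ~ sing f (g z) -> ~ sing f z -> ~ sing g (f z) ->
    f (g z) = g (f z).

Definition is_translate f g c : Prop :=
  forall z, ~ sing f z -> ~ sing g z -> f z = sphere_shift (g z) c.

(* The identity g commutes with the translation f = g + c, but for c <> 0 the
   Julia set of f is the point at infinity while that of g is empty. *)
Definition is_identity f : Prop := forall z, ~ sing f z -> f z = z.

Definition iter_defined f n (z : sphere R) : Prop :=
  forall k, (k < n)%N -> ~ sing f (iter k f z).

Definition fatou_set f : set (sphere R) :=
  [set z | exists U : set (sphere R), [/\ open U, U z,
    forall n w, U w -> iter_defined f n w &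
    normal_family U (range (fun n => iter n f))]].

Definition julia_set f : set (sphere R) := ~` fatou_set f.

End ClassK.

(* Main.v *)
(** Let A be the common singular set. Where f o g = g o f makes sense it reads
    g(g(y) + c) = g(g(y)) + c, so by the identity theorem g(z + c) = g(z) + c off A;
    hence A + c = A and f^n = g^n + n c.

    If infinity is not in A, then A is empty, because the translates of a finite
    point of A accumulate at infinity, and g is itself a translation.

    If infinity is in A, the iterates of g are finite on a disc in the Fatou set of
    g, with centre p say. By Schottky's theorem f^n is normal at p as soon as, near
    p, every f^n omits both points of one of finitely many pairs {b, b + c}. A finite
    singularity or a finite pole b of g does this for all n. If g is entire,
    Picard's theorem for (g(z) - z)/c gives b1 and b2 with g(bi) = bi + mi c and
    0 < m1 < m2. If f^n took a value in {b1, b1 + c} at x and one in {b2, b2 + c} at y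
    for some large n, then with k = n div m1 the iterate g^(n+k) would be bounded at x
    and large at y, which contradicts the equicontinuity of the iterates of g at p. *)

From HB Require Import structures.
Require Import Defs.
From mathcomp Require Import all_boot all_order all_algebra.
From mathcomp Require Import all_classical all_reals all_analysis.
From mathcomp Require Import complex ring lra zify.

Set Implicit Arguments.
Unset Strict Implicit.
Unset Printing Implicit Defensive.
Import Order.TTheory GRing.Theory Num.Theory.
Import numFieldNormedType.Exports.
Local Open Scope classical_set_scope.
Local Open Scope ring_scope.

(** * Complex modulus and differentiability *)

(** The relation between f^n and g^n does not transport normality by itself: the translations by n c
    are not equicontinuous at infinity for the spherical metric, and where g^n is large it may
    nearly cancel n c. Hence the detour through omitted values. The iterates are finite on the disc,
    so infinity is omitted for free and a pair {b, b + c} supplies two more values. The pair may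
    vary with n, but only among finitely many, since Schottky's bound depends on the pair and has to
    be uniform in n.

    A singularity or a pole b comes with b + c because both sets are invariant under translation by
    c. In the entire case f sends b + j c to b + (j + m + 1) c as soon as g(b) = b + m c. If f^n(x)
    = b1 + j c, then g^(n+k)(x) = b1 + (j + k m1 - n) c, and the choice of k balances k m1 against
    n; the larger m2 leaves an excess that grows with n.

    The roles of f and g are symmetric up to the sign of c, so one inclusion suffices. Constant g is
    set apart: the functional equation is found on the image of g, which must accumulate
    somewhere. *)

Section ComplexModulus.
Context {R : realType}.
Notation C := (cplx R).
Implicit Types (x y z : C) (a b : R).

Definition rc (a : R) : C := (a%:C)%C.
Definition re (z : C) : R := complex.Re (z : R[i]).
Definition im (z : C) : R := complex.Im (z : R[i]).
Definition ci : C := ('i%C : R[i]).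

Lemma rcD a b : rc (a + b) = rc a + rc b.
Proof. by rewrite /rc; simpc. Qed.
Lemma rcM a b : rc (a * b) = rc a * rc b.
Proof. by rewrite /rc; simpc. Qed.
Lemma rcN a : rc (- a) = - rc a.
Proof. by rewrite /rc; simpc. Qed.
Lemma rcB a b : rc (a - b) = rc a - rc b.
Proof. by rewrite rcD rcN. Qed.
Lemma rc0 : rc 0 = 0. Proof. by []. Qed.
Lemma rc1 : rc 1 = 1. Proof. by []. Qed.
Lemma rc_nat n : rc n%:R = n%:R.
Proof. by elim: n => [//|n IH]; rewrite -!natr1 rcD IH. Qed.
Lemma rc_inj : injective rc. Proof. by move=> a b []. Qed.
Lemma rc_eq0 a : (rc a == 0) = (a == 0).
Proof. by apply/eqP/eqP => [|->//]; rewrite -rc0 => /rc_inj. Qed.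
Lemma rcV a : rc (a^-1) = (rc a)^-1.
Proof.
have [->|a0] := eqVneq a 0; first by rewrite invr0 rc0 invr0.
by apply: (mulfI (x := rc a)); rewrite ?rc_eq0// -rcM !mulfV ?rc_eq0.
Qed.
Lemma ci2 : ci * ci = -1.
Proof. exact: (sqr_i R). Qed.

Lemma cplxE z : z = rc (re z) + ci * rc (im z).
Proof. exact: (complexE z). Qed.
Lemma reD x y : re (x + y) = re x + re y.
Proof. by case: x; case: y. Qed.
Lemma imD x y : im (x + y) = im x + im y.
Proof. by case: x; case: y. Qed.
Lemma reN x : re (- x) = - re x.
Proof. by case: x. Qed.
Lemma imN x : im (- x) = - im x.
Proof. by case: x. Qed.
Lemma reB x y : re (x - y) = re x - re y.
Proof. by rewrite reD reN. Qed.
Lemma imB x y : im (x - y) = im x - im y.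
Proof. by rewrite imD imN. Qed.
Lemma reM x y : re (x * y) = re x * re y - im x * im y.
Proof. by case: x; case: y. Qed.
Lemma imM x y : im (x * y) = re x * im y + im x * re y.
Proof. by case: x; case: y. Qed.
Lemma re_rc a : re (rc a) = a. Proof. by []. Qed.
Lemma im_rc a : im (rc a) = 0. Proof. by []. Qed.
Lemma re_ci : re ci = 0. Proof. by []. Qed.
Lemma im_ci : im ci = 1. Proof. by []. Qed.
Definition reimE := (reD, imD, reN, imN, reM, imM, re_rc, im_rc, re_ci, im_ci).
Lemma cplxP x y : re x = re y -> im x = im y -> x = y.
Proof. by move=> h1 h2; rewrite (cplxE x) (cplxE y) h1 h2. Qed.

Local Notation md := modulus.
Lemma mdE z : md z = Num.sqrt (re z ^+ 2 + im z ^+ 2).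
Proof. by case: z. Qed.
Lemma md_ge0 z : 0 <= md z.
Proof. by rewrite mdE sqrtr_ge0. Qed.
Lemma md_sqr z : md z ^+ 2 = re z ^+ 2 + im z ^+ 2.
Proof. by rewrite mdE sqr_sqrtr// addr_ge0// sqr_ge0. Qed.
Lemma md0 : md (0 : C) = 0. Proof. exact: Normc.normc0. Qed.
Lemma md1 : md (1 : C) = 1. Proof. exact: Normc.normc1. Qed.
Lemma mdM x y : md (x * y) = md x * md y. Proof. exact: Normc.normcM. Qed.
Lemma mdN x : md (- x) = md x. Proof. exact: (normcN (x : Rcomplex R)). Qed.
Lemma mdD x y : md (x + y) <= md x + md y.
Proof. exact: (le_normcD (x : Rcomplex R) y). Qed.
Lemma mdV x : md (x^-1) = (md x)^-1. Proof. exact: Normc.normcV. Qed.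
Lemma mdf x y : md (x / y) = md x / md y. Proof. by rewrite mdM mdV. Qed.
Lemma mdX x n : md (x ^+ n) = md x ^+ n.
Proof. by elim: n => [|n IH]; rewrite ?expr0 ?md1// !exprS mdM IH. Qed.
Lemma md_rc a : md (rc a) = `|a|.
Proof. by rewrite mdE /= expr0n addr0 sqrtr_sqr. Qed.
Lemma md_ci : md ci = 1.
Proof. by rewrite mdE re_ci im_ci expr0n add0r expr1n sqrtr1. Qed.
Lemma md_nat n : md (n%:R : C) = n%:R.
Proof. by rewrite -rc_nat md_rc ger0_norm. Qed.
Lemma md_eq0 x : (md x == 0) = (x == 0).
Proof. by apply/eqP/eqP => [/Normc.eq0_normc//|->]; exact: md0. Qed.
Lemma md_gt0 x : (0 < md x) = (x != 0).
Proof. by rewrite lt_def md_ge0 andbT md_eq0. Qed.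
Lemma mdBC x y : md (x - y) = md (y - x).
Proof. by rewrite -opprB mdN. Qed.
Lemma mdB x y : md (x - y) <= md x + md y.
Proof. by have := mdD x (- y); rewrite mdN. Qed.
Lemma md_tri x y z : md (x - z) <= md (x - y) + md (y - z).
Proof. by have := mdD (x - y) (y - z); rewrite addrA subrK. Qed.
Lemma md_subl x y : md x - md y <= md (x - y).
Proof. by rewrite lerBlDr; have := mdD (x - y) y; rewrite subrK. Qed.
Lemma md_subr x y : md x - md y <= md (x + y).
Proof. by have := md_subl x (- y); rewrite mdN opprK. Qed.
Lemma re_le_md z : `|re z| <= md z.
Proof. by rewrite mdE -sqrtr_sqr ler_wsqrtr// lerDl sqr_ge0. Qed.
Lemma im_le_md z : `|im z| <= md z.
Proof. by rewrite mdE -sqrtr_sqr ler_wsqrtr// lerDr sqr_ge0. Qed.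
Lemma md_le_reim z : md z <= `|re z| + `|im z|.
Proof.
rewrite {1}(cplxE z); apply: le_trans (mdD _ _) _.
by rewrite mdM md_ci mul1r !md_rc.
Qed.
Lemma md_small_eq0 z : (forall e, 0 < e -> md z <= e) -> z = 0.
Proof.
move=> h; apply/eqP; rewrite -md_eq0 eq_le md_ge0 andbT.
by apply/ler_addgt0Pl => e e0; rewrite addr0; exact: h.
Qed.

(** The norm of [cplx R] takes values in the field itself, and a positive element for its order is
    real; this trades the balls of the topology for balls with a real radius. *)
Lemma nbhs_cplxP (z : C) (A : set C) :
  nbhs z A <-> exists2 e : R, 0 < e & forall w, md (w - z) < e -> A w.
Proof.
have normE (w : C) : `|w| = rc (md w) by [].
split.
  move/nbhs_ballP => [e /= e0 eA]; exists (re e).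
    by move: e0; rewrite ltcE /= => /andP[].
  move=> w wz; apply: eA; rewrite -ball_normE /= normE mdBC ltcE /=.
  by move: e0; rewrite ltcE => /andP[/eqP-> _]; rewrite eqxx.
move=> [e e0 eA]; apply/nbhs_ballP; exists (rc e) => /=.
  by rewrite ltcE /= eqxx.
move=> w; rewrite -ball_normE /= normE ltcE eqxx /= => wz.
by apply: eA; rewrite mdBC.
Qed.

End ComplexModulus.
Notation md := modulus.

(** * Derivatives and continuity relative to a set *)

Section DiffWithin.
Context {R : realType}.
Notation C := (cplx R).
Implicit Types (S T : set C) (f g : C -> C) (z l m : C).

(** With S the whole plane this is the complex derivative, with S the embedded interval [I01] the
    derivative along a path, so one calculus serves holomorphic functions and integrands.
    Multiplying out the quotient makes w = z harmless. *)
Definition diff_within S f z l := forall e : R, 0 < e ->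
  exists2 d : R, 0 < d & forall w, S w -> md (w - z) < d ->
    md (f w - f z - l * (w - z)) <= e * md (w - z).

Definition cont_within S f z := forall e : R, 0 < e ->
  exists2 d : R, 0 < d & forall w, S w -> md (w - z) < d -> md (f w - f z) < e.

Lemma diff_withinW S T f z l : S `<=` T ->
  diff_within T f z l -> diff_within S f z l.
Proof.
by move=> ST h e /h[d d0 hd]; exists d => // w /ST; exact: hd.
Qed.

Lemma cont_withinW S T f z : S `<=` T -> cont_within T f z -> cont_within S f z.
Proof.
by move=> ST h e /h[d d0 hd]; exists d => // w /ST; exact: hd.
Qed.

Lemma diff_lip S f z l : diff_within S f z l ->
  exists2 d : R, 0 < d & forall w, S w -> md (w - z) < d ->
    md (f w - f z) <= (md l + 1) * md (w - z).
Proof.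
move=> /(_ 1 ltr01)[d d0 hd]; exists d => // w Sw wd.
have := hd _ Sw wd; have := md_subl (f w - f z) (l * (w - z)).
by rewrite mdM; lra.
Qed.

Lemma diff_cont S f z l : diff_within S f z l -> cont_within S f z.
Proof.
move=> /diff_lip[d d0 hd] e e0.
have l0 : 0 < md l + 1 by have := md_ge0 l; lra.
exists (Num.min d (e / (md l + 1))); first by rewrite lt_min d0 divr_gt0.
move=> w Sw; rewrite lt_min => /andP[/(hd _ Sw) h1].
by rewrite ltr_pdivlMr// mulrC; exact: le_lt_trans.
Qed.

Lemma diff_within_cst S (c : C) z : diff_within S (fun=> c) z 0.
Proof.
move=> e e0; exists 1 => // w _ _.
by rewrite subrr mul0r subrr md0 mulr_ge0 ?md_ge0// ltW.
Qed.

Lemma diff_within_id S z : diff_within S id z 1.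
Proof.
move=> e e0; exists 1 => // w _ _.
by rewrite mul1r subrr md0 mulr_ge0 ?md_ge0// ltW.
Qed.

Lemma diff_withinD S f g z l m : diff_within S f z l -> diff_within S g z m ->
  diff_within S (fun w => f w + g w) z (l + m).
Proof.
move=> hf hg e e0; have e20 : 0 < e / 2 by lra.
have [d d0 hd] := hf _ e20; have [d' d'0 hd'] := hg _ e20.
exists (Num.min d d'); first by rewrite lt_min d0.
move=> w Sw; rewrite lt_min => /andP[/(hd _ Sw) h1 /(hd' _ Sw) h2].
have -> : f w + g w - (f z + g z) - (l + m) * (w - z) =
  (f w - f z - l * (w - z)) + (g w - g z - m * (w - z)) by ring.
by apply: le_trans (mdD _ _) _; lra.
Qed.

Lemma diff_within_comp S T f g z l m :
  diff_within T f (g z) l -> diff_within S g z m ->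
  (exists2 d : R, 0 < d & forall w, S w -> md (w - z) < d -> T (g w)) ->
  diff_within S (fun w => f (g w)) z (l * m).
Proof.
move=> hf hg [d3 d30 ST] e e0.
have [d1 d10 hd1] := diff_lip hg.
(* Half of [e] pays for the error of [f], magnified by the Lipschitz constant md m + 1 of [g]; the
   other half pays for the error of [g], magnified by md l. *)
have [d4 d40 hd4] := hg _ (divr_gt0 e0 (ltr_pwDl ltr01 (addr_ge0 (md_ge0 l) (md_ge0 l)))).
have m0 : 0 < md m + 1 by have := md_ge0 m; lra.
have [d2 d20 hd2] := hf _ (divr_gt0 e0 (mulr_gt0 (ltr0Sn _ 1) m0)).
have [d5 d50 hd5] := diff_cont hg d20.
exists (Num.min (Num.min d3 d1) (Num.min d4 d5)).
  by rewrite !lt_min d10 d30 d40.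
move=> w Sw; rewrite !lt_min => /andP[/andP[/(ST _ Sw) Tw /(hd1 _ Sw) h1]].
move=> /andP[/(hd4 _ Sw) h4 /(hd5 _ Sw) h5].
have {hd2} h2 := hd2 _ Tw h5.
have -> : f (g w) - f (g z) - l * m * (w - z) =
  (f (g w) - f (g z) - l * (g w - g z)) + l * (g w - g z - m * (w - z)) by ring.
apply: le_trans (mdD _ _) _; rewrite (mdM l).
have A : e / (2 * (md m + 1)) * md (g w - g z) <= e / 2 * md (w - z).
  rewrite invfM mulrA -mulrA; apply: ler_wpM2l; first by rewrite divr_ge0 ?ltW.
  by rewrite mulrC ler_pdivrMr// mulrC.
have l0 := md_ge0 l.
have B : md l * md (g w - g z - m * (w - z)) <= e / 2 * md (w - z).
  apply: le_trans (ler_wpM2l l0 h4) _; rewrite mulrA.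
  apply: ler_wpM2r; first exact: md_ge0.
  rewrite mulrCA ler_wpM2l ?(ltW e0)// ler_pdivrMr; lra.
have := md_ge0 (w - z); lra.
Qed.

Lemma diff_within_sqr S z : diff_within S (fun w => w * w) z (2 * z).
Proof.
move=> e e0; exists e => // w _ wz.
have -> : w * w - z * z - 2 * z * (w - z) = (w - z) * (w - z) by ring.
by rewrite mdM ler_wpM2r ?md_ge0// ltW.
Qed.

Lemma diff_withinZ S c f z l : diff_within S f z l ->
  diff_within S (fun w => c * f w) z (c * l).
Proof.
move=> hf; apply: (@diff_within_comp S setT (fun w => c * w)) => //; last first.
  by exists 1.
move=> e e0; exists 1 => // w _ _.
by rewrite mulrBr subrr md0 mulr_ge0 ?md_ge0// ltW.
Qed.

Lemma diff_within_eq S f g z l m : diff_within S f z l ->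
  (exists2 d : R, 0 < d & forall w, S w -> md (w - z) < d -> f w = g w) ->
  f z = g z -> l = m -> diff_within S g z m.
Proof.
move=> hf [d d0 fg] fgz <- e /hf[d' d'0 hd'].
exists (Num.min d d'); first by rewrite lt_min d0.
move=> w Sw; rewrite lt_min => /andP[/(fg _ Sw) <- /(hd' _ Sw)].
by rewrite fgz.
Qed.

Lemma diff_within_ext S f g z l m : diff_within S f z l ->
  f =1 g -> l = m -> diff_within S g z m.
Proof. by move=> h fg; apply: diff_within_eq h _ _; [exists 1|]. Qed.

(** Polarization: f g is half of (f + g)^2 - f^2 - g^2, so the chain rule for squaring is enough. *)
Lemma diff_withinM S f g z l m : diff_within S f z l -> diff_within S g z m ->
  diff_within S (fun w => f w * g w) z (l * g z + f z * m).
Proof.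
move=> hf hg.
have sq h k : diff_within S h z k ->
    diff_within S (fun w => h w * h w) z (2 * h z * k).
  move=> hh; apply: (@diff_within_comp S setT (fun w => w * w)) hh _.
    exact: diff_within_sqr.
  by exists 1.
have h1 := sq _ _ (diff_withinD hf hg).
have h2 := diff_withinZ (-1) (diff_withinD (sq _ _ hf) (sq _ _ hg)).
apply: diff_within_ext (diff_withinZ (1/2) (diff_withinD h1 h2)) _ _.
  by move=> w /=; field.
by field.
Qed.

Lemma diff_withinN S f z l : diff_within S f z l ->
  diff_within S (fun w => - f w) z (- l).
Proof.
move=> hf; apply: diff_within_ext (diff_withinZ (-1) hf) _ _ => [w|]; ring.
Qed.

Lemma diff_withinB S f g z l m : diff_within S f z l -> diff_within S g z m ->
  diff_within S (fun w => f w - g w) z (l - m).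
Proof. by move=> hf hg; exact: diff_withinD hf (diff_withinN hg). Qed.

Lemma diff_within_inv S z : z != 0 ->
  diff_within S (fun w => w^-1) z (- (z^-1 * z^-1)).
Proof.
move=> z0 e e0; have zp : 0 < md z by rewrite md_gt0.
have k0 : 0 < md z ^+ 3 by rewrite exprn_gt0.
(* The error equals |w - z|^2 / (|w| |z|^2); the first bound gives |w| > |z| / 2, after which the
   second one is what remains to be asked. *)
exists (Num.min (md z / 2) (e * md z ^+ 3 / 2)).
  by rewrite lt_min divr_gt0// divr_gt0// mulr_gt0.
move=> w _; rewrite lt_min => /andP[h1 h2].
have wp : md z / 2 < md w.
  by have := md_subl z w; rewrite mdBC; lra.
have w0 : w != 0 by rewrite -md_gt0; lra.
have -> : w^-1 - z^-1 - - (z^-1 * z^-1) * (w - z) =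
  (w - z) * (w - z) * (w^-1 * (z^-1 * z^-1)) by field; apply/andP.
rewrite !mdM !mdV mulrAC mulrC [X in _ <= X]mulrC; apply: ler_wpM2l.
  exact: md_ge0.
rewrite -!invfM ler_pdivrMr; last by rewrite !mulr_gt0// md_gt0.
apply: le_trans (ltW h2) _.
have : 0 < e * md z ^+ 2 by rewrite mulr_gt0// exprn_gt0.
rewrite expr2; move: (md z) (md w) wp zp => p q h3 h4 h5.
by rewrite exprS expr2; nra.
Qed.

Lemma diff_withinV S f z l : diff_within S f z l -> f z != 0 ->
  diff_within S (fun w => (f w)^-1) z (- (l / (f z * f z))).
Proof.
move=> hf fz0.
have := @diff_within_comp S setT (fun w => w^-1) f z _ _
  (diff_within_inv setT fz0) hf.
move=> /(_ (ex_intro2 _ _ 1 ltr01 (fun _ _ _ => I))).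
by move=> h; apply: diff_within_ext h _ _ => //; rewrite invfM; ring.
Qed.

Lemma cont_within_eq S f g z : cont_within S f z ->
  (exists2 d : R, 0 < d & forall w, S w -> md (w - z) < d -> f w = g w) ->
  f z = g z -> cont_within S g z.
Proof.
move=> hf [d d0 fg] fgz e /hf[d' d'0 hd'].
exists (Num.min d d'); first by rewrite lt_min d0.
by move=> w Sw; rewrite lt_min => /andP[/(fg _ Sw) <- /(hd' _ Sw)]; rewrite fgz.
Qed.

Lemma cont_within_comp S T f g z :
  cont_within T f (g z) -> cont_within S g z ->
  (forall w, S w -> T (g w)) -> cont_within S (fun w => f (g w)) z.
Proof.
move=> hf hg ST e /hf[d d0 hd]; have [d' d'0 hd'] := hg _ d0.
by exists d' => // w Sw wd; apply: hd; [exact: ST|exact: hd'].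
Qed.

Lemma cont_withinD S f g z : cont_within S f z -> cont_within S g z ->
  cont_within S (fun w => f w + g w) z.
Proof.
move=> hf hg e e0; have e20 : 0 < e / 2 by lra.
have [d d0 hd] := hf _ e20; have [d' d'0 hd'] := hg _ e20.
exists (Num.min d d'); first by rewrite lt_min d0.
move=> w Sw; rewrite lt_min => /andP[/(hd _ Sw) h1 /(hd' _ Sw) h2].
have -> : f w + g w - (f z + g z) = (f w - f z) + (g w - g z) by ring.
by have := mdD (f w - f z) (g w - g z); lra.
Qed.

Lemma cont_within_cst S (c : C) z : cont_within S (fun=> c) z.
Proof. exact: diff_cont (diff_within_cst S c z). Qed.
Lemma cont_within_id S z : cont_within S id z.
Proof. exact: diff_cont (diff_within_id S z). Qed.

Lemma cont_withinM S f g z : cont_within S f z -> cont_within S g z ->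
  cont_within S (fun w => f w * g w) z.
Proof.
move=> hf hg e e0.
have F0 := md_ge0 (f z); have G0 := md_ge0 (g z).
have a0 : 0 < e / (2 * (md (g z) + 1)) by rewrite divr_gt0//; lra.
have b0 : 0 < Num.min 1 (e / (2 * (md (f z) + 1))).
  by rewrite lt_min ltr01 divr_gt0//; lra.
have [d d0 hd] := hf _ a0; have [d' d'0 hd'] := hg _ b0.
exists (Num.min d d'); first by rewrite lt_min d0.
move=> w Sw; rewrite lt_min => /andP[/(hd _ Sw) h1 /(hd' _ Sw)].
rewrite lt_min => /andP[h2 h3].
have -> : f w * g w - f z * g z = (f w - f z) * g w + f z * (g w - g z) by ring.
apply: le_lt_trans (mdD _ _) _; rewrite !mdM.
have h4 : md (g w) <= md (g z) + 1 by have := md_subl (g w) (g z); lra.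
have := md_ge0 (f w - f z); have := md_ge0 (g w - g z); have := md_ge0 (g w).
move: h1 h3; rewrite !ltr_pdivlMr; [|lra|lra].
by move=> h1 h3 *; nra.
Qed.

Lemma cont_withinN S f z : cont_within S f z -> cont_within S (fun w => - f w) z.
Proof.
move=> h; have := cont_withinM (cont_within_cst S (-1) z) h.
by move=> h'; apply: cont_within_eq h' _ _; [exists 1 => // w _ _; ring|ring].
Qed.

Lemma cont_withinB S f g z : cont_within S f z -> cont_within S g z ->
  cont_within S (fun w => f w - g w) z.
Proof. by move=> hf hg; exact: cont_withinD hf (cont_withinN hg). Qed.

Lemma cont_withinV S f z : cont_within S f z -> f z != 0 ->
  cont_within S (fun w => (f w)^-1) z.
Proof.
move=> hf f0; apply: (@cont_within_comp S setT (fun w => w^-1)) => //.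
exact: diff_cont (diff_within_inv setT f0).
Qed.

End DiffWithin.

(** * Dependent choice, nested intervals and bisection *)

Section Nested.
Context {R : realType}.
Notation C := (cplx R).

Lemma dependent_sequence (X : Type) (B : nat -> X -> Prop)
    (Q : nat -> X -> X -> Prop) (x0 : X) :
  B 0%N x0 -> (forall n x, B n x -> exists y, B n.+1 y /\ Q n x y) ->
  exists u : nat -> X, u 0%N = x0 /\ forall n, B n (u n) /\ Q n (u n) (u n.+1).
Proof.
move=> B0 BS.
have next (n : nat) (x : {x : X | B n x}) :
    {y : {y : X | B n.+1 y} | Q n (sval x) (sval y)}.
  by apply: cid; case: x => x Bx /=; have [y [By Qy]] := BS n x Bx; exists (exist _ y By).
pose s := fix s n : {x : X | B n x} :=
  if n is m.+1 then sval (next m (s m)) else exist _ x0 B0.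
exists (fun n => sval (s n)); split => // n; split; first exact: (svalP (s n)).
exact: (svalP (next n (s n))).
Qed.

Lemma real_between (lo hi : nat -> R) :
  (forall n k, lo n <= hi k) -> exists s, forall n, lo n <= s <= hi n.
Proof.
move=> lh; have ub k : ubound (range lo) (hi k) by move=> _ [n _ <-].
exists (sup (range lo)) => n; apply/andP; split.
  by apply: ub_le_sup; [exists (hi 0%N)|exists n].
by apply: ge_sup => //; exists (lo 0%N), 0%N.
Qed.

Lemma nested_real (lo hi : nat -> R) :
  (forall n, lo n <= lo n.+1) -> (forall n, hi n.+1 <= hi n) ->
  (forall n, lo n <= hi n) -> exists s, forall n, lo n <= s <= hi n.
Proof.
move=> loS hiS lohi; apply: real_between => n k.
have lom i : lo n <= lo (n + i)%N.
  by elim: i => [|i IH]; rewrite ?addn0// addnS (le_trans IH).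
have him i : hi (k + i)%N <= hi k.
  by elim: i => [|i IH]; rewrite ?addn0// addnS (le_trans _ IH).
by apply: le_trans (lom k) (le_trans (lohi _) _); rewrite addnC; exact: him.
Qed.

(* The common core of Goursat's bisection and of the choice of a point in Bloch's
   theorem: objects [x] of size [L], centred at [m x], shrink to a point [p]. *)
Lemma nested_point (X : Type) (m : X -> C) (B : X -> R -> Prop) (x0 : X) (L0 : R) :
  0 < L0 -> B x0 L0 ->
  (forall x L, 0 < L -> B x L -> exists y, B y (L / 2) /\ md (m y - m x) <= L) ->
  exists p, md (m x0 - p) <= 4 * L0 /\ forall e, 0 < e -> exists x L,
    [/\ 0 < L, L < e, B x L & md (m x - p) <= 4 * L].
Proof.
move=> L00 B0 BS; pose L n := L0 / 2 ^+ n.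
have Lp n : 0 < L n by rewrite divr_gt0// exprn_gt0.
have LS n : L n.+1 = L n / 2 by rewrite /L exprS invfM mulrCA mulrC.
have [|n x Bx|u [u0 uB]] := @dependent_sequence X (fun n x => B x (L n))
    (fun n x y => md (m y - m x) <= L n) x0.
- by rewrite /L expr0 divr1.
- by have [y [By xy]] := BS x (L n) (Lp n) Bx; exists y; rewrite LS.
have lim (f : C -> R) : (forall x y, `|f x - f y| <= md (x - y)) ->
    exists s, forall n, `|f (m (u n)) - s| <= 2 * L n.
  move=> fl; have fS n : `|f (m (u n.+1)) - f (m (u n))| <= L n.
    exact: le_trans (fl _ _) (uB n).2.
  (* These intervals are nested: the centre moves by at most [L n] while the half-width 2 * L n also
     shrinks by [L n]. *)
  have [n|n|n|s hs] := @nested_real (fun n => f (m (u n)) - 2 * L n)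
      (fun n => f (m (u n)) + 2 * L n).
  - by move: (fS n); rewrite LS ler_norml => /andP[? ?]; lra.
  - by move: (fS n); rewrite LS ler_norml => /andP[? ?]; lra.
  - by have := Lp n; lra.
  by exists s => n; rewrite ler_norml; have /andP[? ?] := hs n; apply/andP; split; lra.
have [a ha] := lim re (fun x y => ltac:(rewrite -reB; exact: re_le_md)).
have [b hb] := lim im (fun x y => ltac:(rewrite -imB; exact: im_le_md)).
have P n : md (m (u n) - (rc a + ci * rc b)) <= 4 * L n.
  apply: le_trans (md_le_reim _) _.
  rewrite reB imB !reimE !(mul0r, mul1r, mulr0, subr0, addr0, add0r).
  by have := ha n; have := hb n; lra.
exists (rc a + ci * rc b); split.
  by have := P 0%N; rewrite u0 /L expr0 divr1.
move=> e e0; have [N hN] : exists N, L N < e.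
  exists (Num.truncn (L0 / e)).+1; rewrite /L ltr_pdivrMr ?exprn_gt0// mulrC.
  rewrite -ltr_pdivrMr//; apply: lt_le_trans (truncnS_gt _) _.
  by rewrite -natrX ler_nat ltnW// ltn_expl.
by exists (u N), (L N); split => //; exact: (uB N).1.
Qed.

(** Compactness of [0, 1] in the form of Cousin's bisection: if P failed on [0, 1], a failing half
    could be chosen forever, and the halves would close in on a point t where P holds locally. It
    serves the mean value inequality, boundedness on a path and the continuation of germs. *)
Lemma segment_induction (P : R -> R -> Prop) :
  (forall t, 0 <= t <= 1 -> exists2 d, 0 < d & forall s u,
     0 <= s -> s <= t -> t <= u -> u <= 1 -> u - s < d -> P s u) ->
  (forall s t u, 0 <= s -> s <= t -> t <= u -> u <= 1 -> P s t -> P t u -> P s u) ->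
  P 0 1.
Proof.
move=> Ploc Ptrans; apply: contrapT => nP.
pose L n : R := (2 ^+ n)^-1.
have Lp n : 0 < L n by rewrite invr_gt0 exprn_gt0.
have LS n : L n.+1 = L n / 2 by rewrite /L exprS invfM mulrC.
have [|n s [s0 s1 nPs]|u [u0 uB]] := @dependent_sequence R
  (fun n s => [/\ 0 <= s, s + L n <= 1 & ~ P s (s + L n)])
  (fun n s t => s <= t /\ t + L n.+1 <= s + L n) 0.
- by rewrite /L expr0 invr1 add0r.
- have Ln := Lp n; have := LS n; set l := L n.+1 => lE.
  have [Ps|nPs'] := pselect (P s (s + l)).
    exists (s + l); split; last by split; lra.
    split; [lra|lra|move=> Ps'; apply: nPs].
    have <- : s + l + l = s + L n by lra.
    by apply: Ptrans Ps Ps'; lra.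
  by exists s; split; split => //; lra.
have [n|n|n|t ht] := @nested_real u (fun n => u n + L n).
- exact: (uB n).2.1.
- exact: (uB n).2.2.
- by have := Lp n; lra.
have t01 : 0 <= t <= 1.
  have /andP[h1 h2] := ht 0%N; have [s0 s1 _] := (uB 0%N).1.
  by apply/andP; split; lra.
have [d d0 hd] := Ploc t t01.
have [N hN] : exists N, L N < d.
  exists (Num.truncn d^-1).+1; rewrite /L invf_plt ?posrE ?exprn_gt0//.
  apply: lt_le_trans (truncnS_gt _) _.
  by rewrite -natrX ler_nat ltnW// ltn_expl.
have [s0 s1 nPs] := (uB N).1; have /andP[h1 h2] := ht N.
by apply: nPs; apply: hd => //; lra.
Qed.

End Nested.

(** * Integration along segments *)

Section Antiderivative.
Context {R : realType}.
Notation C := (cplx R).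
Implicit Types (k K f F : C -> C).

Lemma is_derive_eps (F : R -> R) (x l : R) : is_derive x 1 F l ->
  forall e, 0 < e -> exists2 d, 0 < d & forall y, `|y - x| < d ->
    `|F y - F x - l * (y - x)| <= e * `|y - x|.
Proof.
move=> [dF <-] e e0; move: dF; rewrite /derivable => dF.
have /cvgrPdist_lt/(_ e e0) : h^-1 *: ((F \o shift x) h%:A - F x) @[h --> 0^'] -->
  'D_1 F x by [].
rewrite near_withinE => /nbhs_ballP[d /= d0 hd]; exists d => // y yx.
have [->|yx0] := eqVneq y x; first by rewrite !subrr mulr0 subrr normr0 mulr0.
have yx0' : y - x != 0 by rewrite subr_eq0.
have /ltW : `|'D_1 F x - (y - x)^-1 * (F y - F x)| < e.
  have := hd (y - x); rewrite /ball /= sub0r normrN => /(_ yx yx0').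
  by rewrite /= scaler1 subrK.
move=> /(ler_wpM2r (normr_ge0 (y - x))); rewrite -normrM; apply: le_trans.
by rewrite -normrN le_eqVlt; apply/orP; left; apply/eqP; congr `|_|; field.
Qed.

Lemma real_antiderivative (r : R -> R) : continuous r ->
  exists F : R -> R, forall x : R, 0 <= x <= 1 -> is_derive x 1 F (r x).
Proof.
move=> rc; pose F := fun x : R => (\int[lebesgue_measure]_(t in [set` `[-1, x]]) r t)%R.
exists F => x /andP[x0 x1].
(* On [-1, 2] every x of [0, 1] is an interior point, so the derivative there is two-sided. *)
have [||||dF dE] := @continuous_FTC1_closed R r (-1) x 2.
- lra.
- apply: (@continuous_compact_integrable R r `[-1, 2]%classic).
    exact: segment_compact.
  exact: continuous_subspaceT.
- lra.
- exact: rc.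
apply: DeriveDef; first exact: dF.
by rewrite -derive1E; exact: dE.
Qed.

(** The parameter interval lives inside the plane, so that a path is a function of a complex
    variable and the chain rule needs no change of type. *)
Definition I01 : set C := [set z | exists2 t : R, 0 <= t <= 1 & z = rc t].

Lemma I01_rc t : 0 <= t <= 1 -> I01 (rc t). Proof. by exists t. Qed.
Lemma I01_0 : I01 0. Proof. by exists 0 => //; rewrite lexx ler01. Qed.

Definition antideriv K k := forall t, I01 t -> diff_within I01 K t (k t).

Lemma antideriv_exists k : (forall t, I01 t -> cont_within I01 k t) ->
  exists K, antideriv K k.
Proof.
(* Clamping to [0, 1] extends the integrand continuously to the whole line, as [real_antiderivative]
   demands. *)
move=> kc; pose cl (x : R) : R := Num.max 0 (Num.min 1 x).
have cl01 x : 0 <= cl x <= 1.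
  by rewrite /cl le_max lexx /= ge_max ler01 ge_min lexx.
have clid x : 0 <= x <= 1 -> cl x = x.
  by move=> /andP[x0 x1]; rewrite /cl (min_idPr _)// (max_idPr _).
have clip x y : `|cl x - cl y| <= `|x - y|.
  have H a b : a <= b -> `|cl a - cl b| <= `|a - b|.
    move=> ab; rewrite [`|a - b|]distrC (ger0_norm (x := b - a)) ?subr_ge0// distrC.
    rewrite ler_norml /cl.
    have [a1|a1] := ltP 1 a; have [b1|b1] := ltP 1 b.
    - by rewrite subrr; lra.
    - by lra.
    - by have [a0|a0] := ltP 0 a; rewrite maxEle ler01; lra.
    by have [a0|a0] := ltP 0 a; have [b0|b0] := ltP 0 b; lra.
  have [/H//|/ltW/H h] := leP x y.
  by rewrite distrC [X in _ <= X]distrC.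
have fc (f : C -> R) : (forall x y, `|f x - f y| <= md (x - y)) ->
    continuous (fun x => f (k (rc (cl x)))).
  move=> fl x; apply/cvgrPdist_lt => e e0.
  have [d d0 hd] := kc _ (I01_rc (cl01 x)) e e0.
  near=> y; apply: le_lt_trans (fl _ _) _; rewrite mdBC; apply: hd.
    exact/I01_rc/cl01.
  rewrite -rcB md_rc; apply: le_lt_trans (clip _ _) _; rewrite distrC.
  by near: y; exact: cvgr_dist_lt.
have [A hA] := real_antiderivative (fc re (fun x y => ltac:(rewrite -reB; exact: re_le_md))).
have [B hB] := real_antiderivative (fc im (fun x y => ltac:(rewrite -imB; exact: im_le_md))).
exists (fun z => rc (A (re z)) + ci * rc (B (re z))) => _ [t t01 ->] e e0.
have e20 : 0 < e / 2 by lra.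
have [d d0 hd] := is_derive_eps (hA t t01) e20.
have [d' d'0 hd'] := is_derive_eps (hB t t01) e20.
exists (Num.min d d'); first by rewrite lt_min d0.
move=> _ [s s01 ->]; rewrite -rcB md_rc lt_min !re_rc => /andP[/hd h1 /hd' h2].
apply: le_trans (md_le_reim _) _.
rewrite !(reB, imB, reM, imM, reD, imD, re_rc, im_rc, re_ci, im_ci).
rewrite !(mul0r, mul1r, mulr0, subr0, addr0, add0r) -(clid t t01).
by rewrite (clid t t01) in h1 h2 *; lra.
Unshelve. all: by end_near. Qed.

(** This replaces the mean value theorem, which fails for complex values: the inequality with slack
    [e] holds near each point and adds up over adjacent intervals. *)
Lemma antideriv_bound K k M : antideriv K k -> (forall t, I01 t -> md (k t) <= M) ->
  md (K 1 - K 0) <= M.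
Proof.
move=> hK kM; apply/ler_addgt0Pr => e e0.
rewrite -(mulr1 (M + e)) -[X in _ <= _ * X]subr0 -[X in K X]rc1 -rc0.
apply: (@segment_induction _ (fun s u => md (K (rc u) - K (rc s)) <= (M + e) * (u - s))).
  move=> t t01; have [d d0 hd] := hK _ (I01_rc t01) e e0.
  exists d => // s u s0 st tu u1 us; move: t01 => /andP[t0 t1].
  have Iu : I01 (rc u) by apply: I01_rc; lra.
  have Is : I01 (rc s) by apply: I01_rc; lra.
  have kt : md (k (rc t)) <= M by apply/kM/I01_rc; lra.
  have := hd _ Iu; have := hd _ Is; rewrite -!rcB !md_rc.
  rewrite (ler0_norm (x := s - t)) ?(ger0_norm (x := u - t)); [|lra|lra].
  move=> h1 h2; have {}h1 : md (K (rc s) - K (rc t) - k (rc t) * rc (s - t)) <= e * - (s - t).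
    by apply: h1; lra.
  have {}h2 : md (K (rc u) - K (rc t) - k (rc t) * rc (u - t)) <= e * (u - t).
    by apply: h2; lra.
  have -> : K (rc u) - K (rc s) = (K (rc u) - K (rc t) - k (rc t) * rc (u - t)) -
     (K (rc s) - K (rc t) - k (rc t) * rc (s - t)) + k (rc t) * rc (u - s).
    by rewrite !rcB; ring.
  apply: le_trans (mdD _ _) _; rewrite mdM md_rc ger0_norm; last lra.
  have := mdB (K (rc u) - K (rc t) - k (rc t) * rc (u - t))
     (K (rc s) - K (rc t) - k (rc t) * rc (s - t)).
  have := md_ge0 (k (rc t)).
  by move=> k0 h3; nra.
move=> s t u _ _ _ _ h1 h2.
by have := md_tri (K (rc u)) (K (rc t)) (K (rc s)); lra.
Qed.

Lemma antideriv_unique K F k : antideriv K k -> antideriv F k ->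
  K 1 - K 0 = F 1 - F 0.
Proof.
move=> hK hF; apply/eqP; rewrite -subr_eq0 -md_eq0 eq_le md_ge0 andbT.
have -> : K 1 - K 0 - (F 1 - F 0) = K 1 - F 1 - (K 0 - F 0) by ring.
apply: (antideriv_bound (K := fun t => K t - F t) (k := fun t => k t - k t)).
  by move=> t It; apply: diff_withinB; [exact: hK|exact: hF].
by move=> t _; rewrite subrr md0.
Qed.

(** Taking the integral to be the increment of an antiderivative turns linearity, reversal and
    splitting into rules of differentiation. *)
Definition is_int k v := exists2 K, antideriv K k & v = K 1 - K 0.

(* The integral over [0, 1]; 0 if k has no antiderivative there. *)
Definition cint k : C := xget 0 [set v | is_int k v].

Lemma is_int_unique k u v : is_int k u -> is_int k v -> u = v.
Proof. by move=> [K hK ->] [F hF ->]; exact: antideriv_unique hK hF. Qed.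

Lemma cintE k v : is_int k v -> cint k = v.
Proof. move=> kv; rewrite /cint; case: xgetP => [u _ ku|/(_ v)//].
exact: is_int_unique ku kv. Qed.

Definition cont01 k := forall t, I01 t -> cont_within I01 k t.

Lemma cintP k : cont01 k -> is_int k (cint k).
Proof.
move=> /antideriv_exists[K hK]; have kv : is_int k (K 1 - K 0) by exists K.
by rewrite (cintE kv).
Qed.

Lemma is_int_eq k k' v : is_int k v -> (forall t, I01 t -> k t = k' t) -> is_int k' v.
Proof. by move=> [K hK ->] kk'; exists K => // t It; rewrite -kk'//; exact: hK. Qed.

Lemma is_intD k k' v v' : is_int k v -> is_int k' v' ->
  is_int (fun t => k t + k' t) (v + v').
Proof.
move=> [K hK ->] [K' hK' ->]; exists (fun t => K t + K' t); last by ring.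
by move=> t It; apply: diff_withinD; [exact: hK|exact: hK'].
Qed.

Lemma is_intZ c k v : is_int k v -> is_int (fun t => c * k t) (c * v).
Proof.
move=> [K hK ->]; exists (fun t => c * K t); last by ring.
by move=> t It; apply: diff_withinZ; exact: hK.
Qed.

Lemma is_intB k k' v v' : is_int k v -> is_int k' v' ->
  is_int (fun t => k t - k' t) (v - v').
Proof.
move=> hk hk'; have := is_intD hk (is_intZ (-1) hk'); rewrite mulN1r => h.
by apply: is_int_eq h _ => t _; rewrite mulN1r.
Qed.

Lemma is_int_bound k v M : is_int k v -> (forall t, I01 t -> md (k t) <= M) ->
  md v <= M.
Proof. by move=> [K hK ->]; exact: antideriv_bound. Qed.

Lemma is_int_cst c : is_int (fun=> c) c.
Proof.
exists (fun t => c * t); last by rewrite mulr0 subr0 mulr1.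
by move=> t _; apply: diff_within_ext (diff_withinZ c (diff_within_id _ t)) _ _ => //; ring.
Qed.

Lemma I01_rev t : I01 t -> I01 (1 - t).
Proof. by move=> [s s01 ->]; exists (1 - s); [lra|rewrite rcB]. Qed.

Lemma diff_within_affine S (a b z : C) : diff_within S (fun w => a + b * w) z b.
Proof.
apply: diff_within_ext (diff_withinD (diff_within_cst S a z)
  (diff_withinZ b (diff_within_id S z))) _ _ => //; ring.
Qed.

Lemma antideriv_affine K k (a b : C) :
  (forall t, I01 t -> I01 (a + b * t)) -> antideriv K k ->
  antideriv (fun t => K (a + b * t)) (fun t => k (a + b * t) * b).
Proof.
move=> ab hK t It; apply: (@diff_within_comp _ I01 I01 K).
- exact/hK/ab.
- exact: diff_within_affine.
- by exists 1 => // w Iw _; exact: ab.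
Qed.

Lemma is_int_rev k v : is_int k v -> is_int (fun t => - k (1 - t)) (- v).
Proof.
move=> [K hK ->]; exists (fun t => K (1 + -1 * t)); last first.
  by rewrite mulr0 mulr1 addr0 subrr opprB.
have rev s : I01 s -> I01 (1 + -1 * s) by rewrite mulN1r; exact: I01_rev.
by move=> t It; have := antideriv_affine rev hK It; rewrite mulrN1 mulN1r.
Qed.

Lemma is_int_split k v : is_int k v -> exists v1 v2,
  [/\ is_int (fun t => k (t / 2) / 2) v1,
      is_int (fun t => k ((1 + t) / 2) / 2) v2 & v = v1 + v2].
Proof.
move=> [K hK ->].
have two : (2 : C) != 0 by rewrite pnatr_eq0.
have half : (1 / 2 : C) = rc (1 / 2) by rewrite rcM rcV rc_nat.
exists (K (1 / 2) - K 0), (K 1 - K (1 / 2)); split; last by ring.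
- exists (fun t => K (0 + 1/2 * t)); last by rewrite mulr0 mulr1 !add0r.
  have h s : I01 s -> I01 (0 + 1 / 2 * s).
    by move=> [u u01 ->]; exists (1 / 2 * u); [lra|rewrite half -rcM add0r].
  move=> t It; apply: diff_within_ext (antideriv_affine h hK It) _ _ => //.
  by rewrite add0r !mul1r; congr (k _ * _); rewrite mulrC.
- exists (fun t => K (1/2 + 1/2 * t)); last first.
    by rewrite mulr0 mulr1 addr0; congr (K _ - K _); field.
  have h s : I01 s -> I01 (1 / 2 + 1 / 2 * s).
    move=> [u u01 ->]; exists (1 / 2 + 1 / 2 * u); first lra.
    by rewrite half -rcM -rcD.
  move=> t It; apply: diff_within_ext (antideriv_affine h hK It) _ _ => //.
  by rewrite !mul1r; congr (k _ * _); field.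
Qed.

End Antiderivative.

(** * Goursat's theorem and primitives *)

Section Goursat.
Context {R : realType}.
Notation C := (cplx R).
Implicit Types (K : set C) (f F q : C -> C) (a b c z w p : C).

Definition convex K := forall a b t, K a -> K b -> I01 t -> K (a + t * (b - a)).
Definition cont_on K f := forall z, K z -> cont_within K f z.

Definition segint f a b : C := cint (fun t => f (a + t * (b - a)) * (b - a)).

Lemma cont_on_seg K f a b : convex K -> cont_on K f -> K a -> K b ->
  cont01 (fun t => f (a + t * (b - a)) * (b - a)).
Proof.
move=> Kc fc Ka Kb t It; apply: cont_withinM; last exact: cont_within_cst.
apply: (cont_within_comp (T := K)).
- by apply: fc; exact: Kc.
- apply: cont_withinD; first exact: cont_within_cst.
  by apply: cont_withinM; [exact: cont_within_id|exact: cont_within_cst].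
- by move=> w Iw; exact: Kc.
Qed.

Lemma segintP K f a b : convex K -> cont_on K f -> K a -> K b ->
  is_int (fun t => f (a + t * (b - a)) * (b - a)) (segint f a b).
Proof. by move=> Kc fc Ka Kb; exact: cintP (cont_on_seg Kc fc Ka Kb). Qed.

Lemma segint_rev K f a b : convex K -> cont_on K f -> K a -> K b ->
  segint f b a = - segint f a b.
Proof.
move=> Kc fc Ka Kb; apply: cintE; apply: is_int_eq (is_int_rev (segintP Kc fc Ka Kb)) _.
move=> t _; rewrite -mulrN opprB; congr (f _ * _); ring.
Qed.

Definition mid a b : C := (a + b) / 2.

Lemma convex_mid K a b : convex K -> K a -> K b -> K (mid a b).
Proof.
move=> Kc Ka Kb; have : K (a + rc (1 / 2) * (b - a)).
  by apply: Kc => //; apply: I01_rc; lra.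
have -> : rc (1 / 2) = 1 / 2 :> C by rewrite rcM rcV rc_nat.
by have -> : a + 1 / 2 * (b - a) = mid a b by rewrite /mid; field.
Qed.

Lemma segint_mid K f a b : convex K -> cont_on K f -> K a -> K b ->
  segint f a b = segint f a (mid a b) + segint f (mid a b) b.
Proof.
move=> Kc fc Ka Kb; have [v1 [v2 [h1 h2 ->]]] := is_int_split (segintP Kc fc Ka Kb).
congr (_ + _); apply/esym/cintE.
  by apply: is_int_eq h1 _ => t _; rewrite -mulrA; congr (f _ * _); rewrite /mid; field.
by apply: is_int_eq h2 _ => t _; rewrite -mulrA; congr (f _ * _); rewrite /mid; field.
Qed.

Lemma segint_bound K f a b (M : R) : convex K -> cont_on K f -> K a -> K b ->
  (forall t, I01 t -> md (f (a + t * (b - a))) <= M) ->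
  md (segint f a b) <= M * md (b - a).
Proof.
move=> Kc fc Ka Kb fM; apply: is_int_bound (segintP Kc fc Ka Kb) _ => t It.
by rewrite mdM ler_wpM2r ?md_ge0// fM.
Qed.

Lemma segint_FTC K f F a b : convex K -> K a -> K b ->
  (forall z, K z -> diff_within K F z (f z)) -> segint f a b = F b - F a.
Proof.
move=> Kc Ka Kb hF; apply: cintE; exists (fun t => F (a + t * (b - a))); last first.
  by rewrite mul0r addr0 mul1r [a + _]addrC subrK.
move=> t It; apply: (diff_within_comp (T := K)).
- by apply: hF; exact: Kc.
- by apply: diff_within_ext (diff_within_affine _ a (b - a) _) _ _ => // w; rewrite mulrC.
- by exists 1 => // w Iw _; exact: Kc.
Qed.

Lemma segintB K f q a b : convex K -> cont_on K f -> cont_on K q -> K a -> K b ->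
  segint (fun z => f z - q z) a b = segint f a b - segint q a b.
Proof.
move=> Kc fc qc Ka Kb; apply: cintE.
apply: is_int_eq (is_intB (segintP Kc fc Ka Kb) (segintP Kc qc Ka Kb)) _ => t _.
by rewrite mulrBl.
Qed.

Lemma segint_same f a : segint f a a = 0.
Proof.
by apply: cintE; apply: is_int_eq (is_int_cst 0) _ => t _; rewrite subrr mulr0.
Qed.

Definition triint f a b c := segint f a b + segint f b c + segint f c a.

(** The edges of the medial triangle are each traversed in both directions and cancel. *)
Lemma triint_split K f a b c : convex K -> cont_on K f -> K a -> K b -> K c ->
  triint f a b c = triint f a (mid a b) (mid c a) + triint f (mid a b) b (mid b c)
    + triint f (mid c a) (mid b c) c + triint f (mid a b) (mid b c) (mid c a).
Proof.
move=> Kc fc Ka Kb Kc'; rewrite /triint.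
have Km := convex_mid Kc.
rewrite (segint_mid Kc fc Ka Kb) (segint_mid Kc fc Kb Kc') (segint_mid Kc fc Kc' Ka).
rewrite (segint_rev Kc fc (Km _ _ Ka Kb) (Km _ _ Kb Kc')).
rewrite (segint_rev Kc fc (Km _ _ Kb Kc') (Km _ _ Kc' Ka)).
rewrite (segint_rev Kc fc (Km _ _ Kc' Ka) (Km _ _ Ka Kb)).
ring.
Qed.

Lemma mid_subl a b : mid a b - a = (b - a) / 2.
Proof. by rewrite /mid; field. Qed.
Lemma mid_subr a b : mid a b - b = (a - b) / 2.
Proof. by rewrite /mid; field. Qed.
Lemma mid_sub a b c : mid a b - mid c a = (b - c) / 2.
Proof. by rewrite /mid; field. Qed.
Lemma midC a b : mid a b = mid b a.
Proof. by rewrite /mid addrC. Qed.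
Lemma md_half z : md (z / 2) = md z / 2.
Proof. by rewrite mdf md_nat. Qed.

(** One of the four half-size triangles keeps a quarter of the integral, so the bound [del] L^2
    survives every bisection. The triangles shrink to a point p, in K because K is closed, near
    which f is affine up to a small relative error; the affine part has a primitive and contributes
    nothing. *)
Lemma goursat K f a b c : convex K ->
  (forall p, (forall e : R, 0 < e -> exists2 w, K w & md (w - p) < e) -> K p) ->
  (forall z, K z -> exists l, diff_within K f z l) ->
  K a -> K b -> K c -> triint f a b c = 0.
Proof.
move=> Kc Kcl fd Ka Kb Kc'; have fc : cont_on K f.
  by move=> z /fd[l]; exact: diff_cont.
have Km := convex_mid Kc.
apply/eqP; rewrite -md_eq0; apply: contraT => T0.
have {}T0 : 0 < md (triint f a b c) by rewrite lt_def md_ge0 T0.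
pose L0 := 1 + md (a - b) + md (b - c) + md (c - a).
have hab := md_ge0 (a - b); have hbc := md_ge0 (b - c); have hca := md_ge0 (c - a).
have L00 : 0 < L0 by rewrite /L0; lra.
pose del := md (triint f a b c) / L0 ^+ 2.
have del0 : 0 < del by rewrite divr_gt0// exprn_gt0.
pose B (x : C * C * C) (L : R) := let: (a, b, c) := x in
  [/\ K a /\ K b /\ K c, md (a - b) <= L, md (b - c) <= L, md (c - a) <= L &
    del * L ^+ 2 <= md (triint f a b c)].
have [||p [_ hp]] := @nested_point R _ (fun x => x.1.1) B (a, b, c) L0 L00.
- split => //; rewrite /L0; [lra|lra|lra|].
  by rewrite /del divfK// expf_neq0// gt_eqF.
- move=> [[a1 b1] c1] L Lp [[Ka1 [Kb1 Kc1]] /= ab bc ca TL].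
  have := triint_split Kc fc Ka1 Kb1 Kc1.
  set T1 := triint f a1 (mid _ _) _; set T2 := triint f (mid _ _) b1 _; set T3 := triint f (mid _ _) _ c1.
  set T4 := triint f (mid _ _) (mid _ _) (mid _ _) => TE.
  have q : exists2 T, T \in [:: T1; T2; T3; T4] & del * (L / 2) ^+ 2 <= md T.
    have -> : del * (L / 2) ^+ 2 = del * L ^+ 2 / 4 by field.
    apply: contrapT => nq.
    have h T : T \in [:: T1; T2; T3; T4] -> md T < del * L ^+ 2 / 4.
      by move=> Ti; rewrite ltNge; apply/negP => Tl; apply: nq; exists T.
    have := h T1; have := h T2; have := h T3; have := h T4.
    rewrite !inE !eqxx !orbT => /(_ isT) h4 /(_ isT) h3 /(_ isT) h2 /(_ isT) h1.
    have := mdD (T1 + T2 + T3) T4; have := mdD (T1 + T2) T3; have := mdD T1 T2.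
    by rewrite -TE; lra.
  have H z w : md (z - w) <= L -> md ((z - w) / 2) <= L / 2 /\ md ((w - z) / 2) <= L / 2.
    by rewrite !md_half [md (w - z)]mdBC; split; lra.
  have [ab1 ab2] := H _ _ ab; have [bc1 bc2] := H _ _ bc; have [ca1 ca2] := H _ _ ca.
  case: q => T; rewrite !inE => /or4P[]/eqP-> hT.
  + exists (a1, mid a1 b1, mid c1 a1); split; last by rewrite /= subrr md0 ltW.
    split => //.
    * by do !split => //; exact: Km.
    * by rewrite mdBC mid_subl.
    * by rewrite mid_sub.
    * by rewrite mid_subr.
  + exists (mid a1 b1, b1, mid b1 c1); split; last by rewrite /= mid_subl md_half mdBC; lra.
    split => //.
    * by do !split => //; exact: Km.
    * by rewrite mid_subr.
    * by rewrite mdBC mid_subl.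
    * by rewrite mid_sub.
  + exists (mid c1 a1, mid b1 c1, c1); split; last by rewrite /= mid_subr md_half; lra.
    split => //.
    * by do !split => //; exact: Km.
    * by rewrite mid_sub.
    * by rewrite mid_subr.
    * by rewrite mdBC mid_subl.
  + exists (mid a1 b1, mid b1 c1, mid c1 a1); split; last by rewrite /= mid_subl md_half mdBC; lra.
    split => //.
    * by do !split => //; exact: Km.
    * by rewrite mdBC mid_sub.
    * by rewrite mdBC mid_sub.
    * by rewrite mdBC mid_sub.
have Kp : K p.
  apply: Kcl => e e0; have [|x [L [Lp Le Bx px]]] := hp (e / 5); first lra.
  by exists x.1.1; [case: x Bx px => [[? ?] ?] [[]]|lra].
have [l hl] := fd p Kp.
(* The points of the final triangle lie within 6 L of p and its edges have length at most L, so the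
   three edges contribute at most 3 * 6 / 19 of [del] L^2, which is too little. *)
have e0 : 0 < del / 19 by rewrite divr_gt0.
have [d d0 hd] := hl _ e0.
have [|[[a' b'] c'] [L [Lp Ld [[Ka' [Kb' Kc'']] ab bc ca TL] px]]] := hp (d / 7); first lra.
pose Q z := f p + l * (z - p).
have Qc : cont_on K Q.
  move=> z _; apply: cont_withinD; first exact: cont_within_cst.
  apply: cont_withinM; first exact: cont_within_cst.
  by apply: cont_withinB; [exact: cont_within_id|exact: cont_within_cst].
have Qd z : K z -> diff_within K (fun z => f p * z + l / 2 * ((z - p) * (z - p))) z (Q z).
  move=> _; have dp : diff_within K (fun z => z - p) z 1.
    apply: diff_within_ext (diff_withinB (diff_within_id _ z) (diff_within_cst K p z)) _ _ => //.
    by rewrite subr0.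
  apply: diff_within_ext (diff_withinD (diff_withinZ (f p) (diff_within_id _ z))
    (diff_withinZ (l / 2) (diff_withinM dp dp))) _ _ => //.
  by rewrite /Q; field.
have key x y : K x -> K y -> md (x - p) <= 5 * L -> md (y - p) <= 5 * L ->
    md (x - y) <= L -> md (segint f x y - segint Q x y) <= del / 19 * (6 * L) * L.
  move=> Kx Ky xp yp xy; rewrite -(segintB Kc)//.
  apply: le_trans (segint_bound (K := K) (M := del / 19 * (6 * L)) Kc _ Kx Ky _) _.
  - by move=> z Kz; apply: cont_withinB; [exact: fc|exact: Qc].
  - move=> t It; set z := x + _.
    have Kz : K z by exact: Kc.
    have zp : md (z - p) <= 6 * L.
      rewrite /z addrAC; apply: le_trans (mdD _ _) _; rewrite mdM.
      have : md t <= 1 by case: It => s /andP[s0 s1] ->; rewrite md_rc ger0_norm.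
      have := md_ge0 t; have := md_ge0 (x - y); rewrite (mdBC y x); nra.
    have -> : f z - Q z = f z - f p - l * (z - p) by rewrite /Q; ring.
    apply: le_trans (hd z Kz _) _; first lra.
    by apply: ler_wpM2l => //; rewrite ltW.
  - rewrite mdBC; apply: ler_wpM2l => //.
    by apply: mulr_ge0; [rewrite ltW|rewrite mulr_ge0// ltW].
have QT : triint Q a' b' c' = 0.
  by rewrite /triint !(segint_FTC Kc _ _ Qd)//; ring.
have pb : md (b' - p) <= 5 * L.
  have := md_tri b' a' p; rewrite (mdBC b' a'); rewrite /= in px; lra.
have pc : md (c' - p) <= 5 * L.
  have := md_tri c' a' p; rewrite /= in px; lra.
have k1 := key a' b' Ka' Kb'; have k2 := key b' c' Kb' Kc''; have k3 := key c' a' Kc'' Ka'.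
have {k1} k1 : md (segint f a' b' - segint Q a' b') <= del / 19 * (6 * L) * L.
  by apply: k1 => //; rewrite /= in px; lra.
have {k2} k2 : md (segint f b' c' - segint Q b' c') <= del / 19 * (6 * L) * L.
  exact: k2.
have {k3} k3 : md (segint f c' a' - segint Q c' a') <= del / 19 * (6 * L) * L.
  by apply: k3 => //; rewrite /= in px; lra.
have TE : triint f a' b' c' = (segint f a' b' - segint Q a' b') +
  (segint f b' c' - segint Q b' c') + (segint f c' a' - segint Q c' a').
  by rewrite -[LHS]subr0 -QT /triint; ring.
have := mdD ((segint f a' b' - segint Q a' b') + (segint f b' c' - segint Q b' c'))
  (segint f c' a' - segint Q c' a').
have := mdD (segint f a' b' - segint Q a' b') (segint f b' c' - segint Q b' c').
rewrite -TE => h1 h2.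
have : 0 < del * L ^+ 2 by rewrite mulr_gt0// exprn_gt0.
have : del / 19 * (6 * L) * L = 6 / 19 * (del * L ^+ 2) by field.
by lra.
Qed.

End Goursat.

(** * Primitives on a disc, with one exceptional point *)

Section Primitive.
Context {R : realType}.
Notation C := (cplx R).
Implicit Types (f F : C -> C) (a b c z w q v : C) (r : R).

Definition disc a r : set C := [set z | md (z - a) < r].
Definition cdiff f z l := diff_within setT f z l.
Definition holo (D : set C) f := forall z, D z -> exists l, cdiff f z l.

Lemma convex_disc a r : convex (disc a r).
Proof.
move=> x y _ xa ya [t /andP[t0 t1] ->]; rewrite /disc /=.
have -> : x + rc t * (y - x) - a = rc (1 - t) * (x - a) + rc t * (y - a).
  by rewrite rcB rc1; ring.
apply: le_lt_trans (mdD _ _) _; rewrite !mdM !md_rc !ger0_norm//; last lra.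
rewrite /disc /= in xa ya.
have [->|t0'] := eqVneq t 0; first by lra.
have {t0'}t0 : 0 < t by rewrite lt_def t0' t0.
have : t * md (y - a) < t * r by rewrite ltr_pM2l.
have : (1 - t) * md (x - a) <= (1 - t) * r by apply: ler_wpM2l; lra.
by lra.
Qed.

Lemma disc_center a r : 0 < r -> disc a r a.
Proof. by rewrite /disc /= subrr md0. Qed.

Lemma disc_open a r z : disc a r z -> exists2 d : R, 0 < d &
  forall w, md (w - z) < d -> disc a r w.
Proof.
rewrite /disc /= => za; exists (r - md (z - a)); first lra.
by move=> w wz; have := md_tri w z a; lra.
Qed.

(** The real inner product of the plane, used to cut discs by half-planes. *)
Definition dotc z w : R := re z * re w + im z * im w.

Lemma dotc_le z w : `|dotc z w| <= md z * md w.
Proof.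
rewrite -(ler_pXn2r (n := 2)) ?nnegrE ?mulr_ge0 ?md_ge0//.
rewrite exprMn !md_sqr real_normK ?num_real// /dotc.
have := sqr_ge0 (re z * im w - im z * re w); rewrite !expr2; lra.
Qed.

Lemma dotcc z : dotc z z = md z ^+ 2.
Proof. by rewrite md_sqr /dotc !expr2. Qed.
Lemma dotcDl z z' w : dotc (z + z') w = dotc z w + dotc z' w.
Proof. by rewrite /dotc reD imD; ring. Qed.
Lemma dotcZl (t : R) z w : dotc (rc t * z) w = t * dotc z w.
Proof. by rewrite /dotc !reimE !mul0r subr0 addr0; ring. Qed.

Lemma convex_halfdisc a r q v (e : R) :
  convex [set w | md (w - a) <= r /\ e <= dotc (w - q) v].
Proof.
move=> x y _ [xa xq] [ya yq] [t /andP[t0 t1] ->] /=; split.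
  have -> : x + rc t * (y - x) - a = rc (1 - t) * (x - a) + rc t * (y - a).
    by rewrite rcB rc1; ring.
  apply: le_trans (mdD _ _) _; rewrite !mdM !md_rc !ger0_norm//; last lra.
  have : t * md (y - a) <= t * r by apply: ler_wpM2l.
  have : (1 - t) * md (x - a) <= (1 - t) * r by apply: ler_wpM2l; lra.
  by lra.
have -> : x + rc t * (y - x) - q = rc (1 - t) * (x - q) + rc t * (y - q).
  by rewrite rcB rc1; ring.
rewrite dotcDl !dotcZl.
have : t * e <= t * dotc (y - q) v by apply: ler_wpM2l.
have : (1 - t) * e <= (1 - t) * dotc (x - q) v by apply: ler_wpM2l; lra.
by lra.
Qed.

Lemma closed_halfdisc a r q v (e : R) p :
  let K := [set w | md (w - a) <= r /\ e <= dotc (w - q) v] in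
  (forall e : R, 0 < e -> exists2 w, K w & md (w - p) < e) -> K p.
Proof.
move=> K hK; split.
  apply/ler_addgt0Pr => d d0; have [w [wa _] wp] := hK d d0.
  by have := md_tri p w a; rewrite (mdBC p w); lra.
apply/ler_addgt0Pr => d d0.
have v0 : 0 < md v + 1 by have := md_ge0 v; lra.
have [w [_ wq] wp] := hK _ (divr_gt0 d0 v0).
have wpE : w - q = (w - p) + (p - q) by ring.
rewrite wpE dotcDl in wq; have := dotc_le (w - p) v.
rewrite ler_norml => /andP[_ h].
have : md (w - p) * md v <= d.
  move: wp; rewrite ltr_pdivlMr// => /ltW; have := md_ge0 (w - p); lra.
by lra.
Qed.

Lemma cdiff_within S f z l : cdiff f z l -> diff_within S f z l.
Proof. exact: diff_withinW. Qed.

Section Exceptional.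
Variables (f : C -> C) (a : C) (r : R) (q : C).
Hypothesis qD : disc a r q.
Hypothesis fc : forall z, disc a r z -> cont_within setT f z.
Hypothesis fd : forall z, disc a r z -> z != q -> exists l, cdiff f z l.

Let fcD : cont_on (disc a r) f.
Proof. by move=> z /fc; exact: cont_withinW. Qed.

(* Three of the four half-size triangles stay in a half-disc away from q, where
   Goursat's theorem applies. *)
Let thin_step b c : disc a r b -> disc a r c -> md (c - b) < md (b - q) ->
  triint f q b c = triint f q (mid q b) (mid c q).
Proof.
move=> Db Dc cb; have Dm := convex_mid (convex_disc (a := a) (r := r)).
have Dqb := Dm _ _ qD Db; have Dcq := Dm _ _ Dc qD; have Dbc := Dm _ _ Db Dc.
rewrite (triint_split (convex_disc (r := r)) fcD qD Db Dc).
(* Both b - q and c - q have inner product at least 2 * e with [v], so even the midpoints of q with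
   b and c stay in the half-plane at level [e]. *)
pose v := b - q; pose e := (md v ^+ 2 - md (c - b) * md v) / 2.
have e0 : 0 < e.
  have : 0 <= md (c - b) by exact: md_ge0.
  by rewrite /e /v expr2; move: cb; move: (md (c - b)) (md (b - q)) => x y; nra.
have [s sr hs] : exists2 s : R, s < r & forall z, z \in [:: q; b; c] -> md (z - a) <= s.
  exists (Num.max (md (q - a)) (Num.max (md (b - a)) (md (c - a)))).
    by rewrite !gt_max; apply/and3P; split.
  by move=> z; rewrite !inE => /or3P[]/eqP->; rewrite !le_max lexx ?orbT.
have mids x y : md (x - a) <= s -> md (y - a) <= s -> md (mid x y - a) <= s.
  move=> xs ys; have -> : mid x y - a = ((x - a) + (y - a)) / 2 by rewrite /mid; field.
  by rewrite md_half; have := mdD (x - a) (y - a); lra.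
have qs : md (q - a) <= s by apply: hs; rewrite !inE eqxx.
have bs : md (b - a) <= s by apply: hs; rewrite !inE eqxx orbT.
have cs : md (c - a) <= s by apply: hs; rewrite !inE eqxx !orbT.
pose K := [set w | md (w - a) <= s /\ e <= dotc (w - q) v].
have T0 x y z : K x -> K y -> K z -> triint f x y z = 0.
  apply: (goursat (K := K)).
  - exact: convex_halfdisc.
  - exact: closed_halfdisc.
  - move=> w [ws we]; have [||l hl] := fd (z := w); [by rewrite /disc/=; lra| |].
      apply/eqP => wq; move: we; rewrite wq subrr /dotc /= !mul0r; lra.
    by exists l; exact: cdiff_within.
have bv : dotc (b - q) v = md v ^+ 2 by rewrite dotcc.
have v20 : 0 <= md v ^+ 2 by rewrite sqr_ge0.
have mv0 : 0 <= md (c - b) * md v by rewrite mulr_ge0 ?md_ge0.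
have half x y : mid x y - q = rc (1 / 2) * ((x - q) + (y - q)).
  by rewrite rcM rcV rc_nat rc1 /mid; field.
have cv : 2 * e <= dotc (c - q) v.
  have -> : c - q = (c - b) + (b - q) by ring.
  rewrite dotcDl bv; have := dotc_le (c - b) v; rewrite ler_norml => /andP[h _].
  by rewrite /e; lra.
have qv : dotc (q - q) v = 0 by rewrite subrr /dotc /= !mul0r addr0.
have Kb : K b by split => //; rewrite bv /e; lra.
have Kc : K c by split => //; lra.
have Kqb : K (mid q b).
  by split; [exact: mids|rewrite half dotcZl dotcDl qv bv /e; lra].
have Kcq : K (mid c q) by split; [exact: mids|rewrite half dotcZl dotcDl qv; lra].
have Kbc : K (mid b c).
  by split; [exact: mids|rewrite half dotcZl dotcDl bv; rewrite /e in cv *; lra].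
by rewrite (T0 (mid q b) b)// (T0 (mid c q) (mid b c))// (T0 (mid q b) (mid b c))// !addr0.
Qed.

(** Halving towards q does not change the integral, by [thin_step], while its bound, a constant
    times the perimeter, tends to 0. *)
Lemma thin_triangle b c : disc a r b -> disc a r c -> md (c - b) < md (b - q) ->
  triint f q b c = 0.
Proof.
move=> Db Dc cb.
pose s n x : C := q + (x - q) / 2 ^+ n.
have s2 n x : s n.+1 x = mid q (s n x).
  by rewrite /s /mid exprS; field; rewrite expf_neq0// pnatr_eq0.
have sD n x : disc a r x -> disc a r (s n x).
  move=> Dx; elim: n => [|n IH]; first by rewrite /s expr0 divr1 addrC subrK.
  by rewrite s2; apply: convex_mid => //; exact: convex_disc.
have smd n x : md (s n x - q) = md (x - q) / 2 ^+ n.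
  by rewrite /s addrAC subrr add0r mdf mdX md_nat.
have sBmd n x y : md (s n x - s n y) = md (x - y) / 2 ^+ n.
  have -> : s n x - s n y = (x - y) / 2 ^+ n by rewrite /s; ring.
  by rewrite mdf mdX md_nat.
have p2 n : 0 < 2 ^+ n :> R by rewrite exprn_gt0.
have Tn n : triint f q b c = triint f q (s n b) (s n c).
  elim: n => [|n ->]; first by rewrite /s expr0 !divr1 ![q + _]addrC !subrK.
  rewrite thin_step ?s2 1?(midC (s n c))//; [exact: sD|exact: sD|].
  by rewrite sBmd smd ltr_pM2r// invr_gt0.
have [d d0 hd] := fc qD ltr01.
apply: md_small_eq0 => e e0.
pose P := md (b - q) + md (c - b) + md (q - c).
have Pb := md_ge0 (b - q); have Pcb := md_ge0 (c - b); have Pc := md_ge0 (q - c).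
have P0 : 0 <= P by rewrite /P; lra.
pose M := md (f q) + 1; have M0 : 0 < M by rewrite /M; have := md_ge0 (f q); lra.
have [n hn] : exists n, (P + 1) / 2 ^+ n < Num.min d (e / M).
  have m0 : 0 < Num.min d (e / M) by rewrite lt_min d0 divr_gt0.
  exists (Num.truncn ((P + 1) / Num.min d (e / M))).+1.
  rewrite ltr_pdivrMr// mulrC -ltr_pdivrMr//; apply: lt_le_trans (truncnS_gt _) _.
  by rewrite -natrX ler_nat ltnW// ltn_expl.
move: hn; rewrite lt_min => /andP[nd ne].
have Dq : disc q d q by exact: disc_center.
have le2 x : x <= P -> x / 2 ^+ n < d.
  by move=> xP; apply: le_lt_trans nd; rewrite ler_pM2r ?invr_gt0//; lra.
have Dqb : disc q d (s n b) by rewrite /disc /= smd; apply: le2; rewrite /P; lra.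
have Dqc : disc q d (s n c).
  by rewrite /disc /= smd mdBC; apply: le2; rewrite /P; lra.
have seg x y : disc a r x -> disc a r y -> disc q d x -> disc q d y ->
    md (segint f x y) <= M * md (y - x).
  move=> Dx Dy qx qy; apply: (segint_bound (convex_disc (r := r)) fcD) => // t It.
  have := hd (x + t * (y - x)) I (convex_disc qx qy It).
  have := md_subl (f (x + t * (y - x))) (f q); rewrite /M; lra.
rewrite (Tn n) /triint.
have h1 := seg _ _ qD (sD n b Db) Dq Dqb.
have h2 := seg _ _ (sD n b Db) (sD n c Dc) Dqb Dqc.
have h3 := seg _ _ (sD n c Dc) qD Dqc Dq.
have := mdD (segint f q (s n b) + segint f (s n b) (s n c)) (segint f (s n c) q).
have := mdD (segint f q (s n b)) (segint f (s n b) (s n c)).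
rewrite sBmd smd in h2 h1 *; rewrite (mdBC q) smd (mdBC c) in h3.
move: ne; rewrite ltr_pdivlMr// => ne.
have : M * (md (b - q) / 2 ^+ n) + M * (md (c - b) / 2 ^+ n) +
  M * (md (q - c) / 2 ^+ n) <= M * ((P + 1) / 2 ^+ n).
  rewrite -!mulrDr ler_pM2l// -!mulrDl ler_pM2r ?invr_gt0// /P; lra.
by lra.
Qed.

(** Integrating from q itself, only triangles with vertex q matter, and for the derivative at z only
    those whose opposite side is short. The exceptional point is allowed for the sake of difference
    quotients, which are continuous at q before they are known to be differentiable there. *)
Lemma primitive_exceptional : exists F, forall z, disc a r z -> cdiff F z (f z).
Proof.
exists (fun z => segint f q z) => z Dz e e0.
have cD := convex_disc (a := a) (r := r).
have [d d0 hd] := fc Dz e0.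
have [d1 d10 hd1] := disc_open Dz.
have [d2 d20 hd2] : exists2 d2 : R, 0 < d2 & forall w, md (w - z) < d2 ->
    disc a r w -> triint f q z w = 0.
  have [->|zq] := eqVneq z q.
    exists 1 => // w _ Dw; rewrite /triint segint_same add0r.
    by rewrite (segint_rev cD fcD qD Dw) subrr.
  exists (md (z - q)); first by rewrite md_gt0 subr_eq0.
  by move=> w wz Dw; exact: thin_triangle.
exists (Num.min d (Num.min d1 d2)); first by rewrite !lt_min d0 d10.
move=> w _; rewrite !lt_min => /and3P[wd /hd1 Dw /hd2/(_ Dw)].
rewrite /triint (segint_rev cD fcD qD Dw) => T0.
have -> : segint f q w - segint f q z = segint f z w by apply/eqP; rewrite -subr_eq0;
  rewrite -oppr_eq0 -T0; apply/eqP; ring.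
have cc : cont_on (disc a r) (fun=> f z) by move=> ? _; exact: cont_within_cst.
have <- : segint (fun=> f z) z w = f z * (w - z).
  rewrite (segint_FTC (F := fun x => f z * x) cD Dz Dw) ?mulrBr// => x _.
  by apply: diff_within_ext (diff_withinZ (f z) (diff_within_id _ x)) _ _ => //; rewrite mulr1.
rewrite -(segintB cD)//; apply: (segint_bound cD) => //.
  by move=> x Dx; apply: cont_withinB; [exact: fcD|exact: cc].
move=> t It; apply: ltW; apply: hd => //.
by apply: (@convex_disc z d) => //; exact: disc_center.
Qed.

End Exceptional.

Lemma primitive_holo f a r : 0 < r -> holo (disc a r) f ->
  exists F, forall z, disc a r z -> cdiff F z (f z).
Proof.
move=> r0 hf; apply: (primitive_exceptional (q := a)).
- exact: disc_center.
- by move=> z /hf[l]; exact: diff_cont.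
- by move=> z /hf.
Qed.

End Primitive.

(** * The complex exponential *)

Section ComplexExponential.
Context {R : realType}.
Notation C := (cplx R).
Implicit Types (z w u : C).

Definition cexp z : C := rc (expR (re z)) * (rc (cos (im z)) + ci * rc (sin (im z))).

Lemma cexp0 : cexp 0 = 1.
Proof. by rewrite /cexp /= expR0 cos0 sin0 rc0 mulr0 addr0 mulr1. Qed.

Lemma cexpD z w : cexp (z + w) = cexp z * cexp w.
Proof.
rewrite /cexp reD imD expRD cosD sinD !(rcM, rcB, rcD).
transitivity (rc (expR (re z)) * rc (expR (re w)) *
  (rc (cos (im z)) * rc (cos (im w)) + ci * ci * (rc (sin (im z)) * rc (sin (im w))) +
  ci * (rc (sin (im z)) * rc (cos (im w)) + rc (cos (im z)) * rc (sin (im w))))).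
  by rewrite ci2; ring.
by ring.
Qed.

Lemma md_cexp z : md (cexp z) = expR (re z).
Proof.
rewrite /cexp mdM md_rc ger0_norm ?expR_ge0// [X in _ * X]mdE.
by rewrite !reimE !(mul0r, mul1r, mulr0, subr0, addr0, add0r) cos2Dsin2 sqrtr1 mulr1.
Qed.

Lemma cexp_neq0 z : cexp z != 0.
Proof. by rewrite -md_gt0 md_cexp expR_gt0. Qed.

Lemma cexpN z : cexp (- z) = (cexp z)^-1.
Proof.
by apply: (mulfI (cexp_neq0 z)); rewrite -cexpD subrr cexp0 mulfV// cexp_neq0.
Qed.

Lemma cexpMn z n : cexp (n%:R * z) = cexp z ^+ n.
Proof.
elim: n => [|n IH]; first by rewrite mul0r cexp0.
by rewrite -natr1 mulrDl mul1r cexpD IH exprSr.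
Qed.

Definition twopii : C := ci * rc (2 * pi).

Lemma cexp_2pii : cexp twopii = 1.
Proof.
rewrite /cexp /twopii !reimE !(mul0r, mul1r, mulr0, subr0, addr0, add0r).
have -> : 2 * pi = pi *+ 2 :> R by rewrite mulr_natl.
by rewrite expR0 cos2pi sin2pi rc0 mulr0 addr0 mulr1.
Qed.

Lemma twopii_neq0 : twopii != 0.
Proof.
rewrite -md_gt0 mdM md_ci mul1r md_rc normr_gt0 mulf_neq0 ?pnatr_eq0//.
by rewrite gt_eqF// pi_gt0.
Qed.

(** The bound on the imaginary part later turns bounds on |z| and 1/|z| into a bound on the chosen
    logarithm. *)
Lemma cexp_surj z : z != 0 -> exists u, [/\ cexp u = z, re u = ln (md z) & `|im u| <= pi].
Proof.
move=> z0; have m0 : 0 < md z by rewrite md_gt0.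
have e2 : re z ^+ 2 + im z ^+ 2 = md z ^+ 2 by rewrite md_sqr.
pose x := re z / md z; pose y := im z / md z.
have xy : x ^+ 2 + y ^+ 2 = 1.
  by rewrite /x /y !expr_div_n -mulrDl e2 divff// expf_neq0// gt_eqF.
have x1 : -1 <= x <= 1.
  rewrite -ler_norml -(ler_pXn2r (n := 2)) ?nnegrE//.
  by rewrite expr1n real_normK ?num_real// -xy lerDl sqr_ge0.
have sy : sin (acos x) = `|y|.
  rewrite sin_acos// -xy addrAC subrr add0r; exact: sqrtr_sqr.
have zE : z = rc (md z) * (rc x + ci * rc y).
  rewrite mulrDr mulrCA -!rcM /x /y mulrCA divff ?mulr1 ?gt_eqF//.
  by rewrite mulrCA divff ?mulr1 ?gt_eqF// -cplxE.
pose th := if 0 <= y then acos x else - acos x.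
have ct : cos th = x by rewrite /th; case: ifP => _; rewrite ?cosN acosK// in_itv.
have st : sin th = y.
  rewrite /th; case: ifP => y0; first by rewrite sy ger0_norm.
  by rewrite sinN sy ltr0_norm ?opprK// ltNge y0.
exists (rc (ln (md z)) + ci * rc th); split.
- rewrite /cexp !reimE !(mul0r, mul1r, mulr0, subr0, addr0, add0r).
  by rewrite lnK ?posrE// ct st -zE.
- by rewrite !reimE !(mul0r, mul1r, mulr0, subr0, addr0, add0r).
- rewrite !reimE !(mul0r, mul1r, mulr0, subr0, addr0, add0r).
  have -> : `|th| = acos x.
    by rewrite /th; case: ifP => _; rewrite ?normrN ger0_norm// acos_ge0.
  exact: acos_lepi.
Qed.

Lemma cdiff_cexp0 : cdiff cexp 0 1.
Proof.
(* The error is at most e' |x| + 5 e' |y|, whence the six; [e'] is also kept below 1 to bound the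
   modulus of the real exponential by 2. *)
move=> e e0; pose e' := Num.min (e / 6) 1.
have e'0 : 0 < e' by rewrite lt_min ltr01 divr_gt0.
have e'1 : e' <= 1 by rewrite ge_min lexx orbT.
have e'e : e' <= e / 6 by rewrite ge_min lexx.
have [d1 d10 h1] := is_derive_eps (is_derive_expR (0 : R)) e'0.
have [d2 d20 h2] := is_derive_eps (is_derive_cos (0 : R)) e'0.
have [d3 d30 h3] := is_derive_eps (is_derive_sin (0 : R)) e'0.
exists (Num.min (Num.min d1 d2) (Num.min d3 (e' / 2))).
  by rewrite !lt_min d10 d20 d30 divr_gt0.
move=> h _; rewrite subr0 cexp0 mul1r !lt_min => /andP[/andP[hd1 hd2] /andP[hd3 he']].
have hr := re_le_md h; have hi := im_le_md h.
move: (h1 (re h)) (h2 (im h)) (h3 (im h)); rewrite !subr0 expR0 cos0 sin0 oppr0 mul0r !mul1r !(subr0, addr0).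
move=> /(_ (le_lt_trans hr hd1)) {}h1 /(_ (le_lt_trans hi hd2)) {}h2 /(_ (le_lt_trans hi hd3)) {}h3.
rewrite /cexp; set x := re h in h1 hr *; set y := im h in h2 h3 hi *.
set E := expR x in h1 *; set c := cos y in h2 *; set s := sin y in h3 *.
have -> : rc E * (rc c + ci * rc s) - 1 - h =
  rc (E - 1 - x) + rc (E * (c - 1)) + ci * rc (E * (s - y) + (E - 1) * y).
  have hE : h = rc x + ci * rc y by exact: cplxE.
  by rewrite [in LHS]hE !(rcM, rcB, rcD, rcN) !rc1; ring.
apply: le_trans (mdD _ _) _; rewrite mdM md_ci mul1r md_rc.
apply: le_trans (lerD (mdD _ _) (ler_normD _ _)) _; rewrite !md_rc !normrM.
have y0 := normr_ge0 y; have x0 := normr_ge0 x.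
have E1 : `|E - 1| <= 2 * `|x|.
  have -> : E - 1 = (E - 1 - x) + x by ring.
  by apply: le_trans (ler_normD _ _) _; nra.
have E2 : `|E| <= 2.
  have -> : E = (E - 1) + 1 by ring.
  by apply: le_trans (ler_normD _ _) _; rewrite normr1; lra.
have a1 : `|E| * `|c - 1| <= 2 * (e' * `|y|) by apply: ler_pM.
have a2 : `|E| * `|s - y| <= 2 * (e' * `|y|) by apply: ler_pM.
have a3 : `|E - 1| * `|y| <= e' * `|y| by apply: ler_wpM2r => //; lra.
have b1 : e' * `|y| <= e / 6 * md h by apply: ler_pM => //; lra.
have b2 : e' * `|x| <= e / 6 * md h by apply: ler_pM => //; lra.
by lra.
Qed.

Lemma cdiff_cexp z : cdiff cexp z (cexp z).
Proof.
have h : cdiff (fun w => cexp (w - z)) z (1 * 1).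
  apply: (diff_within_comp (T := setT)).
  - by rewrite subrr; exact: cdiff_cexp0.
  - apply: diff_within_ext (diff_withinB (diff_within_id _ z) (diff_within_cst _ z z)) _ _ => //.
    by rewrite subr0.
  - by exists 1.
apply: diff_within_ext (diff_withinZ (cexp z) h) _ _; last by rewrite !mulr1.
by move=> w; rewrite -cexpD addrC subrK.
Qed.

End ComplexExponential.

Section Chain.
Context {R : realType}.
Notation C := (cplx R).

Lemma diff_chain (S : set C) (f g : C -> C) z l m :
  cdiff f (g z) l -> diff_within S g z m -> diff_within S (fun w => f (g w)) z (l * m).
Proof. by move=> hf hg; apply: (diff_within_comp (T := setT)) hf hg _; exists 1. Qed.

Lemma diff_cexp (S : set C) (f : C -> C) z l : diff_within S f z l ->
  diff_within S (fun w => cexp (f w)) z (cexp (f z) * l).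
Proof. by move=> h; apply: diff_chain => //; exact: cdiff_cexp. Qed.

Lemma cont_diff_cst (S : set C) (f g : C -> C) z : cont_within setT f (g z) ->
  cont_within S g z -> cont_within S (fun w => f (g w)) z.
Proof. by move=> hf hg; apply: (cont_within_comp (T := setT)). Qed.

End Chain.

(** * Cauchy's formula and its consequences *)

Section Cauchy.
Context {R : realType}.
Notation C := (cplx R).
Implicit Types (f F k g : C -> C) (a b c z w q : C) (r : R).

Lemma cont01_bounded k : cont01 k -> exists2 M : R, 0 < M & forall t, I01 t -> md (k t) <= M.
Proof.
move=> kc; have [M hM] : exists M : R, forall x : R, 0 <= x <= 1 -> md (k (rc x)) <= M.
  apply: (@segment_induction R (fun s u => exists M : R, forall x : R, s <= x <= u -> md (k (rc x)) <= M)).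
    move=> t t01; have [d d0 hd] := kc _ (I01_rc t01) 1 ltr01.
    exists d => // s u s0 st tu u1 us; exists (md (k (rc t)) + 1) => x /andP[sx xu].
    have := hd (rc x); rewrite -rcB md_rc => /(_ _ _)/ltW h.
    have {}h : md (k (rc x) - k (rc t)) <= 1.
      apply: h; first by apply: I01_rc; lra.
      by rewrite ltr_norml; lra.
    by have := md_subl (k (rc x)) (k (rc t)); lra.
  move=> s t u s0 st tu u1 [M hM] [N hN]; exists (Num.max M N) => x /andP[sx xu].
  rewrite le_max; have [xt|tx] := leP x t; first by rewrite hM// sx.
  by rewrite [X in _ || X]hN ?orbT// xu ltW.
exists (Num.max M 1); first by rewrite lt_max ltr01 orbT.
by move=> _ [x x01 ->]; rewrite le_max hM.
Qed.

(** Differentiation under the integral sign; a quadratic error uniform in t makes it a direct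
    estimate, and Cauchy kernels satisfy it explicitly. *)
Lemma cint_diff (h : C -> C -> C) (h' : C -> C) (z0 : C) (d B : R) : 0 < d -> 0 < B ->
  (forall z, md (z - z0) < d -> cont01 (h ^~ z)) -> cont01 h' ->
  (forall t z, I01 t -> md (z - z0) < d ->
     md (h t z - h t z0 - (z - z0) * h' t) <= B * md (z - z0) ^+ 2) ->
  cdiff (fun z => cint (h ^~ z)) z0 (cint h').
Proof.
move=> d0 B0 hc h'c hB e e0; exists (Num.min d (e / B)).
  by rewrite lt_min d0 divr_gt0.
move=> w _; rewrite lt_min => /andP[wd we].
have z0d : md (z0 - z0) < d by rewrite subrr md0.
have H := is_intB (is_intB (cintP (hc _ wd)) (cintP (hc _ z0d)))
  (is_intZ (w - z0) (cintP h'c)).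
rewrite [cint h' * _]mulrC.
apply: le_trans (is_int_bound H _) _ => [t It|]; first exact: hB.
rewrite expr2 mulrA; apply: ler_wpM2r; first exact: md_ge0.
by move: we; rewrite ltr_pdivlMr// => /ltW; rewrite mulrC.
Qed.

Variables (a : C) (r : R).
Hypothesis r0 : 0 < r.

Definition circ (t : C) : C := a + rc r * cexp (twopii * t).
Definition circ' (t : C) : C := rc r * (cexp (twopii * t) * twopii).

Lemma diff_circ S t : diff_within S circ t (circ' t).
Proof.
apply: diff_within_ext (diff_withinD (diff_within_cst S a t)
  (diff_withinZ (rc r) (diff_cexp (diff_withinZ twopii (diff_within_id S t))))) _ _ => //.
by rewrite add0r mulr1.
Qed.

Lemma cont_circ' S t : cont_within S circ' t.
Proof.
apply: cont_withinM; first exact: cont_within_cst.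
apply: cont_withinM; last exact: cont_within_cst.
exact: diff_cont (diff_cexp (diff_withinZ twopii (diff_within_id S t))).
Qed.

Lemma md_circ t : I01 t -> md (circ t - a) = r.
Proof.
move=> [s _ ->]; rewrite /circ addrAC subrr add0r mdM md_rc md_cexp /twopii.
rewrite !reimE !(mul0r, mul1r, mulr0, subr0, addr0, add0r) ?oppr0 expR0 mulr1.
by rewrite ger0_norm// ltW.
Qed.

Lemma md_circ' t : I01 t -> md (circ' t) = r * (2 * pi).
Proof.
move=> It; have := md_circ It; rewrite /circ' /circ addrAC subrr add0r mulrA => h; rewrite mdM h.
by rewrite /twopii mdM md_ci mul1r md_rc ger0_norm// mulr_ge0// pi_ge0.
Qed.

Lemma circ01 : circ 0 = circ 1.
Proof. by rewrite /circ mulr0 mulr1 cexp0 cexp_2pii. Qed.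

Lemma circ_far z t : I01 t -> r - md (z - a) <= md (circ t - z).
Proof.
move=> It; have := md_tri (circ t) z a; rewrite md_circ//; lra.
Qed.

Lemma circ_neq z t : disc a r z -> I01 t -> circ t - z != 0.
Proof.
by rewrite /disc /= -md_gt0 => za It; have := circ_far z It; lra.
Qed.

Lemma cont_circ_inv z : disc a r z -> cont01 (fun t => (circ t - z)^-1).
Proof.
move=> za t It; apply: cont_withinV; last exact: circ_neq.
apply: cont_withinB; [exact: diff_cont (diff_circ _ t)|exact: cont_within_cst].
Qed.

(** Two derivatives are enough: the first yields the integral formula for f', the second shows that
    f' is again differentiable. *)
Lemma cauchy_kernel k z : cont01 k -> disc a r z ->
  cdiff (fun z => cint (fun t => k t / (circ t - z))) z
    (cint (fun t => k t / (circ t - z) ^+ 2)) /\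
  cdiff (fun z => cint (fun t => k t / (circ t - z) ^+ 2)) z
    (2 * cint (fun t => k t / (circ t - z) ^+ 3)).
Proof.
(* Half the distance from z to the circle: every w within [d] of z is then at distance at least [d]
   from it. *)
move=> kc za; pose d := (r - md (z - a)) / 2.
have d0 : 0 < d by rewrite /d; rewrite /disc /= in za; lra.
have near w : md (w - z) < d -> disc a r w.
  by rewrite /disc /= /d => wz; have := md_tri w z a; rewrite /disc /= in za; lra.
have inv_b w t : md (w - z) < d -> I01 t -> md ((circ t - w)^-1) <= d^-1.
  move=> wz It; rewrite mdV lef_pV2 ?posrE// ?md_gt0 ?circ_neq//; last exact: near.
  have := circ_far w It; have := md_tri w z a; rewrite /d in wz *; lra.
have [M M0 hM] := cont01_bounded kc.
have zz : md (z - z) < d by rewrite subrr md0.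
have kcV n w : md (w - z) < d -> cont01 (fun t => k t / (circ t - w) ^+ n).
  move=> /near wa; elim: n => [|n IH].
    by move=> t It; apply: cont_within_eq (kc t It) _ _; [exists 1 => // x _ _|]; rewrite expr0 divr1.
  move=> t It; have := cont_withinM (IH t It) (cont_circ_inv wa It).
  by move=> h; apply: cont_within_eq h _ _; [exists 1 => // x _ _|]; rewrite exprSr invfM mulrA.
have d1 : 0 < d^-1 by rewrite invr_gt0.
split.
  apply: (@cint_diff (fun t z => k t / (circ t - z)) _ z d (M * d^-1 ^+ 3)) => //.
  - by rewrite mulr_gt0// exprn_gt0.
  - by move=> w /(kcV 1%N); rewrite /=.
  - exact: kcV.
  move=> t w It wz; have w0 := circ_neq (near _ wz) It; have z0 := circ_neq za It.
  have -> : k t / (circ t - w) - k t / (circ t - z) - (w - z) * (k t / (circ t - z) ^+ 2) =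
    k t * ((circ t - w)^-1 * ((circ t - z)^-1 * (circ t - z)^-1)) * (w - z) ^+ 2.
    by field; rewrite w0 z0.
  rewrite mdM mdX; apply: ler_wpM2r; first by rewrite exprn_ge0// md_ge0.
rewrite !mdM !exprS expr0 mulr1.
  by do 3?[apply: ler_pM; rewrite ?mulr_ge0 ?md_ge0//]; rewrite ?hM ?inv_b.
have -> : 2 * cint (fun t => k t / (circ t - z) ^+ 3) =
    cint (fun t => 2 * (k t / (circ t - z) ^+ 3)).
  by apply/esym/cintE/is_intZ/cintP/kcV.
apply: (@cint_diff (fun t z => k t / (circ t - z) ^+ 2) _ z d (M * (3 * d^-1 ^+ 4))) => //.
- by rewrite !mulr_gt0// exprn_gt0.
- by move=> w /(kcV 2%N).
- by move=> t It; apply: cont_withinM; [exact: cont_within_cst|exact: kcV].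
move=> t w It wz; have w0 := circ_neq (near _ wz) It; have z0 := circ_neq za It.
have -> : k t / (circ t - w) ^+ 2 - k t / (circ t - z) ^+ 2 -
    (w - z) * (2 * (k t / (circ t - z) ^+ 3)) =
  k t * ((circ t - w)^-1 * ((circ t - z)^-1 * (circ t - z)^-1) *
    ((circ t - w)^-1 + 2 * (circ t - z)^-1)) * (w - z) ^+ 2.
  by field; rewrite w0 z0.
rewrite mdM mdX; apply: ler_wpM2r; first by rewrite exprn_ge0// md_ge0.
rewrite !mdM.
have -> : 3 * d^-1 ^+ 4 = (d^-1 * (d^-1 * d^-1)) * (3 * d^-1) by field; rewrite gt_eqF.
apply: ler_pM; rewrite ?mulr_ge0 ?md_ge0// ?hM//.
have b1 := inv_b _ _ wz It; have b2 := inv_b _ _ zz It.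
apply: ler_pM; rewrite ?mulr_ge0 ?md_ge0//.
  by do 2?[apply: ler_pM; rewrite ?mulr_ge0 ?md_ge0//].
apply: le_trans (mdD _ _) _; rewrite mdM md_nat; lra.
Qed.

(* Differentiating in z gives 0, so the value is the one at the centre. *)
Lemma winding z : disc a r z -> is_int (fun t => circ' t / (circ t - z)) twopii.
Proof.
move=> za; have kc : cont01 circ' by move=> t _; exact: cont_circ'.
have D0 w : disc a r w -> cdiff (fun z => cint (fun t => circ' t / (circ t - z))) w 0.
  move=> wa; have [+ _] := cauchy_kernel kc wa.
  have -> // : cint (fun t => circ' t / (circ t - w) ^+ 2) = 0.
  apply: cintE; exists (fun t => - (circ t - w)^-1); last by rewrite circ01 subrr.
  move=> t It; apply: diff_within_ext (diff_withinN (diff_withinV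
    (diff_withinB (diff_circ I01 t) (diff_within_cst I01 w t)) (circ_neq wa It))) _ _ => //.
  by rewrite opprK subr0 expr2.
pose N z := cint (fun t => circ' t / (circ t - z)).
have <- : N z = twopii.
  have -> : N z = N a.
    have aa : disc a r a by exact: disc_center.
    have h0 : is_int (fun=> 0) (N z - N a).
      exists (fun t => N (a + t * (z - a))); last first.
        by rewrite mul1r mul0r addr0 [a + _]addrC subrK.
      move=> t It.
      have h : diff_within I01 (fun s => a + s * (z - a)) t (z - a).
        by apply: diff_within_ext (diff_within_affine I01 a (z - a) t) _ _ => // s; rewrite mulrC.
      by have := @diff_chain _ I01 N (fun s => a + s * (z - a)) _ _ _ (D0 _ (convex_disc aa za It)) h; rewrite mul0r.
    by apply/eqP; rewrite -subr_eq0; apply/eqP/(is_int_unique h0)/is_int_cst.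
  apply: cintE; apply: is_int_eq (is_int_cst twopii) _ => t It.
  rewrite /circ' /circ addrAC subrr add0r mulrA mulrAC divff ?mul1r//.
  by rewrite mulf_neq0 ?cexp_neq0// rc_eq0 gt_eqF.
apply: cintP => t It; apply: cont_withinM; first exact: kc.
exact: cont_circ_inv.
Qed.

End Cauchy.

(** * Cauchy's formula on discs, the maximum principle, Liouville's theorem, logarithms *)

Section HolomorphicTheory.
Context {R : realType}.
Notation C := (cplx R).
Implicit Types (f g F k : C -> C) (a b c z w q u : C) (r s M : R).

Lemma cdiff_unique f z l m : cdiff f z l -> cdiff f z m -> l = m.
Proof.
move=> hl hm; apply/eqP; rewrite -subr_eq0; apply/eqP/md_small_eq0 => e e0.
have e20 : 0 < e / 2 by lra.
have [d d0 hd] := hl _ e20; have [d' d'0 hd'] := hm _ e20.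
pose t := Num.min d d' / 2.
have t0 : 0 < t by rewrite divr_gt0// lt_min d0.
have [td td'] : t < d /\ t < d'.
  have : Num.min d d' <= d by rewrite ge_min lexx.
  have : Num.min d d' <= d' by rewrite ge_min lexx orbT.
  by move: t0; rewrite /t; lra.
have zt : z + rc t - z = rc t by ring.
have mt : md (rc t : C) = t by rewrite md_rc ger0_norm// ltW.
have := hd (z + rc t) I; rewrite zt mt => /(_ td) h1.
have := hd' (z + rc t) I; rewrite zt mt => /(_ td') h2.
rewrite -(ler_pM2r t0) -[in X in X <= _]mt -mdM.
have -> : (l - m) * rc t = (f (z + rc t) - f z - m * rc t) - (f (z + rc t) - f z - l * rc t).
  by ring.
by apply: le_trans (mdB _ _) _; lra.
Qed.

Definition derv f z : C := xget 0 [set l | cdiff f z l].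

Lemma dervE f z l : cdiff f z l -> derv f z = l.
Proof.
move=> h; rewrite /derv; case: xgetP => [m _ hm|/(_ l)//].
exact: cdiff_unique hm h.
Qed.

Lemma dervP (D : set C) f z : holo D f -> D z -> cdiff f z (derv f z).
Proof. by move=> fD /fD[l hl]; rewrite (dervE hl). Qed.

Lemma cdiff_near f g z l (d : R) : 0 < d -> (forall w, md (w - z) < d -> f w = g w) ->
  cdiff f z l -> cdiff g z l.
Proof.
move=> d0 fg h; apply: diff_within_eq h _ _ _ => //; first by exists d => // w _; exact: fg.
by apply: fg; rewrite subrr md0.
Qed.

Lemma holoW (D E : set C) f : E `<=` D -> holo D f -> holo E f.
Proof. by move=> ED h z /ED; exact: h. Qed.

Lemma disc_sub a r s : r <= s -> disc a r `<=` disc a s.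
Proof. by move=> rs z; rewrite /disc /=; lra. Qed.

Lemma holo_cst (D : set C) c : holo D (fun=> c).
Proof. by move=> z _; exists 0; exact: diff_within_cst. Qed.
Lemma holo_id (D : set C) : holo D id.
Proof. by move=> z _; exists 1; exact: diff_within_id. Qed.
Lemma holoD (D : set C) f g : holo D f -> holo D g -> holo D (fun z => f z + g z).
Proof. by move=> hf hg z Dz; have [l ?] := hf z Dz; have [m ?] := hg z Dz;
  exists (l + m); exact: diff_withinD. Qed.
Lemma holoB (D : set C) f g : holo D f -> holo D g -> holo D (fun z => f z - g z).
Proof. by move=> hf hg z Dz; have [l ?] := hf z Dz; have [m ?] := hg z Dz;
  exists (l - m); exact: diff_withinB. Qed.
Lemma holoM (D : set C) f g : holo D f -> holo D g -> holo D (fun z => f z * g z).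
Proof. by move=> hf hg z Dz; have [l ?] := hf z Dz; have [m ?] := hg z Dz;
  exists (l * g z + f z * m); exact: diff_withinM. Qed.
Lemma holoV (D : set C) f : holo D f -> (forall z, D z -> f z != 0) ->
  holo D (fun z => (f z)^-1).
Proof. by move=> hf f0 z Dz; have [l ?] := hf z Dz;
  exists (- (l / (f z * f z))); apply: diff_withinV => //; exact: f0. Qed.
Lemma holoZ (D : set C) c f : holo D f -> holo D (fun z => c * f z).
Proof. by move=> hf; apply: holoM => //; exact: holo_cst. Qed.
Lemma holoX (D : set C) f n : holo D f -> holo D (fun z => f z ^+ n).
Proof.
move=> hf; elim: n => [|n IH]; first exact: holo_cst.
by move=> z Dz; have [l hl] := holoM hf IH Dz; exists l; apply: diff_within_ext hl _ _ => //= w;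
  rewrite exprS.
Qed.
Lemma holo_cexp (D : set C) f : holo D f -> holo D (fun z => cexp (f z)).
Proof. by move=> hf z Dz; have [l ?] := hf z Dz; exists (cexp (f z) * l); exact: diff_cexp. Qed.
Lemma holo_comp (D E : set C) f g : holo E f -> holo D g -> (forall z, D z -> E (g z)) ->
  holo D (fun z => f (g z)).
Proof.
move=> hf hg DE z Dz; have [l ?] := hg z Dz; have [m ?] := hf _ (DE z Dz).
by exists (m * l); exact: diff_chain.
Qed.
Lemma holo_ext (D : set C) f g : (forall z, D z -> exists2 d : R, 0 < d &
  forall w, md (w - z) < d -> f w = g w) -> holo D f -> holo D g.
Proof.
move=> fg hf z Dz; have [l hl] := hf z Dz; have [d d0 hd] := fg z Dz.
by exists l; exact: cdiff_near hd hl.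
Qed.
Lemma holo_disc_ext a r f g : (forall w, disc a r w -> f w = g w) ->
  holo (disc a r) f -> holo (disc a r) g.
Proof.
move=> fg; apply: holo_ext => z /disc_open[d d0 hd]; exists d => // w /hd; exact: fg.
Qed.

Lemma deriv0_const f a r : 0 < r -> (forall z, disc a r z -> cdiff f z 0) ->
  forall z, disc a r z -> f z = f a.
Proof.
move=> r0 f0 z za; have aa : disc a r a by exact: disc_center.
have h : is_int (fun=> 0) (f z - f a).
  exists (fun t => f (a + t * (z - a))); last first.
    by rewrite mul1r mul0r addr0 [a + _]addrC subrK.
  move=> t It; have h : diff_within I01 (fun s : C => a + s * (z - a)) t (z - a).
    by apply: diff_within_ext (diff_within_affine I01 a (z - a) t) _ _ => // s; rewrite mulrC.
  have := @diff_chain _ I01 f (fun s : C => a + s * (z - a)) _ _ _ (f0 _ (convex_disc aa za It)) h.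
  by rewrite mul0r.
by apply/eqP; rewrite -subr_eq0; apply/eqP/(is_int_unique h)/is_int_cst.
Qed.

Definition quot f q l z : C := if z == q then l else (f z - f q) / (z - q).

Lemma cont_quot f q l : cdiff f q l -> cont_within setT (quot f q l) q.
Proof.
move=> h e e0; have e20 : 0 < e / 2 by lra.
have [d d0 hd] := h _ e20; exists d => // w _ wq; rewrite /quot eqxx.
case: eqVneq => [_|wq0]; first by rewrite subrr md0.
have wq1 : w - q != 0 by rewrite subr_eq0.
have -> : (f w - f q) / (w - q) - l = (f w - f q - l * (w - q)) / (w - q) by field.
rewrite mdf ltr_pdivrMr ?md_gt0//; apply: le_lt_trans (hd w I wq) _.
by rewrite ltr_pM2r ?md_gt0//; lra.
Qed.

Lemma diff_quot f q l z m : cdiff f z m -> z != q -> exists l', cdiff (quot f q l) z l'.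
Proof.
move=> h zq; have zq0 : z - q != 0 by rewrite subr_eq0.
have h1 := diff_withinB h (diff_within_cst setT (f q) z).
have h2 := diff_withinV (diff_withinB (diff_within_id setT z) (diff_within_cst setT q z)) zq0.
have h3 := diff_withinM h1 h2.
eexists; apply: (cdiff_near (d := md (z - q))) h3; first by rewrite md_gt0.
move=> w wz; rewrite /quot; case: eqVneq wz => // -> ; by rewrite mdBC ltxx.
Qed.

Section CauchyFormula.
Variables (f : C -> C) (a : C) (r s : R).
Hypotheses (r0 : 0 < r) (rs : r < s) (hf : holo (disc a s) f).

Let k t := f (circ a r t) * circ' r t.

Let circ_in t : I01 t -> disc a s (circ a r t).
Proof. by move=> It; rewrite /disc /= md_circ. Qed.

Lemma cont_cauchy_kernel : cont01 k.
Proof.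
move=> t It; apply: cont_withinM; last exact: cont_circ'.
have [l hl] := hf (circ_in It).
by apply: cont_diff_cst; [exact: diff_cont hl|exact: diff_cont (diff_circ a r I01 t)].
Qed.

(** The difference quotient of f at z has a primitive, z being the exceptional point, so its
    integral over the circle vanishes and only f(z) times the winding integral is left. *)
Lemma cauchy_int z : disc a r z -> is_int (fun t => k t / (circ a r t - z)) (twopii * f z).
Proof.
move=> za; have zs : disc a s z by apply: disc_sub za; exact: ltW.
have [l hl] := hf zs.
have [w ws|w ws wz|G hG] := @primitive_exceptional _ (quot f z l) a s z zs.
- have [->|wz] := eqVneq w z; first exact: cont_quot.
  by have [m hm] := hf ws; have [m' hm'] := diff_quot l hm wz; exact: diff_cont hm'.
- by have [m hm] := hf ws; exact: diff_quot hm wz.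
have h0 : is_int (fun t => quot f z l (circ a r t) * circ' r t) 0.
  exists (fun t => G (circ a r t)); last by rewrite circ01 subrr.
  by move=> t It; apply: diff_chain; [apply/hG/circ_in|exact: diff_circ].
have := is_intD h0 (is_intZ (f z) (winding r0 za)); rewrite add0r mulrC.
move=> h; apply: is_int_eq h _ => t It.
have tz := circ_neq r0 za It; rewrite /quot /k.
by case: eqVneq => [E|_]; [rewrite E subrr eqxx in tz|field].
Qed.

Lemma cauchy_formula z : disc a r z ->
  f z = twopii^-1 * cint (fun t => k t / (circ a r t - z)).
Proof. by move=> za; rewrite (cintE (cauchy_int za)) mulKf// twopii_neq0. Qed.

Lemma cauchy_deriv z : disc a r z ->
  cdiff f z (twopii^-1 * cint (fun t => k t / (circ a r t - z) ^+ 2)).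
Proof.
move=> za; have [h _] := cauchy_kernel r0 cont_cauchy_kernel za.
have [d d0 hd] := disc_open za.
by apply: cdiff_near (diff_withinZ _ h) => [|w /hd wa]; [exact: d0|rewrite -cauchy_formula].
Qed.

Lemma cauchy_derv_diff z : disc a r z -> exists l, cdiff (derv f) z l.
Proof.
move=> za; have [_ h] := cauchy_kernel r0 cont_cauchy_kernel za.
have [d d0 hd] := disc_open za; eexists.
by apply: cdiff_near (diff_withinZ twopii^-1 h) => [|w /hd wa];
  [exact: d0|rewrite (dervE (cauchy_deriv wa))].
Qed.

(** The difference quotient is itself a Cauchy integral, with density [k'], hence differentiable at
    q too: its singularity is removable. *)
Lemma cauchy_quot_diff q : disc a r q -> exists l, cdiff (quot f q (derv f q)) q l.
Proof.
move=> qa; pose k' t := k t / (circ a r t - q).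
have kc' : cont01 k'.
  by move=> t It; apply: cont_withinM; [exact: cont_cauchy_kernel|exact: cont_circ_inv].
have [h _] := cauchy_kernel r0 kc' qa; have [d d0 hd] := disc_open qa; eexists.
apply: cdiff_near (diff_withinZ twopii^-1 h); first exact: d0.
move=> w /hd wa; rewrite /quot; case: eqVneq => [->|wq].
  rewrite (dervE (cauchy_deriv qa)); congr (_ * _); congr cint; apply/funext => t.
  by rewrite /k' expr2 invfM mulrA.
have wq0 : w - q != 0 by rewrite subr_eq0.
apply: (mulIf wq0); rewrite divfK// -mulrA [_ * (w - q)]mulrC.
have -> : (w - q) * cint (fun t => k' t / (circ a r t - w)) =
    cint (fun t => k t / (circ a r t - w) - k t / (circ a r t - q)).
  apply/esym/cintE.
  apply: is_int_eq (is_intZ (w - q) (cintP (k := fun t => k' t / (circ a r t - w)) _)) _.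
    by move=> t It; apply: cont_withinM; [exact: kc'|exact: cont_circ_inv].
  move=> t It; rewrite /k'; have := circ_neq r0 wa It; have := circ_neq r0 qa It.
  by move=> h1 h2; field; rewrite h1 h2.
rewrite (cintE (is_intB (cauchy_int wa) (cauchy_int qa))) -mulrBr mulKf//.
exact: twopii_neq0.
Qed.

Lemma cauchy_bound z M : disc a r z -> (forall t, I01 t -> md (f (circ a r t)) <= M) ->
  md (f z) <= r / (r - md (z - a)) * M.
Proof.
move=> za fM; have p0 : 0 < 2 * pi :> R by rewrite mulr_gt0// pi_gt0.
have t2 : md (twopii : C) = 2 * pi.
  by rewrite /twopii mdM md_ci mul1r md_rc ger0_norm// ltW.
have d0 : 0 < r - md (z - a) by rewrite /disc /= in za; lra.
have := is_int_bound (cauchy_int za) (M := M * (r * (2 * pi)) / (r - md (z - a))).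
rewrite mdM t2 => h; rewrite -(ler_pM2l p0); apply: le_trans (h _) _; last first.
  by rewrite le_eqVlt; apply/orP; left; apply/eqP; ring.
move=> t It; rewrite /k mdf mdM md_circ'//.
have m0 : 0 <= md (f (circ a r t)) * (r * (2 * pi)).
  by rewrite !mulr_ge0 ?md_ge0 ?(ltW r0)// pi_ge0.
apply: ler_pM => //; first by rewrite invr_ge0 md_ge0.
  by apply: ler_wpM2r; [rewrite mulr_ge0 ?(ltW r0)// ltW|exact: fM].
by rewrite lef_pV2 ?posrE ?md_gt0 ?circ_neq// circ_far.
Qed.

End CauchyFormula.

Lemma between_radius a s z : disc a s z -> exists r, [/\ 0 < r, r < s & disc a r z].
Proof.
rewrite /disc /= => za; have := md_ge0 (z - a).
by exists ((md (z - a) + s) / 2); split; lra.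
Qed.

Lemma holo_derv a s f : holo (disc a s) f -> holo (disc a s) (derv f).
Proof.
move=> hf z /between_radius[r [r0 rs za]]; exact: (cauchy_derv_diff r0 rs hf za).
Qed.

Lemma holo_quot a s f q : holo (disc a s) f -> disc a s q ->
  holo (disc a s) (quot f q (derv f q)).
Proof.
move=> hf qs z zs; have [->|zq] := eqVneq z q; last first.
  by have [m hm] := hf z zs; exact: diff_quot hm zq.
have [r [r0 rs qa]] := between_radius qs.
exact: (cauchy_quot_diff r0 rs hf qa).
Qed.

Lemma bernoulli_ge (x : R) n : 0 <= x -> 1 + n%:R * x <= (1 + x) ^+ n.
Proof.
move=> x0; elim: n => [|n IH]; first by rewrite mul0r addr0 expr0.
rewrite exprS -natr1; have n0 : 0 <= n%:R :> R by [].
have : (1 + x) * (1 + n%:R * x) <= (1 + x) * (1 + x) ^+ n by apply: ler_wpM2l => //; lra.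
nra.
Qed.

(* Cauchy's estimate for f loses a factor K, which disappears when it is applied
   to large powers of f. *)
Lemma max_modulus_circ a r s f M z : 0 < r -> r < s -> holo (disc a s) f ->
  (forall t, I01 t -> md (f (circ a r t)) <= M) -> disc a r z -> md (f z) <= M.
Proof.
move=> r0 rs hf fM za; have M0 : 0 <= M.
  by apply: le_trans (fM 0 I01_0); exact: md_ge0.
set K := r / (r - md (z - a)).
have hn n : md (f z) ^+ n <= K * M ^+ n.
  rewrite -mdX; apply: (cauchy_bound r0 rs (holoX n hf) za) => t It.
  by rewrite mdX lerXn2r ?nnegrE ?md_ge0// fM.
rewrite leNgt; apply/negP => Mf.
have [M00|M00] := eqVneq M 0.
  by have := hn 1%N; rewrite !expr1 M00 mulr0; lra.
have {M00}Mp : 0 < M by rewrite lt_def M00.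
pose x := md (f z) / M - 1.
have x0 : 0 < x by rewrite subr_gt0 ltr_pdivlMr// mul1r.
have [n] : exists n : nat, K < n%:R * x.
  exists (Num.truncn (K / x)).+1; rewrite -ltr_pdivrMr//; exact: truncnS_gt.
have := bernoulli_ge n (ltW x0).
have -> : 1 + x = md (f z) / M by rewrite /x; ring.
rewrite expr_div_n ler_pdivlMr ?exprn_gt0// => h1 h2.
have := hn n; have : K * M ^+ n < (1 + n%:R * x) * M ^+ n.
  by rewrite ltr_pM2r ?exprn_gt0//; lra.
lra.
Qed.

Lemma max_modulus a r s f M z : 0 < r -> r < s -> holo (disc a s) f ->
  (forall w, md (w - a) = r -> md (f w) <= M) -> disc a r z -> md (f z) <= M.
Proof.
move=> r0 rs hf fM; apply: max_modulus_circ rs hf _ => // t It.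
by apply: fM; rewrite md_circ.
Qed.

(** Without a zero, 1/f would violate the maximum principle at a. The lower bound is asked on an
    annulus so that 1/f is holomorphic beyond the circle of radius r. *)
Lemma min_principle a r s f (m : R) : 0 < r -> r < s -> holo (disc a s) f ->
  (forall w, r <= md (w - a) < s -> m <= md (f w)) -> md (f a) < m ->
  exists2 z, disc a r z & f z = 0.
Proof.
move=> r0 rs hf fm fa; apply: contrapT => nz.
have m0 : 0 < m by have := md_ge0 (f a); lra.
have f0 z : disc a s z -> f z != 0.
  move=> zs; have [zr|rz] := ltP (md (z - a)) r.
    by apply/eqP => f0; apply: nz; exists z.
  by rewrite -md_gt0; have := fm z; rewrite rz => /(_ zs); lra.
have aa : disc a r a by exact: disc_center.
have fas : f a != 0 by apply/f0/disc_center; lra.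
have : md (f a)^-1 <= m^-1.
  apply: (max_modulus r0 rs (holoV hf f0) _ aa) => w wa.
  have fw : m <= md (f w) by apply: fm; rewrite wa lexx.
  by rewrite mdV lef_pV2 ?posrE//; lra.
by rewrite mdV lef_pV2 ?posrE ?md_gt0//; lra.
Qed.

(** The maximum principle bounds the difference quotient at w from its values on the circle of
    radius 3 s / 4, which stays at distance s / 4 from w; hence 2 M / (s / 4). *)
Lemma holo_lipschitz a s f M z w : 0 < s -> holo (disc a s) f ->
  (forall w, disc a s w -> md (f w) <= M) ->
  disc a (s / 2) z -> disc a (s / 2) w -> md (f z - f w) <= 8 * M / s * md (z - w).
Proof.
move=> s0 hf fM za wa; have [->|zw] := eqVneq z w; first by rewrite !subrr md0 mulr0.
have ws : disc a s w by apply: disc_sub wa; lra.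
have zw0 : z - w != 0 by rewrite subr_eq0.
rewrite -ler_pdivrMr ?md_gt0// -mdf.
have -> : (f z - f w) / (z - w) = quot f w (derv f w) z.
  by rewrite /quot (negbTE zw).
apply: (max_modulus (r := 3 / 4 * s) (s := s) _ _ (holo_quot hf ws)); [lra|lra| |].
  move=> u ua; have uw : s / 4 <= md (u - w).
    by rewrite /disc /= in wa; have := md_tri u w a; lra.
  have uw0 : u - w != 0 by rewrite -md_gt0; lra.
  rewrite /quot -subr_eq0 (negbTE uw0) mdf ler_pdivrMr ?md_gt0//.
  have us : disc a s u by rewrite /disc /=; lra.
  have M0 : 0 <= M by apply: le_trans (fM u us); exact: md_ge0.
  have fuw : md (f u - f w) <= 2 * M.
    by apply: le_trans (mdB _ _) _; have := fM u us; have := fM w ws; lra.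
  apply: le_trans fuw _.
  have -> : 2 * M = 8 * M / s * (s / 4) by field; rewrite gt_eqF.
  by apply: ler_wpM2l => //; rewrite divr_ge0// ?mulr_ge0// ltW.
by rewrite /disc /= in za *; lra.
Qed.

Lemma liouville f M : holo setT f -> (forall w, md (f w) <= M) -> forall z, f z = f 0.
Proof.
move=> hf fM z; apply/eqP; rewrite -subr_eq0; apply/eqP/md_small_eq0 => e e0.
have M0 : 0 <= M by apply: le_trans (fM 0); exact: md_ge0.
have z0 := md_ge0 z.
pose s := 2 * md z + 1 + 8 * M * md z / e.
have s1 : 0 <= 8 * M * md z / e by rewrite !mulr_ge0// invr_ge0 ltW.
have s0 : 0 < s by rewrite /s; lra.
apply: le_trans (holo_lipschitz (a := 0) (s := s) (M := M) s0 _ _ _ _) _.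
- exact: holoW hf.
- by move=> w _; exact: fM.
- by rewrite /disc /= subr0 /s; lra.
- by apply: disc_center; lra.
rewrite subr0 mulrAC ler_pdivrMr//.
have -> : e * s = e * (2 * md z + 1) + 8 * M * md z by rewrite /s; field; rewrite gt_eqF.
by rewrite lerDr mulr_ge0 ?(ltW e0)//; lra.
Qed.

(** L is a primitive of f'/f, so f exp(-L) has derivative 0. The value at a is prescribed so that it
    can be chosen of controlled size. *)
Lemma holo_log a r f u : 0 < r -> holo (disc a r) f ->
  (forall z, disc a r z -> f z != 0) -> cexp u = f a ->
  exists L, [/\ holo (disc a r) L, L a = u & forall z, disc a r z -> cexp (L z) = f z].
Proof.
move=> r0 hf f0 ua; have aa : disc a r a by exact: disc_center.
have [P hP] := primitive_holo r0 (holoM (holo_derv hf) (holoV hf f0)).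
pose L z := P z - P a + u.
have hL z : disc a r z -> cdiff L z (derv f z / f z).
  move=> za; apply: diff_within_ext (diff_withinD (diff_withinB (hP z za)
    (diff_within_cst setT (P a) z)) (diff_within_cst setT u z)) _ _ => //.
  by rewrite subr0 addr0.
exists L; split.
- by move=> z za; exists (derv f z / f z); exact: hL.
- by rewrite /L subrr add0r.
move=> z za; have h w : disc a r w -> cdiff (fun z => f z * cexp (- L z)) w 0.
  move=> wa; have := diff_withinM (dervP hf wa) (diff_cexp (diff_withinN (hL w wa))).
  move=> h; apply: diff_within_ext h _ _ => //.
  by have := f0 w wa => ?; field.
have La : L a = u by rewrite /L subrr add0r.
have /= := deriv0_const r0 h za; rewrite La -ua !cexpN mulfV ?cexp_neq0//.
move=> /(canRL (mulfK _)); rewrite invr_eq0 cexp_neq0 invrK mul1r.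
by move=> ->.
Qed.

End HolomorphicTheory.

(** * The theorems of Bloch, Schottky and Picard *)

Section Bloch.
Context {R : realType}.
Notation C := (cplx R).
Implicit Types (f g h : C -> C) (a b c z w q u v p : C) (r s : R).

Lemma segment_bound f a s z (K : R) : holo (disc a s) f ->
  (forall w, disc a s w -> md (derv f w) <= K) -> disc a s z ->
  md (f z - f a) <= K * md (z - a).
Proof.
move=> hf fK za; have aa : disc a s a.
  by apply: disc_center; have := md_ge0 (z - a); rewrite /disc /= in za; lra.
have := @antideriv_bound R (fun t => f (a + t * (z - a)))
  (fun t => derv f (a + t * (z - a)) * (z - a)) (K * md (z - a)).
rewrite mul1r mul0r addr0 [a + _]addrC subrK; apply.
  move=> t It; have h : diff_within I01 (fun s : C => a + s * (z - a)) t (z - a).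
    by apply: diff_within_ext (diff_within_affine I01 a (z - a) t) _ _ => // x; rewrite mulrC.
  exact: (@diff_chain _ I01 f (fun s : C => a + s * (z - a)) _ _ _
    (dervP hf (convex_disc aa za It)) h).
by move=> t It; rewrite mdM ler_wpM2r ?md_ge0// fK//; exact: convex_disc.
Qed.

(** Put A = |f'(p)|. The maximum principle for the difference quotient of f' gives |f'(z) - f'(p)|
    <= (10 A / t) |z - p|, at most A / 2 within t / 20. There |f(z) - f(p)| >= (A / 2) |z - p|,
    which is at least A t / 80 once |z - p| >= t / 40; half of that is left for v, and the minimum
    principle yields a zero of f - v. *)
Lemma covering f p (t : R) v : 0 < t -> holo (disc p t) f ->
  (forall z, disc p t z -> md (derv f z) <= 4 * md (derv f p)) ->
  md (v - f p) < md (derv f p) * t / 160 -> exists2 z, disc p t z & f z = v.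
Proof.
move=> t0 hf f4 vp; set A := md (derv f p) in f4 vp *.
have pp : disc p t p by exact: disc_center.
have A0 : 0 <= A by exact: md_ge0.
have q_le z : disc p (t / 2) z -> md (derv f z - derv f p) <= 10 * A / t * md (z - p).
  move=> zp; have [->|zp0] := eqVneq z p; first by rewrite !subrr md0 mulr0.
  have zp1 : z - p != 0 by rewrite subr_eq0.
  rewrite -ler_pdivrMr ?md_gt0// -mdf.
  have -> : (derv f z - derv f p) / (z - p) = quot (derv f) p (derv (derv f) p) z.
    by rewrite /quot (negbTE zp0).
  apply: (max_modulus (r := t / 2) (s := t) _ _ (holo_quot (holo_derv hf) pp) _ zp); [lra|lra|].
  move=> w wp; have wp0 : w - p != 0 by rewrite -md_gt0 wp; lra.
  rewrite /quot -subr_eq0 (negbTE wp0) mdf wp ler_pdivrMr; last lra.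
  have -> : 10 * A / t * (t / 2) = 5 * A by field; rewrite gt_eqF.
  by have := mdB (derv f w) (derv f p); have := f4 w; rewrite /disc /= wp -/A => h; lra.
have lin z : disc p (t / 20) z -> A / 2 * md (z - p) <= md (f z - f p).
  rewrite {1}/disc /= => zp.
  pose K := 10 * A / t * md (z - p).
  have K0 : 0 <= 10 * A / t by rewrite divr_ge0 ?mulr_ge0 ?(ltW t0).
  pose g w := f w - derv f p * (w - p).
  have gd w : disc p t w -> cdiff g w (derv f w - derv f p).
    move=> wp; apply: diff_withinB; first exact: dervP hf wp.
    apply: diff_within_ext (diff_withinZ (derv f p) (diff_withinB (diff_within_id setT w)
      (diff_within_cst setT p w))) _ _ => //.
    by rewrite subr0 mulr1.
  have [z0|z0] := eqVneq z p; first by rewrite z0 !subrr md0 mulr0.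
  have d0 : 0 < md (z - p) by rewrite md_gt0 subr_eq0.
  have h : md (g z - g p) <= 10 * A / t * (t / 20) * md (z - p).
    apply: (segment_bound (s := t / 20)) => //.
      by move=> w wp; eexists; apply: gd; apply: disc_sub wp; lra.
    move=> w wp; have wt : disc p t w by apply: disc_sub wp; lra.
    rewrite (dervE (gd _ wt)); apply: le_trans (q_le w _) _.
      by apply: disc_sub wp; lra.
    by apply: ler_wpM2l => //; rewrite /disc /= in wp; lra.
  have e1 : 10 * A / t * (t / 20) = A / 2 by field; rewrite gt_eqF.
  have -> : f z - f p = derv f p * (z - p) + (g z - g p) by rewrite /g; ring.
  have := md_subr (derv f p * (z - p)) (g z - g p); rewrite mdM -/A.
  by rewrite e1 in h; lra.
have Ap : 0 < A.
  by rewrite lt_def A0 andbT; apply/eqP => A00; move: vp; have := md_ge0 (v - f p);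
    rewrite A00; lra.
have [|||||z zp /eqP] := @min_principle R p (t / 40) (t / 20) (fun z => f z - v) (A * t / 160).
- lra.
- lra.
- by apply: holoB; [apply: holoW hf => z; apply: disc_sub; lra|exact: holo_cst].
- move=> w /andP[w1 w2]; have := lin w w2.
  have : A / 2 * (t / 40) <= A / 2 * md (w - p) by apply: ler_wpM2l => //; lra.
  have -> : f w - v = (f w - f p) - (v - f p) by ring.
  have := md_subl (f w - f p) (v - f p).
  have -> : A / 2 * (t / 40) = A * t / 80 by field.
  by lra.
- by rewrite mdBC.
rewrite subr_eq0 => /eqP fz; exists z => //; apply: disc_sub zp; lra.
Qed.

(* Choose a disc on which |f'| is at most four times its value at the centre: if
   there were none, |f'| L would stay bounded below along discs of radius L -> 0
   that shrink to a point. *)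
Lemma bloch f a s : 0 < s -> holo (disc a s) f -> derv f a != 0 ->
  exists b, forall v, md (v - b) < md (derv f a) * s / 1280 ->
    exists2 z, disc a s z & f z = v.
Proof.
move=> s0 hf fa; pose L0 := s / 8; pose ka := md (derv f a) * L0.
have L00 : 0 < L0 by rewrite divr_gt0.
have ka0 : 0 < ka by rewrite mulr_gt0// md_gt0.
(* Both clauses survive halving L: the centre moves by at most L, and |f'| grows by a factor greater
   than four. The final radius combines the 160 of [covering] with the 8 in [L0]. *)
pose B x L := md (x - a) + 2 * L <= 2 * L0 /\ ka <= md (derv f x) * L.
have [x [L [Lp [xa xk] x4]]] : exists x (L : R), [/\ 0 < L, B x L &
    forall z, disc x L z -> md (derv f z) <= 4 * md (derv f x)].
  apply: contrapT => nx.
  have [||p [pa hp]] := @nested_point R C id B a L0 L00.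
  - by split; [rewrite subrr md0 add0r|].
  - move=> x L Lp [xa xk].
    have [z zx zf] : exists2 z, disc x L z & 4 * md (derv f x) < md (derv f z).
      apply: contrapT => nz; apply: nx; exists x, L; split => // z zx.
      by rewrite leNgt; apply/negP => zf; apply: nz; exists z.
    rewrite /disc /= in zx; exists z; split; last exact: ltW.
    split; first by have := md_tri z x a; lra.
    have : 4 * md (derv f x) * L <= md (derv f z) * L by rewrite ler_pM2r// ltW.
    lra.
  have ps : disc a s p.
    by rewrite /disc /= mdBC; apply: le_lt_trans pa _; rewrite /L0; lra.
  have [l hl] := holo_derv hf ps.
  have [d d0 hd] := diff_cont hl ltr01.
  have N0 : 0 < md (derv f p) + 1 by have := md_ge0 (derv f p); lra.
  have [|x [L [Lp Le [xa xk] xp]]] := hp (Num.min (d / 5) (ka / (md (derv f p) + 1))).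
    by rewrite lt_min !divr_gt0.
  move: Le; rewrite lt_min => /andP[Ld]; rewrite ltr_pdivlMr// => Lk.
  have := hd x I; have := md_subl (derv f x) (derv f p) => h /(_ _)h1.
  have {}h1 : md (derv f x - derv f p) < 1 by apply: h1; lra.
  have : md (derv f x) * L <= (md (derv f p) + 1) * L by rewrite ler_pM2r//; lra.
  lra.
exists (f x) => v vx.
have xL : disc x L `<=` disc a s.
  by move=> z; rewrite /disc /= => zx; have := md_tri z x a; rewrite /L0 in xa; lra.
have [||||z zx fz] := covering (f := f) (p := x) (t := L) (v := v) => //.
- exact: holoW hf.
- apply: lt_le_trans vx _; move: xk; rewrite /ka /L0; lra.
by exists z => //; exact: xL.
Qed.

End Bloch.

(** * A net of points where cosh^2 is a natural number *)

Section HyperbolicCosine.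
Context {R : realType}.
Notation C := (cplx R).
Implicit Types (f g h : C -> C) (a b c z w q u v p : C) (r s : R).

Lemma cexp_int (k : int) : cexp (k%:~R * twopii : C) = 1.
Proof.
have H n : cexp (n%:R * twopii : C) = 1 by rewrite cexpMn cexp_2pii expr1n.
case: k => n; first exact: H.
by rewrite NegzE mulrNz mulNr cexpN H invr1.
Qed.

(* cosh u = +- sqrt n at the points u = +- ln (sqrt n + sqrt (n - 1)) + i pi k. *)
Lemma sqr_cosh_dense b : exists u (n : nat),
  md (u - b) <= 6 /\ ((cexp u + cexp (- u)) / 2) ^+ 2 = n%:R.
Proof.
pose x := re b; pose y := im b.
pose E := expR `|x|; have E1 : 1 <= E by have := expR_ge1Dx `|x|; have := normr_ge0 x; rewrite /E; lra.
have E0 : 0 < E by rewrite expR_gt0.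
(* These are cosh |x| and sinh |x|. With n the integer part of c^2, sqrt n + sqrt (n - 1) lies
   between E / 3 and E, so the real part moves by at most ln 3 <= 2; the imaginary part moves by at
   most pi <= 4. This makes 6. *)
pose c := (E + E^-1) / 2; pose c' := (E - E^-1) / 2.
have cc : c ^+ 2 = c' ^+ 2 + 1 by rewrite /c /c'; field; rewrite gt_eqF.
have Ei : E^-1 <= 1 by rewrite invf_le1.
have Ei0 : 0 < E^-1 by rewrite invr_gt0.
have c'0 : 0 <= c' by rewrite /c'; lra.
have c0 : 0 <= c by rewrite /c; lra.
have cE : c + c' = E by rewrite /c /c'; field; rewrite gt_eqF.
pose n := Num.truncn (c ^+ 2).
have /andP[nc cn] : n%:R <= c ^+ 2 < n.+1%:R by apply: truncn_itv; rewrite sqr_ge0.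
have n1 : (0 < n)%N.
  rewrite lt0n; apply/eqP => n0; move: cn; rewrite n0 cc; have := sqr_ge0 c'; lra.
have nR : 1 <= n%:R :> R by rewrite ler1n.
pose rn : R := Num.sqrt n%:R; pose rm : R := Num.sqrt (n%:R - 1).
have rn2 : rn ^+ 2 = n%:R by rewrite sqr_sqrtr//; lra.
have rm2 : rm ^+ 2 = n%:R - 1 by rewrite sqr_sqrtr//; lra.
have rn0 : 0 <= rn by exact: sqrtr_ge0.
have rm0 : 0 <= rm by exact: sqrtr_ge0.
have rn1 : 1 <= rn by rewrite -(sqrtr1 R) ler_wsqrtr.
pose s := rn + rm; have s0 : 0 < s by rewrite /s; lra.
have sE : s <= E.
  rewrite /s -cE; apply: lerD.
    by rewrite -(ler_pXn2r (n := 2)) ?nnegrE// rn2.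
  by rewrite -(ler_pXn2r (n := 2)) ?nnegrE// rm2; lra.
have Es : E <= 3 * s.
  have h : E <= 2 * c by rewrite /c; lra.
  have : 2 * c <= 3 * rn.
    rewrite leNgt; apply/negP => rc3; move: cn rn2; rewrite -natr1 !expr2 => cn rn2.
    have h1 : (3 * rn) * (3 * rn) <= (2 * c) * (2 * c) by apply: ler_pM; lra.
    lra.
  by rewrite /s; lra.
have sV : s^-1 = rn - rm.
  apply: (mulfI (x := s)); first by rewrite gt_eqF.
  rewrite mulfV ?gt_eqF//; transitivity (rn ^+ 2 - rm ^+ 2); last by rewrite /s; ring.
  by rewrite rn2 rm2; ring.
pose sg : R := if 0 <= x then 1 else -1.
have sgx : x = sg * `|x|.
  by rewrite /sg; case: ifP => x0; [rewrite ger0_norm ?mul1r|rewrite ltr0_norm ?mulN1r ?opprK// ltNge x0].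
have vx : `|sg * ln s - x| <= 2.
  have -> : sg * ln s - x = sg * (ln s - `|x|) by rewrite mulrBr -sgx.
  rewrite normrM.
  have -> : `|sg| = 1 by rewrite /sg; case: ifP => _; rewrite ?normrN normr1.
  rewrite mul1r ler_norml.
  have xE : `|x| = ln E by rewrite /E expRK.
  have l1 : ln s <= `|x| by rewrite xE ler_ln ?posrE.
  have l2 : `|x| <= ln 3 + ln s.
    by rewrite xE -lnM ?posrE// ler_ln ?posrE// mulr_gt0.
  have l3 : ln (3 : R) <= 2.
    rewrite -(expRK 2) ler_ln ?posrE ?expR_gt0//; have := expR_ge1Dx (2 : R); lra.
  by apply/andP; split; lra.
pose k := Num.floor (y / pi).
have p0 : 0 < pi :> R by exact: pi_gt0.
have p4 : pi < 4 :> R by have := pihalf_lt2 R; lra.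
have ky : `|pi * k%:~R - y| <= 4.
  have /andP[h1 h2] := floor_itv (y / pi).
  move: h1 h2; rewrite -/k intrD ler_pdivlMr// ltr_pdivrMr// => h1 h2.
  by rewrite ler_norml; apply/andP; split; lra.
pose A := cexp (rc (sg * ln s)); pose e : C := cexp (ci * rc (pi * k%:~R)).
exists (rc (sg * ln s) + ci * rc (pi * k%:~R)), n; split.
  apply: le_trans (md_le_reim _) _; rewrite reB imB !reimE.
  by rewrite !(mul0r, mul1r, mulr0, subr0, addr0, add0r) -/x -/y; lra.
rewrite opprD !cexpD -/A -/e.
have e2 : e * e = 1.
  rewrite /e -cexpD -(cexp_int k); congr cexp; rewrite /twopii -mulrDr -rcD.
  have -> : k%:~R = rc k%:~R :> C.
    by case: (k) => m; rewrite ?NegzE ?mulrNz ?rcN -?pmulrn ?rc_nat.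
  by rewrite mulrCA -rcM; congr (_ * rc _); ring.
have eV : cexp (- (ci * rc (pi * k%:~R))) = e.
  by rewrite cexpN; apply: (mulfI (cexp_neq0 (ci * rc (pi * k%:~R)))); rewrite mulfV ?cexp_neq0// -/e e2.
rewrite eV -mulrDl; have AA : A + cexp (- rc (sg * ln s)) = 2 * rc rn.
  rewrite cexpN -/A.
  have -> : A = rc (expR (sg * ln s)).
    by rewrite /A /cexp re_rc im_rc cos0 sin0 rc0 mulr0 addr0 mulr1.
  rewrite -rcV -expRN -rcD -rc_nat -rcM; congr rc.
  rewrite /sg; case: ifP => _; rewrite ?mul1r ?mulN1r ?opprK expRN lnK ?posrE// sV /s; ring.
rewrite AA expr_div_n !expr2; transitivity (rc rn * rc rn * (e * e)).
  by field.
by rewrite e2 mulr1 -rcM -expr2 rn2 rc_nat.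
Qed.

End HyperbolicCosine.

(** * Schottky's theorem and Picard's little theorem *)

Section Schottky.
Context {R : realType}.
Notation C := (cplx R).
Implicit Types (f g h H W L : C -> C) (a b c z w q u v p : C) (r s M : R).

Lemma md_cexp_le z : md (cexp z) <= expR (md z).
Proof.
rewrite md_cexp ler_expR; apply: le_trans (re_le_md z); exact: ler_norm.
Qed.

(** If |W'(w)| exceeded 2 * 6 * 1280 / s, Bloch's theorem on the disc of radius s / 2 about w would
    put a disc of radius more than 6 into the image of W, and with it a point where cosh^2 is a
    natural number. *)
Lemma omit_lattice_lipschitz a s W : 0 < s -> holo (disc a s) W ->
  (forall z n, disc a s z -> ((cexp (W z) + cexp (- W z)) / 2) ^+ 2 != n%:R) ->
  forall z, disc a (s / 2) z -> md (W z - W a) <= 6 * 1280.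
Proof.
move=> s0 hW Wn z za.
have [K K0 KE] : exists2 K : R, 0 < K & K = 6 * 1280 by exists (6 * 1280); lra.
rewrite -KE.
have dW w : disc a (s / 2) w -> md (derv W w) <= 2 * K / s.
  move=> wa; rewrite leNgt; apply/negP => Ww.
  have w0 : derv W w != 0.
    by rewrite -md_gt0; apply: lt_trans Ww; rewrite divr_gt0// mulr_gt0.
  have sub : disc w (s / 2) `<=` disc a s.
    by move=> x; rewrite /disc /= in wa *; have := md_tri x w a; lra.
  have [||b hb] := bloch (a := w) (s := s / 2) _ _ w0; [lra|exact: holoW hW|].
  have [u [n [ub un]]] := sqr_cosh_dense b.
  have [|x xw xu] := hb u.
    apply: le_lt_trans ub _; move: Ww; rewrite ltr_pdivrMr//; lra.
  by have := Wn x n (sub _ xw); rewrite xu un eqxx.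
have hW2 : holo (disc a (s / 2)) W by apply: holoW hW; apply: disc_sub; lra.
apply: le_trans (segment_bound hW2 dW za) _.
have KsE : 2 * K / s * (s / 2) = K by field; rewrite gt_eqF.
rewrite -[leRHS]KsE.
by apply: ler_wpM2l; [rewrite divr_ge0 ?mulr_ge0// ltW|rewrite /disc /= in za; exact: ltW].
Qed.

(** Both m and 1/m are bounded because ln m must be controlled from either side; ln x <= x - 1 does
    it, and 4 covers pi. *)
Lemma md_log_bound (m : R) u : 0 < m -> re u = ln m -> `|im u| <= pi ->
  forall K, m <= K -> m^-1 <= K -> md u <= K + 4.
Proof.
move=> m0 ru iu K mK iK; apply: le_trans (md_le_reim u) _; rewrite ru.
have p4 : pi < 4 :> R by have := pihalf_lt2 R; lra.
have K0 : 0 < K by lra.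
have lnK' x : 0 < x -> ln x <= x - 1 :> R.
  by move=> x0; rewrite -[x in X in _ <= X](lnK (x := x)) ?posrE//; have := expR_ge1Dx (ln x); lra.
have h1 := lnK' m m0; have := lnK' m^-1; rewrite invr_gt0 lnV ?posrE// => /(_ m0) h2.
have : `|ln m| <= K by rewrite ler_norml; apply/andP; split; lra.
lra.
Qed.

Lemma sqr_le_self (x K : R) : x ^+ 2 <= K -> x <= K + 1.
Proof. by rewrite expr2 => h; have := sqr_ge0 (x - 1); rewrite expr2; nra. Qed.

(* Write H = exp (2 pi i cosh^2 W). Since H avoids 1, cosh^2 W avoids the integers,
   and Bloch's theorem then bounds W'. *)
Lemma schottky_annulus M : exists S : R, forall a s H, 0 < s -> holo (disc a s) H ->
  (forall z, disc a s z -> H z != 0) -> (forall z, disc a s z -> H z != 1) ->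
  md (H a) <= M -> (md (H a))^-1 <= M ->
  forall z, disc a (s / 2) z -> md (H z) <= S.
Proof.
(* [B1] bounds a logarithm of H(a) and so L(a); [B2] bounds both P(a) - Q(a) and its inverse P(a) +
   Q(a); [B3] bounds W on the half disc. The 8 in the final bound is an upper bound of 2 pi. *)
pose B1 := M + 4; pose B2 := 2 * B1 + 4; pose B3 := B2 + 4 + 6 * 1280.
exists (expR (8 * (expR B3 * expR B3))) => a s H s0 hH H0 H1 Ha Hai z za.
have aa : disc a s a by exact: disc_center.
have pp0 : 0 < 2 * pi :> R by rewrite mulr_gt0// pi_gt0.
have pi2 := pi_ge2 R; have pi4 : pi < 4 :> R by have := pihalf_lt2 R; lra.
have m2 : md (twopii : C) = 2 * pi by rewrite /twopii mdM md_ci mul1r md_rc gtr0_norm.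
have [u0 [eu0 ru0 iu0]] := cexp_surj (H0 a aa).
have u0B : md u0 <= B1 by apply: md_log_bound ru0 iu0 _ _ _ => //; rewrite md_gt0 H0.
have [L0 [hL0 L0a L0E]] := holo_log s0 hH H0 eu0.
pose L w := twopii^-1 * L0 w.
have hL : holo (disc a s) L by exact: holoZ.
have Ln w (n : nat) : disc a s w -> L w != n%:R.
  move=> wa; apply/eqP => E; have := H1 w wa; rewrite -L0E//.
  have -> : L0 w = n%:R * twopii by rewrite -E /L mulrC mulVKf// twopii_neq0.
  by rewrite cexpMn cexp_2pii expr1n eqxx.
have La : md (L a) <= B1.
  rewrite /L L0a mdM mdV m2; apply: le_trans u0B.
  rewrite mulrC ler_pdivrMr//; have := md_ge0 u0; nra.
have sqrt_holo f : holo (disc a s) f -> (forall w, disc a s w -> f w != 0) ->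
    exists2 P, holo (disc a s) P & forall w, disc a s w -> P w ^+ 2 = f w.
  move=> hf f0; have [u [eu _ _]] := cexp_surj (f0 a aa).
  have [l [hl _ lE]] := holo_log s0 hf f0 eu.
  exists (fun w => cexp (1 / 2 * l w)); first by apply/holo_cexp/holoZ.
  by move=> w wa; rewrite expr2 -cexpD -lE//; congr cexp; field.
(* P and Q, square roots of L and L - 1, play the parts of cosh W and -sinh W: since (P - Q)(P + Q)
   = 1, a logarithm W of P - Q satisfies cosh W = P. The roots exist because L avoids 0 and 1. *)
have [P hP PL] := sqrt_holo L hL (fun w wa => Ln w 0%N wa).
have [||Q hQ QL] := sqrt_holo (fun w => L w - 1).
- by apply: holoB hL _; exact: holo_cst.
- by move=> w wa; rewrite subr_eq0; exact: (Ln w 1%N wa).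
have PQ w : disc a s w -> (P w - Q w) * (P w + Q w) = 1.
  by move=> wa; have := PL w wa; have := QL w wa => h1 h2;
    transitivity (P w ^+ 2 - Q w ^+ 2); [ring|rewrite h1 h2; ring].
have G0 w : disc a s w -> P w - Q w != 0.
  by move=> wa; apply/eqP => E; have := PQ w wa; rewrite E mul0r => /esym/eqP; rewrite oner_eq0.
have GV w : disc a s w -> (P w - Q w)^-1 = P w + Q w.
  by move=> wa; apply: (mulfI (G0 w wa)); rewrite PQ// mulfV// G0.
have Pa : md (P a) <= B1 + 1 by apply: sqr_le_self; rewrite -mdX PL.
have Qa : md (Q a) <= B1 + 2.
  have -> : B1 + 2 = (B1 + 1) + 1 by ring.
  by apply: sqr_le_self; rewrite -mdX QL//; have := mdB (L a) 1; rewrite md1; lra.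
have [u1 [eu1 ru1 iu1]] := cexp_surj (G0 a aa).
have u1B : md u1 <= B2 + 4.
  apply: md_log_bound ru1 iu1 _ _ _; first by rewrite md_gt0 G0.
    by have := mdB (P a) (Q a); rewrite /B2; lra.
  by rewrite -mdV GV//; have := mdD (P a) (Q a); rewrite /B2; lra.
have [W [hW Wa WE]] := holo_log s0 (holoB hP hQ) G0 eu1.
have WL w : disc a s w -> ((cexp (W w) + cexp (- W w)) / 2) ^+ 2 = L w.
  by move=> wa; rewrite cexpN WE// GV// -PL//; congr (_ ^+ 2); field.
have zs : disc a s z by apply: disc_sub za; lra.
have Wz : md (W z) <= B3.
  have := @omit_lattice_lipschitz a s W s0 hW _ z za.
  have := md_subl (W z) (W a); rewrite Wa => h1 h2.
  suff : md (W z - u1) <= 6 * 1280 by rewrite /B3; lra.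
  by apply: h2 => x n xa; rewrite WL// Ln.
have Lz : md (L z) <= expR B3 * expR B3.
  rewrite -WL// mdX expr2 mdf md_nat.
  have h : md (cexp (W z) + cexp (- W z)) / 2 <= expR B3.
    have := mdD (cexp (W z)) (cexp (- W z)).
    have := md_cexp_le (W z); have := md_cexp_le (- W z); rewrite mdN.
    have : expR (md (W z)) <= expR B3 by rewrite ler_expR.
    lra.
  by apply: ler_pM => //; rewrite divr_ge0 ?md_ge0.
rewrite -L0E//; apply: le_trans (md_cexp_le _) _; rewrite ler_expR.
have -> : L0 z = twopii * L z by rewrite /L mulVKf// twopii_neq0.
by rewrite mdM m2; apply: ler_pM; rewrite ?md_ge0//; lra.
Qed.

(** When H(a) is close to 0 its inverse is out of control; then 1 - H, which omits the same two
    values, has modulus at least 1/2 at a and takes its place. *)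
Lemma schottky M : exists S : R, forall a s H, 0 < s -> holo (disc a s) H ->
  (forall z, disc a s z -> H z != 0) -> (forall z, disc a s z -> H z != 1) ->
  md (H a) <= M -> forall z, disc a (s / 2) z -> md (H z) <= S.
Proof.
have [S1 h1] := schottky_annulus (Num.max M 2); have [S2 h2] := schottky_annulus 2.
exists (Num.max S1 (S2 + 1)) => a s H s0 hH H0 H1 Ha z za; rewrite le_max.
have aa : disc a s a by exact: disc_center.
have half K : 0 < md (K : C) -> 1 / 2 <= md K -> (md K)^-1 <= 2.
  by move=> p h; rewrite -[leRHS]invrK lef_pV2 ?posrE ?invr_gt0//; lra.
have [Hh|Hh] := leP (1 / 2) (md (H a)).
  apply/orP; left; apply: (h1 a s H) => //; first by rewrite le_max Ha.
  by rewrite le_max half ?orbT//; lra.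
apply/orP; right; have := h2 a s (fun w => 1 - H w) s0.
have := mdB 1 (H a); have := md_subl 1 (H a); rewrite md1 => b1 b2.
move=> h; have {h} : md (1 - H z) <= S2.
  apply: h => //.
  - by apply: holoB => //; exact: holo_cst.
  - by move=> w wa; rewrite subr_eq0 eq_sym H1.
  - by move=> w wa; rewrite -subr_eq0 addrAC subrr add0r oppr_eq0 H0.
  - by lra.
  - by apply: half; lra.
by have := md_subl (H z) 1; rewrite mdBC md1; lra.
Qed.

(** Schottky's bound does not depend on the radius, so H is bounded on the plane and Liouville's
    theorem applies. *)
Lemma little_picard H : holo setT H -> (forall z, H z != 0) -> (forall z, H z != 1) ->
  forall z, H z = H 0.
Proof.
move=> hH H0 H1; have [S hS] := schottky (md (H 0)).
apply: (liouville (M := S)) => // w.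
apply: (hS 0 (2 * md w + 1)) => //.
- by have := md_ge0 w; lra.
- exact: holoW hH.
- by rewrite /disc /= subr0; lra.
Qed.

End Schottky.

(** * Montel's theorem *)

Section Subsequences.
Context {R : realType}.
Notation C := (cplx R).
Implicit Types (z w p : C) (s M : R).

Definition unbounded (I : set nat) := forall N, exists2 n, (N <= n)%N & I n.

Lemma pigeonhole (T : finType) (col : nat -> T) (I : set nat) : unbounded I ->
  exists c, unbounded [set n | I n /\ col n = c].
Proof.
move=> hI; apply: contrapT => nc.
have /choice[N hN] : forall c : T, exists N, forall n, (N <= n)%N -> I n -> col n <> c.
  move=> c; apply: contrapT => nN; apply: nc; exists c => N.
  apply: contrapT => nn; apply: nN; exists N => n Nn In nc.
  by apply: nn; exists n.
have [n hn In] := hI (\max_(c : T) N c)%N.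
by apply: (hN (col n) n) => //; apply: leq_trans hn; exact: leq_bigmax.
Qed.

(** P m k l stands for closeness of the terms k and l at precision m. Nested infinite index sets,
    one per precision, are thinned out to one index from each. *)
Lemma diagonal_subsequence (P : nat -> nat -> nat -> Prop) :
  (forall m I, unbounded I -> exists J, [/\ J `<=` I, unbounded J &
     forall k l, J k -> J l -> P m k l]) ->
  exists s : nat -> nat, {homo s : m n / (m < n)%N} /\
    forall m k l, (m <= k)%N -> (m <= l)%N -> P m (s k) (s l).
Proof.
move=> hP; pose B m (x : set nat * nat) :=
  [/\ unbounded x.1, x.1 x.2 & forall k l, x.1 k -> x.1 l -> P m k l].
have [J0 [_ J0u J0P]] : exists J, [/\ J `<=` setT, unbounded J &
    forall k l, J k -> J l -> P 0%N k l].
  by apply: hP => N; exists N.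
have [n0 _ J0n] := J0u 0%N.
have [|m [J n] [/= Ju Jn JP]|u [u0 uB]] := @dependent_sequence (set nat * nat) B
    (fun m x y => y.1 `<=` x.1 /\ (x.2 < y.2)%N) (J0, n0).
- by [].
- have [K [KJ Ku KP]] := hP m.+1 J Ju; have [k nk Kk] := Ku n.+1.
  by exists (K, k).
have sub m k : (u (m + k)%N).1 `<=` (u m).1.
  elim: k => [|k IH]; first by rewrite addn0.
  by rewrite addnS; apply: subset_trans (uB (m + k)%N).2.1 IH.
exists (fun m => (u m).2); split.
  apply: homo_ltn => [x y z|m]; [exact: ltn_trans|exact: (uB m).2.2].
have self k : (u k).1 (u k).2 by have [] := (uB k).1.
have mem m k : (m <= k)%N -> (u m).1 (u k).2.
  by move=> mk; apply: (sub m (k - m)%N); rewrite subnKC.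
by move=> m k l mk ml; have [_ _ H] := (uB m).1; apply: H; exact: mem.
Qed.

(** Total boundedness of a disc, phrased as a finite colouring so that [pigeonhole] can be applied
    to it. *)
Lemma finite_cells M (d : R) : 0 < d -> exists (T : finType) (c : C -> T),
  forall z w, md z <= M -> md w <= M -> c z = c w -> md (z - w) <= d.
Proof.
move=> d0; have [e e0 ed] : exists2 e : R, 0 < e & e = d / 2 by exists (d / 2); lra.
pose K := Num.truncn (2 * M / e).
pose cell (x : R) : 'I_K.+1 := inord (Num.truncn ((x + M) / e)).
have cellP x y : `|x| <= M -> `|y| <= M -> cell x = cell y -> `|x - y| <= e.
  have aux t : `|t| <= M -> 0 <= (t + M) / e /\ (cell t : nat) = Num.truncn ((t + M) / e).
    rewrite ler_norml => /andP[t1 t2].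
    have t0 : 0 <= (t + M) / e by rewrite divr_ge0 ?(ltW e0)//; lra.
    split => //; rewrite /cell inordK// ltnS le_truncn//.
    by rewrite ler_pM2r ?invr_gt0//; lra.
  move=> xM yM xy; have [x0 cx] := aux x xM; have [y0 cy] := aux y yM.
  have xyE : Num.truncn ((x + M) / e) = Num.truncn ((y + M) / e) by rewrite -cx -cy xy.
  have /andP[a1 a2] := truncn_itv x0; have /andP[b1 b2] := truncn_itv y0.
  rewrite xyE in a1 a2; set k := Num.truncn _ in a1 a2 b1 b2.
  move: a1 a2 b1 b2; rewrite -natr1 !ler_pdivlMr// !ltr_pdivrMr// => a1 a2 b1 b2.
  by rewrite ler_norml; apply/andP; split; lra.
exists ('I_K.+1 * 'I_K.+1)%type, (fun z => (cell (re z), cell (im z))).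
move=> z w zM wM [czw dzw].
have h1 : `|re z - re w| <= e.
  by apply: cellP czw; [exact: le_trans (re_le_md z) zM|exact: le_trans (re_le_md w) wM].
have h2 : `|im z - im w| <= e.
  by apply: cellP dzw; [exact: le_trans (im_le_md z) zM|exact: le_trans (im_le_md w) wM].
by apply: le_trans (md_le_reim _) _; rewrite reB imB; lra.
Qed.

Lemma real_limit (x : nat -> R) :
  (forall m k l, (m <= k)%N -> (m <= l)%N -> `|x k - x l| <= m.+1%:R^-1) ->
  exists L, forall m, `|x m - L| <= m.+1%:R^-1.
Proof.
move=> hx.
have [m k|L hL] := @real_between R (fun m => x m - m.+1%:R^-1) (fun m => x m + m.+1%:R^-1).
  have p j : 0 < (j.+1%:R : R)^-1 by rewrite invr_gt0.
  have := p m; have := p k; have [mk|km] := leqP m k.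
    have := hx m m k (leqnn m) mk; rewrite ler_norml => /andP[_].
    by move: (m.+1%:R^-1) (k.+1%:R^-1) => a b ? ? ?; lra.
  have := hx k m k (ltnW km) (leqnn k); rewrite ler_norml => /andP[_].
  by move: (m.+1%:R^-1) (k.+1%:R^-1) => a b ? ? ?; lra.
exists L => m; have := hL m; rewrite ler_norml.
by move: (m.+1%:R^-1) => e /andP[? ?]; apply/andP; split; lra.
Qed.

Lemma cplx_limit (x : nat -> C) :
  (forall m k l, (m <= k)%N -> (m <= l)%N -> md (x k - x l) <= m.+1%:R^-1) ->
  exists L, forall m, md (x m - L) <= 2 * m.+1%:R^-1.
Proof.
move=> hx; have [m k l mk ml|a ha] := @real_limit (re \o x).
  by rewrite /= -reB; apply: le_trans (re_le_md _) (hx m k l mk ml).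
have [m k l mk ml|b hb] := @real_limit (im \o x).
  by rewrite /= -imB; apply: le_trans (im_le_md _) (hx m k l mk ml).
exists (rc a + ci * rc b) => m; apply: le_trans (md_le_reim _) _.
rewrite reB imB !reimE !(mul0r, mul1r, mulr0, subr0, addr0, add0r).
by have := ha m; have := hb m; rewrite /=; move: (m.+1%:R^-1) => e ? ?; lra.
Qed.

(** Each index n is coloured by the cells of the values of u n on a finite net. Indices of the same
    colour give functions close on the net, and the common Lipschitz constant 8 M / s spreads this
    to the half disc. *)
Lemma montel_bounded (u : nat -> C -> C) p s M : 0 < s ->
  (forall n, holo (disc p s) (u n)) -> (forall n w, disc p s w -> md (u n w) <= M) ->
  exists (t : nat -> nat) (h : C -> C), {homo t : m n / (m < n)%N} /\
    forall e, 0 < e -> exists N, forall n w, (N <= n)%N -> disc p (s / 2) w ->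
      md (u (t n) w - h w) < e.
Proof.
move=> s0 hu uM; have pp : disc p s p by exact: disc_center.
have M0 : 0 <= M by apply: le_trans (uM 0%N p pp); exact: md_ge0.
have [Lam LamE Lam0] : exists2 Lam : R, Lam = 8 * M / s & 0 <= Lam.
  by exists (8 * M / s) => //; rewrite divr_ge0 ?mulr_ge0// ltW.
pose P m k l := forall w, disc p (s / 2) w -> md (u k w - u l w) <= (m.+1%:R : R)^-1.
have [m I hI|t [tinc tP]] := @diagonal_subsequence P.
  have [e e0 eE] : exists2 e : R, 0 < e & e = m.+1%:R^-1.
    by exists m.+1%:R^-1 => //; rewrite invr_gt0.
  have L10 : 0 < 4 * (Lam + 1) by lra.
  have [T1 [c1 hc1]] := finite_cells s (divr_gt0 e0 L10).
  have e20 : 0 < e / 2 by lra.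
  have [T2 [c2 hc2]] := finite_cells M e20.
  (* A cell that misses the disc gets the default [p]; only cells of points of the disc are
     consulted. *)
  pose rep (c : T1) : C := xget p [set w | disc p (s / 2) w /\ c1 (w - p) = c].
  pose col n : {ffun T1 -> T2} := [ffun c => c2 (u n (rep c))].
  have [c cu] := pigeonhole col hI.
  exists [set n | I n /\ col n = c]; split => // [n []//|k l [_ ck] [_ cl]] w wp.
  pose r := rep (c1 (w - p)).
  have [rp rc1] : disc p (s / 2) r /\ c1 (r - p) = c1 (w - p).
    by rewrite /r /rep; case: xgetP => [x _//|/(_ w)[]].
  have wr : md (w - r) <= e / (4 * (Lam + 1)).
    have -> : w - r = (w - p) - (r - p) by ring.
    by apply: hc1 => //; rewrite /disc /= in wp rp; lra.
  have kl : md (u k r - u l r) <= e / 2.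
    have rs : disc p s r by apply: disc_sub rp; lra.
    apply: hc2; [exact: uM|exact: uM|].
    by move: ck; rewrite -cl => /ffunP/(_ (c1 (w - p))); rewrite !ffunE.
  have lip n : md (u n w - u n r) <= Lam * md (w - r).
    rewrite LamE; exact: holo_lipschitz (hu n) (uM n) wp rp.
  have Lw : Lam * md (w - r) <= e / 4.
    apply: le_trans (ler_wpM2l Lam0 wr) _.
    rewrite mulrA ler_pdivrMr//.
    have -> : e / 4 * (4 * (Lam + 1)) = Lam * e + e by field.
    by rewrite lerDl ltW.
  have -> : u k w - u l w = (u k w - u k r) + (u k r - u l r) - (u l w - u l r) by ring.
  apply: le_trans (mdB _ _) _.
  have := mdD (u k w - u k r) (u k r - u l r); have := lip k; have := lip l.
  rewrite -eE; lra.
have /choice[h hh] : forall w, exists L, disc p (s / 2) w ->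
    forall m, md (u (t m) w - L) <= 2 * m.+1%:R^-1.
  move=> w; have [wp|nwp] := pselect (disc p (s / 2) w); last by exists 0.
  have [m k l mk ml|L hL] := @cplx_limit (fun n => u (t n) w); first exact: tP.
  by exists L => _; exact: hL.
exists t, h; split => // e e0; exists (Num.truncn (2 / e)) => n w Nn wp.
apply: le_lt_trans (hh w wp n) _; rewrite ltr_pdivrMr// mulrC -ltr_pdivrMr//.
by apply: lt_le_trans (truncnS_gt _) _; rewrite ler_nat.
Qed.

End Subsequences.

(** * Holomorphic maps of the Riemann sphere *)

Section SphereTopology.
Context {R : realType}.
Notation C := (cplx R).
Notation S := (sphere R).
Implicit Types (u v w c : C) (z p q : S) (h g : S -> S).

Lemma disc_in_compact (M : R) : exists K : set C,
  [/\ compact K, closed K & forall w, ~ K w -> M < md w].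
Proof.
pose sq : set (R * R)%type := `[-M, M]%classic `*` `[-M, M]%classic.
pose e (x : (R * R)%type) : C := rc x.1 + ci * rc x.2.
have ce : continuous e.
  move=> x A /nbhs_cplxP[d d0 dA].
  apply/nbhs_ballP; exists (d / 2) => /=; first by rewrite divr_gt0.
  move=> y [/= y1 y2]; apply: dA; apply: le_lt_trans (md_le_reim _) _.
  rewrite /e reB imB !reimE !(mul0r, mul1r, mulr0, subr0, addr0, add0r).
  by move: y1 y2; rewrite /ball /= distrC (distrC x.2); lra.
have sqc : compact sq by apply: compact_setX; exact: segment_compact.
have Kc : compact (e @` sq).
  by apply: continuous_compact sqc; exact: continuous_subspaceT.
exists (e @` sq); split => //; first exact: compact_closed (@norm_hausdorff _ _) Kc.
move=> w nK; rewrite ltNge; apply/negP => wM; apply: nK; exists (re w, im w).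
  by split; rewrite /= in_itv /= -ler_norml; apply: le_trans wM;
    [exact: re_le_md|exact: im_le_md].
by rewrite /e /= -cplxE.
Qed.

Lemma compact_cplx_bounded (K : set C) : compact K ->
  exists M : R, forall w, K w -> md w <= M.
Proof.
move=> Kc; have mc : continuous (md : C -> R).
  move=> x B /nbhs_ballP[e e0 eB]; apply/nbhs_cplxP; exists e => // w wx; apply: eB.
  have := md_subl x w; have := md_subl w x; rewrite (mdBC x w) => h1 h2.
  by rewrite /ball /= ltr_norml; apply/andP; split; lra.
have : compact (md @` K) by apply: continuous_compact Kc; exact: continuous_subspaceT.
move=> /compact_bounded[N [_ hN]]; exists (N + 1) => w Kw.
apply: le_trans (ler_norm _) _; apply: (hN (N + 1)); first by rewrite ltrDl.
by exists w.
Qed.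

(* [ch z] is the inverse of the preferred chart at z, and [ctr z] the coordinate
   of z in that chart. *)
Definition ctr z : C := affine (chart z z).
Definition ch z v : S := chart z (Some v).

Lemma sphere_invK : involutive (@sphere_inv R).
Proof.
case=> [u|] /=; last by rewrite eqxx.
by have [->//|u0] := eqVneq u 0; rewrite /= invr_eq0 (negbTE u0) invrK.
Qed.

Lemma chartK p : involutive (chart p).
Proof. by case: p => [u|] z //=; exact: sphere_invK. Qed.

Lemma chart_inj p : injective (chart p).
Proof. exact: can_inj (chartK p). Qed.

Lemma chart_self z : chart z z = Some (ctr z).
Proof. by case: z. Qed.

Lemma ch_ctr z : ch z (ctr z) = z.
Proof. by rewrite /ch -chart_self chartK. Qed.

Lemma ch_inj z : injective (ch z).
Proof. by move=> u v /chart_inj[]. Qed.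

Lemma ch_Some u v : ch (Some u) v = Some v. Proof. by []. Qed.
Lemma ctr_None : ctr None = 0. Proof. by []. Qed.
Lemma ch_None v : ch None v = if v == 0 then None else Some v^-1.
Proof. by []. Qed.

Lemma nbhs_Some u (A : set S) :
  nbhs (Some u : S) A <-> exists2 e : R, 0 < e & forall w, md (w - u) < e -> A (Some w).
Proof. exact: (nbhs_cplxP u (fun w => A (Some w))). Qed.

Lemma nbhs_None (A : set S) :
  nbhs (None : S) A <-> A None /\ exists M : R, forall w, M < md w -> A (Some w).
Proof.
split.
  move=> nA; split; first exact: nbhs_singleton nA.
  have [K [Kc Kcl] KA] := nA; have [M hM] := compact_cplx_bounded Kc.
  exists M => w Mw; apply: KA; left; exists w => //= Kw.
  by have := hM w Kw; lra.
move=> [AN [M hM]]; have [K [Kc Kcl KM]] := disc_in_compact M.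
by exists K => // _ [[w nK <-]|->//]; apply: hM; exact: KM.
Qed.

(** Finite points and infinity get the same description here, so that later arguments in coordinates
    do not split into cases. *)
Lemma nbhs_chart z (A : set S) :
  nbhs z A <-> exists2 e : R, 0 < e & forall v, disc (ctr z) e v -> A (ch z v).
Proof.
case: z => [u|]; first exact: nbhs_Some.
apply: (iff_trans (nbhs_None A)); split.
  move=> [AN [M hM]]; pose e := (`|M| + 1)^-1.
  have M0 : 0 < `|M| + 1 by have := normr_ge0 M; lra.
  exists e; first by rewrite invr_gt0.
  move=> v; rewrite ch_None /disc /= subr0 => ve.
  have [//|v0] := eqVneq v 0; apply: hM; rewrite mdV.
  apply: le_lt_trans (ler_norm M) _; apply: lt_trans (_ : `|M| + 1 < _); first by rewrite ltrDl.
  by rewrite -[X in X < _]invrK ltf_pV2 ?posrE ?md_gt0 ?invr_gt0.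
move=> [e e0 hA]; split.
  by have := hA 0; rewrite ch_None eqxx; apply; exact: disc_center.
exists e^-1 => w ew; have ep : 0 < e^-1 by rewrite invr_gt0.
have w0 : w != 0 by rewrite -md_gt0; lra.
have := hA w^-1; rewrite ch_None invr_eq0 (negbTE w0) invrK; apply.
rewrite /disc /= ctr_None subr0 mdV -[X in _ < X]invrK ltf_pV2 ?posrE//.
by rewrite md_gt0.
Qed.

Lemma sphere_separate p q : p <> q -> exists (A B : set S),
  [/\ nbhs p A, nbhs q B & A `&` B = set0].
Proof.
have sn u : exists (A B : set S), [/\ nbhs (Some u : S) A, nbhs (None : S) B & A `&` B = set0].
  exists [set z | if z is Some w then md w < md u + 1 else False : Prop].
  exists [set z | if z is Some w then md u + 1 < md w else True : Prop]; split.
  - apply/nbhs_Some; exists 1 => // w wu /=; have := md_subl w u; lra.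
  - by apply/nbhs_None; split => //; exists (md u + 1).
  - by rewrite -subset0 => -[w|] [] //=; lra.
case: p q => [u|] [v|] // pq; last first.
- by have [A [B [nA nB AB]]] := sn v; exists B, A; split => //; rewrite setIC.
have uv : 0 < md (u - v).
  by rewrite md_gt0 subr_eq0; apply/eqP => uv; apply: pq; rewrite uv.
exists [set z | if z is Some w then md (w - u) < md (u - v) / 2 else False : Prop].
exists [set z | if z is Some w then md (w - v) < md (u - v) / 2 else False : Prop]; split.
- by apply/nbhs_Some; exists (md (u - v) / 2) => //; lra.
- by apply/nbhs_Some; exists (md (u - v) / 2) => //; lra.
- rewrite -subset0 => -[w|] [] //= h1 h2.
  by have := md_tri u w v; rewrite (mdBC u w); lra.
Qed.

Lemma sphere_hausdorff : hausdorff_space S.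
Proof.
move=> p q cl; apply: contrapT => /sphere_separate[A [B [nA nB AB]]].
by have [x xAB] := cl A B nA nB; rewrite AB in xAB.
Qed.

Lemma compact_sphere_open (A : set S) : compact A -> open (~` A).
Proof. by move=> Ac; apply: closed_openC; exact: compact_closed sphere_hausdorff Ac. Qed.

Lemma open_nbhs_sphere (U : set S) z : open U -> U z -> nbhs z U.
Proof. by move=> oU Uz; apply: open_nbhs_nbhs. Qed.

(** The increments in direction 1 are complex multiples of 1, hence run through all directions of
    the plane. *)
Lemma derivableP1 (f : C -> C) u : derivable f u 1 <-> exists l, cdiff f u l.
Proof.
split.
  rewrite /derivable => /cvg_ex[/= l hl]; exists l => e e0.
  have /hl : nbhs (l : C) [set y : C | md (y - l) < e] by apply/nbhs_cplxP; exists e.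
  rewrite /= /nbhs /= /within /= => /nbhs_cplxP[d d0 hd]; exists d => // w _ wu.
  have [->|wu0] := eqVneq w u; first by rewrite !subrr mulr0 subrr md0 mulr0.
  have wu1 : w - u != 0 by rewrite subr_eq0.
  have := hd (w - u); rewrite subr0 => /(_ wu wu1).
  rewrite /= scaler1 subrK => /ltW h.
  have -> : f w - f u - l * (w - u) = ((w - u)^-1 * (f w - f u) - l) * (w - u) by field.
  by rewrite mdM ler_wpM2r// md_ge0.
move=> [l hl]; apply/cvg_ex; exists l => A /nbhs_cplxP[e e0 eA].
have e20 : 0 < e / 2 by lra.
have [d d0 hd] := hl _ e20.
apply/nbhs_cplxP; exists d => // h; rewrite subr0 => hd0 h0; apply: eA.
rewrite /= scaler1; have := hd (h + u) I; rewrite addrK => /(_ hd0) H.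
have -> : h^-1 *: (f (h + u) - f u) - l = (f (h + u) - f u - l * h) / h.
  by rewrite /GRing.scale /=; field.
rewrite mdf ltr_pdivrMr ?md_gt0//; apply: le_lt_trans H _.
by rewrite ltr_pM2r ?md_gt0//; lra.
Qed.

(** [phi] is h read in the charts at z and at h z. The equation is between points of the sphere, so
    no value is lost to the default of [affine]. *)
Definition local_rep h z r (phi : C -> C) := [/\ 0 < r,
  forall v, disc (ctr z) r v -> h (ch z v) = ch (h z) (phi v) &
  holo (disc (ctr z) r) phi].

Lemma local_rep_ctr h z r phi : local_rep h z r phi -> phi (ctr z) = ctr (h z).
Proof.
move=> [r0 hphi _]; apply: (@ch_inj (h z)).
by rewrite -hphi ?ch_ctr//; exact: disc_center.
Qed.

Lemma chart_affine p y : chart p y <> None -> y = ch p (affine (chart p y)).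
Proof.
by move=> h; apply: (@chart_inj p); rewrite /ch chartK; case: (chart p y) h.
Qed.

Lemma holomorphic_rep h z : holomorphic_at h z -> exists r phi, local_rep h z r phi.
Proof.
move=> [hc /nbhs_cplxP[d d0 hd]].
have nN : nbhs (h z) [set y | chart (h z) y <> None].
  by apply/nbhs_chart; exists 1 => // v _; rewrite /ch /= chartK.
have /nbhs_chart[e e0 he] := hc _ nN.
pose phi v := affine (chart (h z) (h (ch z v))).
exists (Num.min d e), phi; split.
- by rewrite lt_min d0.
- by move=> v; rewrite /disc /= lt_min => /andP[_ ve]; apply/chart_affine/he.
- move=> v; rewrite /disc /= lt_min => /andP[vd _]; apply/derivableP1; exact: hd.
Qed.

Lemma rep_continuous h z r phi : local_rep h z r phi -> {for z, continuous h}.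
Proof.
move=> H; have [r0 hphi dphi] := H => B /nbhs_chart[e e0 he].
have [l hl] := dphi _ (disc_center (ctr z) r0).
have [d d0 hd] := diff_cont hl e0.
apply/nbhs_chart; exists (Num.min r d); first by rewrite lt_min r0.
move=> v; rewrite /disc /= lt_min => /andP[vr vd].
by rewrite hphi//; apply: he; rewrite /disc /= -(local_rep_ctr H); exact: hd.
Qed.

Lemma rep_holomorphic h z r phi : local_rep h z r phi -> holomorphic_at h z.
Proof.
move=> H; split; first exact: rep_continuous H.
have [r0 hphi dphi] := H.
apply/nbhs_cplxP; exists r => // u ur; apply/derivableP1.
apply: (holo_disc_ext (f := phi)) dphi _ ur => v vr.
by rewrite -[chart z (Some v)]/(ch z v) hphi// /ch chartK.
Qed.

Lemma holomorphic_near g h z : nbhs z [set y | g y = h y] ->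
  holomorphic_at g z -> holomorphic_at h z.
Proof.
move=> gh /holomorphic_rep[r [phi [r0 gphi dphi]]].
have ghz : g z = h z by exact: nbhs_singleton gh.
move/nbhs_chart: gh => [e e0 he].
apply: (@rep_holomorphic _ _ (Num.min r e) phi); split.
- by rewrite lt_min r0.
- move=> v; rewrite /disc /= lt_min => /andP[vr ve].
  by rewrite -(he v ve) gphi// ghz.
- by apply: holoW dphi; apply: disc_sub; rewrite ge_min lexx.
Qed.

Lemma holomorphic_cst (p z : S) : holomorphic_at (fun=> p) z.
Proof.
apply: (@rep_holomorphic _ _ 1 (fun=> ctr p)); split => // [v _|].
  by rewrite ch_ctr.
exact: holo_cst.
Qed.

Lemma holomorphic_comp g h z : holomorphic_at g z -> holomorphic_at h (g z) ->
  holomorphic_at (h \o g) z.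
Proof.
move=> /holomorphic_rep[r [phi H]] /holomorphic_rep[s [psi [s0 hpsi dpsi]]].
have [r0 gphi dphi] := H.
have [l hl] := dphi _ (disc_center (ctr z) r0).
have [d d0 hd] := diff_cont hl s0.
have img v : disc (ctr z) (Num.min r d) v -> disc (ctr (g z)) s (phi v).
  rewrite /disc /= lt_min => /andP[_ vd]; rewrite -(local_rep_ctr H); exact: hd.
have sub : disc (ctr z) (Num.min r d) `<=` disc (ctr z) r.
  by apply: disc_sub; rewrite ge_min lexx.
apply: (@rep_holomorphic _ _ (Num.min r d) (psi \o phi)); split.
- by rewrite lt_min r0.
- by move=> v vr; rewrite /= gphi ?hpsi//; [exact: img|exact: sub].
- exact: holo_comp dpsi (holoW sub dphi) img.
Qed.

Lemma holomorphic_shift c z : holomorphic_at (fun z => sphere_shift z c) z.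
Proof.
case: z => [u|].
  apply: (@rep_holomorphic _ _ 1 (fun v => v + c)); split => //.
  exact: holoD (@holo_id _ _) (@holo_cst _ _ _).
(* Near infinity the translation reads v / (1 + c v); this radius keeps |c v| below 1/2. *)
pose r := (2 * (md c + 1))^-1.
have r0 : 0 < r by rewrite invr_gt0 mulr_gt0//; have := md_ge0 c; lra.
have cv v : disc 0 r v -> 1 + c * v != 0.
  rewrite /disc /= subr0 => vr; rewrite -md_gt0.
  have := md_subr 1 (c * v); rewrite md1 mdM.
  have : md c * md v <= 1 / 2; last by lra.
  have c0 := md_ge0 c; apply: le_trans (_ : md c * r <= _).
    by apply: ler_wpM2l => //; exact: ltW.
  rewrite /r invfM mulrCA; apply: le_trans (_ : 2^-1 * 1 <= _); last by lra.
  by apply: ler_wpM2l => //; rewrite ler_pdivrMr; lra.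
apply: (@rep_holomorphic _ _ r (fun v => v / (1 + c * v))); split => //.
  move=> v vr; rewrite ctr_None in vr; have h := cv v vr; rewrite !ch_None.
  have [->|v0] := eqVneq v 0; first by rewrite mul0r eqxx.
  rewrite mulf_eq0 invr_eq0 (negbTE v0) (negbTE h) /= invf_div.
  by congr Some; field.
rewrite ctr_None; apply: holoM; first exact: holo_id.
apply: holoV cv; apply: holoD; first exact: holo_cst.
exact: holoZ (@holo_id _ _).
Qed.

End SphereTopology.

(** * The identity theorem *)

Section IdentityTheorem.
Context {R : realType}.
Notation C := (cplx R).
Notation S := (sphere R).
Implicit Types (a b c u v w : C) (z p q : S) (h g : S -> S) (f : C -> C).

Lemma geometric_small (x q K : R) : 0 <= q -> q < 1 ->
  (forall n, x <= K * q ^+ n) -> x <= 0.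
Proof.
move=> q0 q1 hx; rewrite leNgt; apply/negP => x0.
have K0 : 0 < K by have := hx 0%N; rewrite expr0 mulr1; lra.
have [q00|q00] := eqVneq q 0.
  by have := hx 1%N; rewrite q00 expr1 mulr0; lra.
have qp : 0 < q by rewrite lt_def q00.
have [y y0 yE] : exists2 y : R, 0 < y & q^-1 = 1 + y.
  exists (q^-1 - 1); last by ring.
  by rewrite subr_gt0 -[X in X < _](invr1) ltf_pV2 ?posrE.
pose n := (Num.truncn (K / x / y)).+1.
have nK : K / x < n%:R * y by rewrite -ltr_pdivrMr//; exact: truncnS_gt.
have := bernoulli_ge n (ltW y0); rewrite -yE exprVn => h1.
have qn : 0 < q ^+ n by rewrite exprn_gt0.
have : K / x < (q ^+ n)^-1 by lra.
by rewrite ltr_pdivrMr// mulrC ltr_pdivlMr//; have := hx n; lra.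
Qed.

(** In place of power series: every power of v - a divides f, and the maximum principle for the
    quotient on a circle of radius s gives |f(v)| <= M (|v - a| / s)^k for all k. *)
Lemma holo_eq0_cluster a (r : R) f : 0 < r -> holo (disc a r) f ->
  (forall e : R, 0 < e -> exists v, [/\ v != a, md (v - a) < e & f v = 0]) ->
  forall v, disc a r v -> f v = 0.
Proof.
move=> r0 hf acc; have aa : disc a r a by exact: disc_center.
have fact k : exists2 g, holo (disc a r) g &
    forall v, disc a r v -> f v = (v - a) ^+ k * g v.
  elim: k => [|k [g hg fg]]; first by exists f => // v _; rewrite expr0 mul1r.
  have ga : g a = 0.
    apply: md_small_eq0 => e e0; have [l hl] := hg a aa.
    have [d d0 hd] := diff_cont hl e0.
    have [|v [va vd fv]] := acc (Num.min d r); first by rewrite lt_min d0.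
    move: vd; rewrite lt_min => /andP[vd vr].
    have gv : g v = 0.
      have := fg v vr; rewrite fv => /esym/eqP.
      by rewrite mulf_eq0 expf_eq0 subr_eq0 (negbTE va) andbF /= => /eqP.
    by have := hd v I vd; rewrite gv sub0r mdN; exact: ltW.
  exists (quot g a (derv g a)); first exact: holo_quot.
  move=> v va; rewrite fg// exprSr -mulrA; congr (_ * _); rewrite /quot.
  case: eqVneq => [->|vna]; first by rewrite ga subrr mul0r.
  by rewrite ga subr0 mulrC divfK// subr_eq0.
move=> v va; have [s [s0 sr vs]] := between_radius va.
have circ_in t : I01 t -> disc a r (circ a s t) by move=> It; rewrite /disc /= md_circ.
have [|M M0 hM] := @cont01_bounded R (fun t => f (circ a s t)).
  move=> t It; have [l hl] := hf _ (circ_in t It).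
  by apply: cont_diff_cst; [exact: diff_cont hl|exact: diff_cont (diff_circ a s I01 t)].
apply/eqP; rewrite -md_eq0 eq_le md_ge0 andbT; apply/eqP/eqP.
apply: (@geometric_small _ (md (v - a) / s) M).
- by rewrite divr_ge0 ?md_ge0// ltW.
- by rewrite ltr_pdivrMr// mul1r.
move=> k; have [g hg fg] := fact k; rewrite fg// mdM mdX expr_div_n.
have sk : 0 < s ^+ k by rewrite exprn_gt0.
have gv : md (g v) <= M / s ^+ k.
  apply: (max_modulus_circ s0 sr hg _ vs) => t It.
  rewrite ler_pdivlMr// mulrC -{1}(md_circ a s0 It) -mdX -mdM -fg//; last exact: circ_in.
  exact: hM.
rewrite [leRHS]mulrCA; apply: ler_wpM2l gv.
by rewrite exprn_ge0// md_ge0.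
Qed.

Lemma rep_eq h g z : holomorphic_at h z -> holomorphic_at g z ->
  (forall V, nbhs z V -> exists y, [/\ V y, y <> z & h y = g y]) ->
  nbhs z [set y | h y = g y].
Proof.
move=> hz gz acc.
have E : h z = g z.
  apply: contrapT => /sphere_separate[A [B [nA nB AB]]].
  have hA : nbhs z [set y | A (h y)] by exact: hz.1.
  have gB : nbhs z [set y | B (g y)] by exact: gz.1.
  have [y [[/= hyA gyB] _ hg]] := acc _ (filterI hA gB).
  suff : (A `&` B) (h y) by rewrite AB.
  by split=> //; rewrite hg.
have [r [phi [r0 hphi dphi]]] := holomorphic_rep hz.
have [s [psi [s0 gpsi dpsi]]] := holomorphic_rep gz.
pose t := Num.min r s; have t0 : 0 < t by rewrite lt_min r0.
have [tr ts] : t <= r /\ t <= s by split; rewrite ge_min lexx ?orbT.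
apply/nbhs_chart; exists t => // v vt /=.
rewrite hphi ?gpsi ?E; [|by apply: disc_sub vt|by apply: disc_sub vt].
congr ch; apply/eqP; rewrite -subr_eq0; apply/eqP.
have hd : holo (disc (ctr z) t) (fun v => phi v - psi v).
  by apply: holoB; [apply: holoW dphi|apply: holoW dpsi]; exact: disc_sub.
apply: (holo_eq0_cluster t0 hd _ vt) => e e0.
have m0 : 0 < Num.min e t by rewrite lt_min e0.
have [|y [[w wm <-] yz hg]] := acc [set y | exists2 w, disc (ctr z) (Num.min e t) w & ch z w = y].
  by apply/nbhs_chart; exists (Num.min e t) => // w wm; exists w.
move: wm; rewrite /disc /= lt_min => /andP[we wt].
exists w; split => //.
  by apply/eqP => wc; apply: yz; rewrite wc ch_ctr.
have wr : disc (ctr z) r w by rewrite /disc /=; lra.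
have ws : disc (ctr z) s w by rewrite /disc /=; lra.
by move: hg; rewrite hphi// gpsi// E => /ch_inj ->; rewrite subrr.
Qed.

(** A countable set has Lebesgue measure 0, the interval has measure d. *)
Lemma uncountable_itv (B : set R) (d : R) : 0 < d -> countable B ->
  exists2 t, 0 <= t <= d & ~ B t.
Proof.
move=> d0 cB; apply: contrapT => nB.
have Bsub : `[0, d]%classic `<=` B.
  move=> t; rewrite /= in_itv /= => t01; apply: contrapT => nt.
  by apply: nB; exists t.
have cI : countable `[0, d]%classic by exact: sub_countable (subset_card_le Bsub) cB.
have := countable_lebesgue_measure0 cI; rewrite lebesgue_measure_itv /= lte_fin d0.
by rewrite oppr0 adde0 => -[d00]; rewrite d00 ltxx in d0.
Qed.

Lemma countable_union (T : Type) (A B : set T) : countable A -> countable B ->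
  countable (A `|` B).
Proof.
move=> cA cB; have -> : A `|` B = \bigcup_(b in [set: bool]) (if b then A else B).
  rewrite eqEsubset; split=> [x [Ax|Bx]|x [[] _ ?]]; [by exists true|by exists false|by left|by right].
by apply: bigcup_countable => [|[]].
Qed.

Lemma countable_inj (T U : Type) (B : set U) (A : set T) (k : U -> T) : countable A ->
  (forall t, B t -> A (k t)) -> (forall s t, B s -> B t -> k s = k t -> s = t) ->
  countable B.
Proof.
move=> /countable_injP[i hi] BA kinj; apply/countable_injP; exists (i \o k).
move=> s t /set_mem Bs /set_mem Bt /= e; apply: kinj => //.
by apply: hi => //; apply/mem_set/BA.
Qed.

Lemma nbhs_other p (V : set S) : nbhs p V -> exists y, [/\ V y, y <> p & y <> None].
Proof.
move=> /nbhs_chart[e e0 he].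
pose v : C := ctr p + rc (e / 2).
have ve : disc (ctr p) e v.
  by rewrite /disc /= /v addrAC subrr add0r md_rc ger0_norm; lra.
exists (ch p v); split; first exact: he.
  rewrite -{2}(ch_ctr p) => /ch_inj /eqP; rewrite /v -subr_eq0 addrAC subrr add0r rc_eq0.
  by move=> /eqP; lra.
rewrite /v; case: (p) => [u //|].
by rewrite ch_None /ctr /= add0r rc_eq0; case: eqVneq => // ?; exfalso; lra.
Qed.

Variable A : set S.
Hypotheses (cA : countable A) (oA : open (~` A)).

(* The midpoint m runs along the perpendicular bisector of [a, b]; each point of A
   rules out at most one m on either side. *)
Lemma avoiding_path a b : ~ A (Some a) -> ~ A (Some b) -> a != b ->
  exists m, forall t : R, 0 <= t <= 1 ->
    ~ A (Some (a + rc t * (m - a))) /\ ~ A (Some (b + rc t * (m - b))).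
Proof.
move=> Aa Ab ab; pose m (s : R) : C := (a + b) / 2 + ci * rc s * (b - a).
have ba0 : b - a != 0 by rewrite subr_eq0 eq_sym.
have key x (k : R) : ~ A (Some x) -> k != 0 ->
    (forall s, m s - x = (rc k + ci * rc s) * (b - a)) ->
    countable [set s | exists2 t : R, 0 <= t <= 1 & A (Some (x + rc t * (m s - x)))].
  move=> Ax k0 mx.
  have /choice[T hT] : forall s : R, exists t : R,
      (exists2 t : R, 0 <= t <= 1 & A (Some (x + rc t * (m s - x)))) ->
      0 <= t <= 1 /\ A (Some (x + rc t * (m s - x))).
    move=> s; have [[t t01 At]|n] := pselect (exists2 t : R, 0 <= t <= 1 & A (Some (x + rc t * (m s - x)))).
      by exists t.
    by exists 0.
  apply: (countable_inj (A := A) (k := fun s => Some (x + rc (T s) * (m s - x)))) => //.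
    by move=> s /hT[].
  move=> s s' /hT[_ As] /hT[_ As'] [E].
  have T0 : T s != 0.
    by apply/eqP => T0; apply: Ax; rewrite T0 rc0 mul0r addr0 in As.
  (* In units of b - a the equality reads T s (k + i s) = T s' (k + i s'): the real parts give T s =
     T s', the imaginary parts then s = s'. *)
  move: E; rewrite !mx !mulrA => /addrI/(mulIf ba0) E.
  have E1 := congr1 re E; have E2 := congr1 im E.
  move: E1 E2; rewrite !reimE !(mul0r, mul1r, mulr0, subr0, addr0, add0r) => E1 E2.
  have TT : T s = T s' by apply: (mulIf k0); exact: E1.
  by apply: (mulfI T0); rewrite {2}TT; exact: E2.
have h1 := key a (1 / 2) Aa; have h2 := key b (- (1 / 2)) Ab.
have k0 : 1 / 2 != 0 :> R by apply/eqP => ?; lra.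
have k1 : - (1 / 2) != 0 :> R by rewrite oppr_eq0.
have half : rc (1 / 2) = 1 / 2 :> C by rewrite rcM rcV rc_nat.
have {h1} h1 : countable [set s | exists2 t : R, 0 <= t <= 1 & A (Some (a + rc t * (m s - a)))].
  apply: h1 => //.
  by move=> s; rewrite /m half; field.
have {h2} h2 : countable [set s | exists2 t : R, 0 <= t <= 1 & A (Some (b + rc t * (m s - b)))].
  apply: h2 => //.
  by move=> s; rewrite /m rcN half; field.
have [s _ /not_orP[n1 n2]] := uncountable_itv ltr01 (countable_union h1 h2).
exists (m s) => t t01; split => At; [apply: n1|apply: n2]; by exists t.
Qed.

Variables (h g : S -> S).
Hypotheses (hh : holomorphic_on (~` A) h) (hg : holomorphic_on (~` A) g).

Let E z := nbhs z [set y | h y = g y].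

Lemma germ_nbhs z : E z -> nbhs z E.
Proof.
move=> Ez; have := nbhs_interior Ez; exact.
Qed.

(** Agreement of germs is an open condition, and by [rep_eq] so is its failure: where the germs
    differ, the functions differ on a punctured neighbourhood. Along a segment the answer is
    therefore constant. *)
Lemma germ_segment a m : (forall t : R, 0 <= t <= 1 -> ~ A (Some (a + rc t * (m - a)))) ->
  E (Some a) <-> E (Some m).
Proof.
move=> Aam; pose x (t : R) : C := a + rc t * (m - a).
have x0 : x 0 = a by rewrite /x rc0 mul0r addr0.
have x1 : x 1 = m by rewrite /x rc1 mul1r addrC subrK.
rewrite -{1}x0 -x1.
refine (@segment_induction R (fun s u : R => E (Some (x s)) <-> E (Some (x u))) _ _).
  move=> t t01; have Axt := Aam t t01.
  have near (V : set S) : nbhs (Some (x t) : S) V -> exists2 d : R, 0 < d &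
      forall s, `|s - t| < d -> V (Some (x s)).
    move=> /nbhs_Some[e e0 eV]; have ma : 0 < md (m - a) + 1 by have := md_ge0 (m - a); lra.
    exists (e / (md (m - a) + 1)); first by rewrite divr_gt0.
    move=> s; rewrite ltr_pdivlMr// => st; apply: eV; apply: le_lt_trans st.
    have -> : x s - x t = rc (s - t) * (m - a) by rewrite /x rcB; ring.
    by rewrite mdM md_rc; apply: ler_wpM2l => //; lra.
  have [Et|nEt] := pselect (E (Some (x t))).
    have [d d0 hd] := near _ (germ_nbhs Et).
    exists d; [exact: d0|move=> s u s0 st tu u1 us].
    have h1 : `|s - t| < d by rewrite ler0_norm; lra.
    have h2 : `|u - t| < d by rewrite ger0_norm; lra.
    by split=> _; [exact (hd u h2)|exact (hd s h1)].
  have [V [nV hV]] : exists V, nbhs (Some (x t) : S) V /\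
      forall y, V y -> y <> Some (x t) -> h y <> g y.
    apply: contrapT => nV; apply: nEt; apply: rep_eq; [exact: hh|exact: hg|].
    move=> V nbV; apply: contrapT => ny; apply: nV; exists V; split => // y Vy yx hgy.
    by apply: ny; exists y.
  have [d d0 hd] := near _ nV.
  exists d; [exact: d0|move=> s u s0 st tu u1 us].
  have F s' : `|s' - t| < d -> ~ E (Some (x s')).
    move=> /hd Vs Es; have [xx|xx] := pselect ((Some (x s') : S) = Some (x t)).
      by apply: nEt; rewrite -xx.
    by apply: (hV _ Vs xx); exact: nbhs_singleton Es.
  have h1 : `|s - t| < d by rewrite ler0_norm; lra.
  have h2 : `|u - t| < d by rewrite ger0_norm; lra.
  by split=> H; [case: (F s h1 H)|case: (F u h2 H)].
move=> s t u _ _ _ _ h1 h2; exact: iff_trans h1 h2.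
Qed.

(** Two-segment paths avoiding A join the finite points of its complement; infinity, if regular, is
    reached last, as an accumulation point of finite regular points. *)
Lemma identity_theorem z0 : ~ A z0 ->
  (forall V, nbhs z0 V -> exists y, [/\ V y, y <> z0 & h y = g y]) ->
  forall z, ~ A z -> h z = g z.
Proof.
move=> Az0 acc.
have E0 : E z0 by apply: rep_eq => //; [exact: hh|exact: hg].
have fin p : ~ A p -> forall V, nbhs p V -> exists u, [/\ V (Some u), ~ A (Some u) & (Some u : S) <> p].
  move=> Ap V nV; have : nbhs p (V `&` ~` A).
    by apply: filterI => //; exact: open_nbhs_sphere.
  by move=> /nbhs_other[[u|] [[Vu Au] up uN]] //; exists u.
have [a Ea Aa] : exists2 a, E (Some a) & ~ A (Some a).
  by have [u [Eu Au _]] := fin _ Az0 _ (germ_nbhs E0); exists u.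
have Efin b : ~ A (Some b) -> E (Some b).
  move=> Ab; have [<-//|ab] := eqVneq a b.
  have [m hm] := avoiding_path Aa Ab ab.
  have h1 := germ_segment (fun t t01 => (hm t t01).1).
  have h2 := germ_segment (fun t t01 => (hm t t01).2).
  exact (proj2 h2 (proj1 h1 Ea)).
move=> z Az; suff Ez : E z by exact: (nbhs_singleton Ez).
apply: rep_eq; [exact: hh|exact: hg|].
move=> V nV; have [u [Vu Au uz]] := fin _ Az _ nV; exists (Some u); split => //.
exact: nbhs_singleton (Efin _ Au).
Qed.

End IdentityTheorem.

(** * Minimality of the singular set *)

Section ClassKLemmas.
Context {R : realType}.
Notation C := (cplx R).
Notation S := (sphere R).

Lemma class_K_open (f : sphere_map R) : class_K f -> open (~` sing f).
Proof. by move=> [_ fc _ _]; exact: compact_sphere_open. Qed.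

(** The maximality clause of [class_K] in usable form: a singular point of f outside B could be
    removed by gluing h to f, the two agreeing where both are defined. *)
Lemma sing_minimal (f : sphere_map R) (B : set S) (h : S -> S) : class_K f ->
  open (~` B) -> holomorphic_on (~` B) h ->
  (forall z, ~ sing f z -> ~ B z -> h z = f z) -> sing f `<=` B.
Proof.
move=> Kf oB hB hf z fz; apply: contrapT => nBz.
have oA := class_K_open Kf; have [_ _ fhol fmax] := Kf.
pose k y := if pselect (sing f y) then h y else f y.
have kf y : ~ sing f y -> k y = f y by rewrite /k; case: pselect.
have kh y : ~ B y -> k y = h y.
  by move=> By; rewrite /k; case: pselect => // fy; rewrite hf.
apply: (fmax (~` sing f `|` ~` B) k) => //.
  by split; [move=> y fy; left|move=> /(_ z) /(_ (or_intror nBz))].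
move=> y [fy|By].
  apply: (holomorphic_near (g := f)); last exact: fhol.
  by apply: filterS (open_nbhs_sphere oA fy) => x fx /=; rewrite kf.
apply: (holomorphic_near (g := h)); last exact: hB.
by apply: filterS (open_nbhs_sphere oB By) => x Bx /=; rewrite kh.
Qed.

End ClassKLemmas.

(** * Commuting translates *)

Section Translates.
Context {R : realType}.
Notation C := (cplx R).
Notation S := (sphere R).
Notation sh := sphere_shift.
Implicit Types (a b u v w : C) (z p q : S).

Lemma shiftD z (c d : C) : sh (sh z c) d = sh z (c + d).
Proof. by case: z => [u|] //=; rewrite addrA. Qed.
Lemma shift0 z : sh z 0 = z.
Proof. by case: z => [u|] //=; rewrite addr0. Qed.
Lemma shiftK (c : C) : cancel (fun z => sh z c) (fun z => sh z (- c)).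
Proof. by move=> z; rewrite shiftD subrr shift0. Qed.
Lemma shiftNK (c : C) : cancel (fun z => sh z (- c)) (fun z => sh z c).
Proof. by move=> z; rewrite shiftD addNr shift0. Qed.

Lemma continuous_shift (c : C) z : {for z, continuous (fun z => sh z c)}.
Proof. by case: (holomorphic_shift c z). Qed.

Lemma open_preimage (U : set S) (h : S -> S) : open U ->
  (forall z, {for z, continuous h}) -> open (h @^-1` U).
Proof.
move=> oU hc; rewrite openE => z Uz; apply: hc.
by apply: open_nbhs_nbhs.
Qed.

Lemma open_shift_preimage (A : set S) (c : C) : open (~` A) -> open (~` [set z | A (sh z c)]).
Proof.
by move=> oA; apply: (open_preimage (h := fun z => sh z c) oA) => z; exact: continuous_shift.
Qed.

Lemma countable_shift_preimage (A : set S) (c : C) : countable A -> countable [set z | A (sh z c)].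
Proof.
move=> cA; apply: (countable_inj (A := A) (k := fun z => sh z c)) => // s t _ _.
exact: (can_inj (shiftK c)).
Qed.

Lemma translate_sym (f g : sphere_map R) c : is_translate f g c -> is_translate g f (- c).
Proof. by move=> fg z gz fz; rewrite fg// shiftK. Qed.

Lemma commutes_sym (f g : sphere_map R) : commutes f g -> commutes g f.
Proof. by move=> fg z *; apply/esym/fg. Qed.

Lemma sing_translate (f g : sphere_map R) c : class_K f -> class_K g ->
  is_translate f g c -> sing f `<=` sing g.
Proof.
move=> Kf Kg fg; apply: (sing_minimal (h := fun z => sh (g z) c) Kf (class_K_open Kg)).
  move=> z gz; have [_ _ gh _] := Kg.
  exact: (holomorphic_comp (h := fun z => sh z c) (gh z gz) (holomorphic_shift c (g z))).
by move=> z fz gz; rewrite fg.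
Qed.

Lemma sing_translate_eq (f g : sphere_map R) c : class_K f -> class_K g ->
  is_translate f g c -> sing f = sing g.
Proof.
move=> Kf Kg fg; rewrite eqEsubset; split; first exact: sing_translate fg.
exact: sing_translate (translate_sym fg).
Qed.

(** Along the segment from a to v the distance |phi - phi(a)| takes every value between 0 and its
    final one, by the intermediate value theorem, so phi takes uncountably many values. *)
Lemma uncountable_image a (r : R) (phi : C -> C) v : holo (disc a r) phi -> disc a r v ->
  phi v <> phi a -> forall B : set C, countable B -> exists2 w, disc a r w & ~ B (phi w).
Proof.
move=> hphi va nphi B cB; apply: contrapT => nB.
have aa : disc a r a.
  by apply: disc_center; have := md_ge0 (v - a); rewrite /disc /= in va; lra.
have BP w : disc a r w -> B (phi w).
  by move=> wa; apply: contrapT => nw; apply: nB; exists w.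
pose d := md (phi v - phi a).
have d0 : 0 < d by rewrite md_gt0 subr_eq0; apply/eqP.
pose x (t : R) : C := a + rc t * (v - a).
have xa t : 0 <= t <= 1 -> disc a r (x t) by move=> t01; apply: convex_disc => //; exact: I01_rc.
pose cl (t : R) : R := Num.max 0 (Num.min 1 t).
have surj s : 0 <= s <= d -> exists2 t : R, 0 <= t <= 1 & md (phi (x t) - phi a) = s.
  move=> sd; have [||t] := @IVT R (fun t => md (phi (x t) - phi a)) 0 1 s ler01.
  - apply: continuous_in_subspaceT => t; rewrite inE /= in_itv /= => t01.
    have [l hl] := hphi _ (xa t t01).
    move=> V /nbhs_ballP[e /= e0 eV]; apply/nbhs_ballP.
    have [d1 d10 hd] := diff_cont hl e0.
    have m0 : 0 < md (v - a) + 1 by have := md_ge0 (v - a); lra.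
    exists (d1 / (md (v - a) + 1)) => /=; first by rewrite divr_gt0.
    move=> t' tt; apply: eV; rewrite /ball /=.
    have xx : md (x t' - x t) < d1.
      have -> : x t' - x t = rc (t' - t) * (v - a) by rewrite /x rcB; ring.
      rewrite mdM md_rc; move: tt; rewrite /ball /= distrC ltr_pdivlMr// => tt.
      by apply: le_lt_trans tt; apply: ler_wpM2l => //; lra.
    have := hd (x t') I xx; rewrite ltr_norml.
    have := md_subl (phi (x t') - phi a) (phi (x t) - phi a).
    have := md_subl (phi (x t) - phi a) (phi (x t') - phi a).
    have -> : phi (x t') - phi a - (phi (x t) - phi a) = phi (x t') - phi (x t) by ring.
    have -> : phi (x t) - phi a - (phi (x t') - phi a) = phi (x t) - phi (x t') by ring.
    by rewrite (mdBC (phi (x t)) (phi (x t'))) => *; apply/andP; split; lra.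
  - have -> : x 0 = a by rewrite /x rc0 mul0r addr0.
    have -> : x 1 = v by rewrite /x rc1 mul1r addrC subrK.
    by rewrite subrr md0 -/d ge_min le_max; lra.
  - by rewrite in_itv /= => t01 ts; exists t.
have /choice[T hT] : forall s : R, exists t : R, 0 <= s <= d ->
    0 <= t <= 1 /\ md (phi (x t) - phi a) = s.
  move=> s; have [/surj[t t01 ts]|n] := pselect (0 <= s <= d); first by exists t.
  by exists 0.
have [t t0d] := uncountable_itv (B := [set s | 0 <= s <= d]) d0
  (countable_inj (k := fun s => phi (x (T s))) cB
    (fun s sd => BP _ (xa _ (hT s sd).1))
    (fun s s' sd sd' e => ltac:(by rewrite -(hT s sd).2 -(hT s' sd').2 e))).
by [].
Qed.

Section Equivariance.
Variables (f g : sphere_map R) (c : C).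
Hypotheses (Kf : class_K f) (Kg : class_K g).
Hypotheses (fg : is_translate f g c) (comm : commutes f g).

Let A := sing g.
Let AE : sing f = A. Proof. exact: sing_translate_eq fg. Qed.
Let oA : open (~` A). Proof. exact: class_K_open. Qed.
Let cA : countable A. Proof. by case: Kg. Qed.
Let gh : holomorphic_on (~` A) g. Proof. by case: Kg. Qed.

Hypothesis nconst : ~ exists p, forall z, ~ A z -> g z = p.

Lemma not_locally_constant z : ~ A z -> forall V, nbhs z V -> exists2 y, V y & g y <> g z.
Proof.
move=> Az V nV; apply: contrapT => nV'.
apply: nconst; exists (g z); apply: (identity_theorem cA oA gh) Az _.
  by move=> y _; exact: holomorphic_cst.
move=> U nU; have [y [[Vy Uy] yz _]] := nbhs_other (filterI nV nU).
by exists y; split => //; apply: contrapT => ngy; apply: nV'; exists y.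
Qed.

(** It provides a point whose value avoids the singularities and their translates, so that both
    sides of the commutation relation are defined nearby. *)
Lemma generic_value (B : set S) : countable B -> exists2 z, ~ A z & ~ B (g z).
Proof.
move=> cB; apply: contrapT => nB.
have BP z : ~ A z -> B (g z) by move=> Az; apply: contrapT => nz; apply: nB; exists z.
have [z0 At] : exists z0, ~ A z0.
  have [||t _ At] := @uncountable_itv R [set t | A (Some (rc t))] 1 => //.
    by apply: (countable_inj (k := fun t => Some (rc t)) cA) => // s s' _ _ [].
  by exists (Some (rc t)).
have [r [phi [r0 hphi dphi]]] := holomorphic_rep (gh At).
have /nbhs_chart[e e0 he] := open_nbhs_sphere oA At.
pose s := Num.min r e; have s0 : 0 < s by rewrite lt_min r0.
have sr : s <= r by rewrite ge_min lexx.
have se : s <= e by rewrite ge_min lexx orbT.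
have [|y [v vs <-] gy] := not_locally_constant At (V := [set y | exists2 v, disc (ctr z0) s v & ch z0 v = y]).
  by apply/nbhs_chart; exists s => // v vs; exists v.
have cc : disc (ctr z0) s (ctr z0) by exact: disc_center.
have [|||w ws] := @uncountable_image (ctr z0) s phi v _ vs _ [set w | B (ch (g z0) w)].
- by apply: holoW dphi; exact: disc_sub.
- move=> E; apply: gy; have vr := disc_sub sr vs; have cr := disc_sub sr cc.
  by rewrite (hphi v vr) E -(hphi _ cr) ch_ctr.
- by apply: (countable_inj (k := ch (g z0)) cB) => // ? ? _ _; exact: ch_inj.
apply; rewrite /= -hphi; last exact: disc_sub ws.
by apply: BP; apply: he; exact: disc_sub ws.
Qed.

Lemma conj_shift_holo (d : C) : holomorphic_on (~` [set z | A (sh z d)])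
  (fun z => sh (g (sh z d)) (- d)).
Proof.
move=> z Az; apply: (holomorphic_comp (g := fun z => g (sh z d)) (h := fun z => sh z (- d))).
  apply: (holomorphic_comp (g := fun z => sh z d) (h := g)); first exact: holomorphic_shift.
  exact: gh.
exact: holomorphic_shift.
Qed.

(* Commutation gives the equation at the points g y for y near z1; they
   accumulate at g z1. *)
Lemma equivariance_off z : ~ A z -> ~ A (sh z c) -> g z = sh (g (sh z c)) (- c).
Proof.
move=> Az Azc; pose A' := [set z | A (sh z c)].
have cU : countable (A `|` A') by apply: countable_union => //; exact: countable_shift_preimage.
have oU : open (~` (A `|` A')).
  by rewrite setCU; apply: openI => //; exact: open_shift_preimage.
have [|z1 Az1 gz1] := @generic_value (A `|` A' `|` [set None]).
  by apply: countable_union => //; exact: countable1.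
have [nA1 nA2 nN] : [/\ ~ A (g z1), ~ A' (g z1) & g z1 <> None].
  by split => h; apply: gz1; [left; left|left; right|right].
apply: (@identity_theorem R _ cU oU g (fun z => sh (g (sh z c)) (- c)) _ _ (g z1)) => //.
- by move=> y /not_orP[yA _]; exact: gh.
- by move=> y /not_orP[_ yA]; exact: conj_shift_holo.
- by move=> [].
- move=> V nV.
  have gc : {for z1, continuous g} by case: (gh Az1).
  have n1 : nbhs z1 [set y | V (g y)] by exact: gc.
  have n2 : nbhs z1 [set y | ~ A (g y)] by exact: gc _ (open_nbhs_sphere oA nA1).
  have n3 : nbhs z1 [set y | ~ A' (g y)].
    have oA' : open (~` A') by exact: open_shift_preimage.
    by have := gc _ (open_nbhs_sphere oA' nA2).
  have n4 : nbhs z1 (~` A) by exact: open_nbhs_sphere.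
  have [y [[[Vy y2] y3] y4] yz] := not_locally_constant Az1
    (filterI (filterI (filterI n1 n2) n3) n4).
  exists (g y); split => //=.
  have fy : f y = sh (g y) c by apply: fg => //; rewrite AE.
  have := comm (z := y); rewrite AE => /(_ y4 y2 y4); rewrite fy => /(_ y3) E.
  by rewrite -E fg ?AE// shiftK.
by move=> [].
Qed.

(** By [equivariance_off] the map z -> g(z + c) - c continues g, and its singularities are those of
    g moved by -c; minimality of A gives one implication, the same with -c the other. *)
Lemma sing_shift z : A z <-> A (sh z c).
Proof.
have sub1 : A `<=` [set z | A (sh z c)].
  apply: (sing_minimal (h := fun z => sh (g (sh z c)) (- c)) Kg).
  - exact: open_shift_preimage.
  - exact: conj_shift_holo.
  - by move=> y Ay Ayc; rewrite -equivariance_off.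
have sub2 : A `<=` [set z | A (sh z (- c))].
  apply: (sing_minimal (h := fun z => sh (g (sh z (- c))) (- - c)) Kg).
  - exact: open_shift_preimage.
  - exact: conj_shift_holo.
  - by move=> y Ay Ayc; rewrite equivariance_off// ?shiftNK ?opprK ?shiftNK.
split; first exact: sub1.
by move=> /sub2 /=; rewrite shiftK.
Qed.

Lemma equivariance z : ~ A z -> g (sh z c) = sh (g z) c.
Proof.
by move=> Az; rewrite (equivariance_off Az) ?shiftNK// -sing_shift.
Qed.

End Equivariance.

End Translates.

(** * Spherical metric and normal families *)

Section SphericalMetric.
Context {R : realType}.
Notation C := (cplx R).
Notation S := (sphere R).
Implicit Types (a b u v w : C) (x y z : S).
Local Notation chd := (@chordal_dist R).
Local Notation sq u := (Num.sqrt (1 + md u ^+ 2)).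

Lemma sq_gt0 u : 0 < sq u.
Proof. by rewrite sqrtr_gt0 ltr_wpDr// sqr_ge0. Qed.
Lemma sq_sqr u : sq u ^+ 2 = 1 + md u ^+ 2.
Proof. by rewrite sqr_sqrtr// addr_ge0// sqr_ge0. Qed.
Lemma sq_ge u : md u <= sq u.
Proof.
rewrite -(ler_pXn2r (n := 2)) ?nnegrE ?md_ge0 ?(ltW (sq_gt0 u))// sq_sqr.
by rewrite lerDr.
Qed.
Lemma sq_ge1 u : 1 <= sq u.
Proof.
rewrite -(ler_pXn2r (n := 2)) ?nnegrE ?(ltW (sq_gt0 u))// sq_sqr expr1n.
by rewrite lerDl sqr_ge0.
Qed.
Lemma sq_le u : sq u <= 1 + md u.
Proof.
have m0 := md_ge0 u.
rewrite -(ler_pXn2r (n := 2)) ?nnegrE ?(ltW (sq_gt0 u)) ?addr_ge0// sq_sqr.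
rewrite !expr2; nra.
Qed.

(** The Cauchy-Schwarz inequality for the vectors (1, u) and (1, v). *)
Lemma sq_cauchy u v : md (1 + conjc (u : R[i]) * v) <= sq u * sq v.
Proof.
have cj : md (conjc (u : R[i]) : C) = md u.
  by rewrite !mdE; case: u => ? ? /=; rewrite sqrrN.
rewrite -(ler_pXn2r (n := 2)) ?nnegrE ?md_ge0 ?mulr_ge0 ?(ltW (sq_gt0 _))//.
rewrite exprMn !sq_sqr.
have h : md (1 + conjc (u : R[i]) * v) <= 1 + md u * md v.
  by have := mdD 1 (conjc (u : R[i]) * v : C); rewrite md1 mdM cj.
apply: le_trans (_ : (1 + md u * md v) ^+ 2 <= _).
  by rewrite ler_pXn2r ?nnegrE ?md_ge0 ?addr_ge0 ?mulr_ge0 ?md_ge0.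
have := sqr_ge0 (md u - md v); rewrite !expr2; lra.
Qed.

Lemma chordal_ge0 x y : 0 <= chd x y.
Proof.
by case: x => [u|]; case: y => [v|] //=; rewrite divr_ge0 ?mulr_ge0 ?md_ge0 ?(ltW (sq_gt0 _)).
Qed.

Lemma chordal_sym x y : chd x y = chd y x.
Proof.
by case: x => [u|]; case: y => [v|] //=; rewrite mdBC [_ * sq v]mulrC.
Qed.

Lemma chordal_xx x : chd x x = 0.
Proof. by case: x => [u|] //=; rewrite subrr md0 mulr0 mul0r. Qed.

Lemma chordal_le_md u v : chd (Some u) (Some v) <= 2 * md (u - v).
Proof.
rewrite /= ler_pdivrMr ?mulr_gt0 ?sq_gt0//.
rewrite ler_peMr ?mulr_ge0 ?md_ge0//.
by rewrite -[X in X <= _]mulr1; apply: ler_pM => //; exact: sq_ge1.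
Qed.

Lemma chordal_le2 x y : chd x y <= 2.
Proof.
case: x => [u|]; case: y => [v|] //=.
- rewrite ler_pdivrMr ?mulr_gt0 ?sq_gt0// ler_pM2l//.
  apply: le_trans (mdB u v) _.
  rewrite -(ler_pXn2r (n := 2)) ?nnegrE ?addr_ge0 ?md_ge0 ?mulr_ge0 ?(ltW (sq_gt0 _))//.
  rewrite exprMn !sq_sqr; have := sqr_ge0 (1 - md u * md v); rewrite !expr2; lra.
- by rewrite ler_pdivrMr ?sq_gt0//; have := sq_ge1 u; lra.
- by rewrite ler_pdivrMr ?sq_gt0//; have := sq_ge1 v; lra.
Qed.

(** For finite y = w it follows from (u - v)(1 + |w|^2) = (u - w)(1 + w' v) + (w - v)(1 + w' u),
    where w' is the conjugate of w, and from [sq_cauchy]. Only the middle point may be infinite: the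
    iterates compared later are finite, their limit need not be. *)
Lemma chordal_triangle u y v : chd (Some u) (Some v) <= chd (Some u) y + chd y (Some v).
Proof.
have su := sq_gt0 u; have sv := sq_gt0 v.
case: y => [w|] /=; last first.
  have -> : 2 / sq u + 2 / sq v = 2 * (sq u + sq v) / (sq u * sq v).
    by field; rewrite !gt_eqF.
  rewrite ler_pM2r ?invr_gt0 ?mulr_gt0// ler_pM2l//.
  by apply: le_trans (mdB u v) _; apply: lerD; exact: sq_ge.
have sw := sq_gt0 w.
have -> : 2 * md (u - w) / (sq u * sq w) + 2 * md (w - v) / (sq w * sq v) =
    2 * (md (u - w) * sq v + md (w - v) * sq u) / (sq u * sq w * sq v).
  by field; rewrite !gt_eqF.
have -> : 2 * md (u - v) / (sq u * sq v) = 2 * (md (u - v) * sq w) / (sq u * sq w * sq v).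
  by field; rewrite !gt_eqF.
rewrite ler_pM2r ?invr_gt0 ?mulr_gt0// ler_pM2l// -(ler_pM2r sw) -mulrA.
have ww : sq w * sq w = md (1 + conjc (w : R[i]) * w : C).
  have -> : conjc (w : R[i]) * w = rc (md w ^+ 2) :> C.
    rewrite md_sqr; case: w {sw} => x y; apply: cplxP; rewrite ?reM ?imM /=.
      by rewrite !expr2; ring.
    by ring.
  by rewrite -expr2 sq_sqr -rc1 -rcD md_rc ger0_norm// addr_ge0// sqr_ge0.
rewrite ww -mdM.
have -> : (u - v) * (1 + conjc (w : R[i]) * w) =
  (u - w) * (1 + conjc (w : R[i]) * v) + (w - v) * (1 + conjc (w : R[i]) * u) :> C by ring.
apply: le_trans (mdD _ _) _; rewrite !mdM mulrDl -!mulrA; apply: lerD.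
  by apply: ler_wpM2l; [exact: md_ge0|rewrite [leRHS]mulrC; exact: sq_cauchy].
by apply: ler_wpM2l; [exact: md_ge0|rewrite [leRHS]mulrC; exact: sq_cauchy].
Qed.

Lemma chordal_half x y : -1 <= chd x y / 2 <= 1.
Proof. by have := chordal_ge0 x y; have := chordal_le2 x y; lra. Qed.

(** Together with [chordal_lt] it makes the two distances uniformly equivalent, so that estimates
    can use the algebraic one. *)
Lemma spherical_lt (e : R) : 0 < e -> exists2 d : R, 0 < d &
  forall x y, chd x y < d -> spherical_dist x y < e.
Proof.
move=> e0; have pi0 := pi_gt0 R.
pose t := Num.min (e / 4) (pi / 4).
have t0 : 0 < t by rewrite lt_min !divr_gt0.
have te : t <= e / 4 by rewrite ge_min lexx.
have tp : t <= pi / 4 by rewrite ge_min lexx orbT.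
have st : 0 < sin t by apply: sin_gt0_pi; apply/andP; split; lra.
exists (2 * sin t); first by rewrite mulr_gt0.
move=> x y xy; rewrite /spherical_dist.
have h := chordal_half x y; have [/andP[a1 a2] sa] := asin_def h.
have lt1 : asin (chd x y / 2) < t.
  rewrite -(ltr_sin (R := R)) ?in_itv /= ?a1 ?a2//; [rewrite sa; lra|].
  by apply/andP; split; lra.
by lra.
Qed.

Lemma chordal_lt (d : R) : 0 < d -> exists2 e : R, 0 < e &
  forall x y, spherical_dist x y < e -> chd x y < d.
Proof.
move=> d0; have pi0 := pi_gt0 R.
have [r r0 hr] := is_derive_eps (is_derive_sin (0 : R)) ltr01.
pose t := Num.min (Num.min (r / 2) (d / 8)) (pi / 4).
have t0 : 0 < t by rewrite !lt_min !divr_gt0.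
have [tr td tp] : [/\ t <= r / 2, t <= d / 8 & t <= pi / 4].
  by rewrite /t !ge_min !lexx ?orbT.
have st : sin t <= 2 * t.
  have := hr t; rewrite subr0 sin0 cos0 mul1r subr0 (gtr0_norm t0) => /(_ _).
  have tr' : t < r by lra.
  by move=> /(_ tr'); rewrite ler_norml => /andP[_]; lra.
exists (2 * t); first lra.
move=> x y; rewrite /spherical_dist => xy.
have h := chordal_half x y; have [/andP[a1 a2] sa] := asin_def h.
have : sin (asin (chd x y / 2)) < sin t.
  by rewrite (ltr_sin (R := R)) ?in_itv /= ?a1 ?a2//; [lra|apply/andP; split; lra].
by rewrite sa; lra.
Qed.

Lemma spherical_xx x : spherical_dist x x = 0.
Proof. rewrite /spherical_dist chordal_xx mul0r -{1}sin0 sinK ?mulr0// in_itv /=.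
by have := pi_ge0 R; lra. Qed.

Lemma spherical_0oo : spherical_dist (Some (0 : C)) None = pi.
Proof.
rewrite /spherical_dist /chordal_dist md0 expr0n addr0 sqrtr1 divr1 divff//.
have -> : asin (1 : R) = pi / 2; last by field.
have mem : pi / 2 \in `[- (pi / 2), pi / 2 : R] by rewrite in_itv /=; have := pi_ge0 R; lra.
by rewrite -{1}sin_pihalf; exact: sinK mem.
Qed.

Lemma spherical_uniform (e : R) : 0 < e -> exists2 d : R, 0 < d &
  forall u v, md (u - v) < d -> spherical_dist (Some u) (Some v) < e.
Proof.
move=> /spherical_lt[d d0 hd]; exists (d / 2); first lra.
by move=> u v uv; apply: hd; apply: le_lt_trans (chordal_le_md u v) _; lra.
Qed.

Lemma spherical_infinity (e : R) : 0 < e -> exists M : R,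
  forall u, M < md u -> spherical_dist (Some u) None < e.
Proof.
move=> /spherical_lt[d d0 hd]; exists (2 / d) => u.
rewrite ltr_pdivrMr// => Mu; apply: hd => /=; rewrite ltr_pdivrMr ?sq_gt0//.
have := sq_ge u; nra.
Qed.

Lemma chordal_separated (B : R) u v : md u <= B -> 2 * B + 2 <= md v ->
  (2 * (1 + B))^-1 <= chd (Some u) (Some v).
Proof.
move=> uB vB /=; have B0 : 0 <= B by apply: le_trans uB; exact: md_ge0.
have su := sq_gt0 u; have sv := sq_gt0 v.
rewrite ler_pdivlMr ?mulr_gt0// ler_pdivrMl; last lra.
have h1 : sq u <= 1 + B by apply: le_trans (sq_le u) _; lra.
have h2 : sq v <= 2 * md v by apply: le_trans (sq_le v) _; lra.
have h3 : md v <= 2 * md (u - v) by have := md_subl v u; rewrite mdBC; lra.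
have : sq u * sq v <= (1 + B) * (2 * md v) by apply: ler_pM => //; exact: ltW.
have : (1 + B) * (2 * md v) <= (1 + B) * (2 * (2 * md (u - v))).
  by apply: ler_wpM2l; lra.
lra.
Qed.

End SphericalMetric.

(** * Normality from omitted values *)

Section MontelNormality.
Context {R : realType}.
Notation C := (cplx R).
Notation S := (sphere R).
Implicit Types (b c p w x y : C) (r : R).

Lemma unbounded_subsequence (I : set nat) : unbounded I ->
  exists s : nat -> nat, {homo s : m n / (m < n)%N} /\ forall n, I (s n).
Proof.
move=> hI; have [n0 _ In0] := hI 0%N.
have [|m n In|s [_ sI]] := @dependent_sequence nat (fun _ n => I n) (fun _ m n => (m < n)%N) n0.
- by [].
- by have [k nk Ik] := hI n.+1; exists k.
exists s; split => [|n]; last exact: (sI n).1.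
by apply: homo_ltn => [x y z|m]; [exact: ltn_trans|exact: (sI m).2].
Qed.

Lemma homo_ge_id (s : nat -> nat) : {homo s : m n / (m < n)%N} -> forall n, (n <= s n)%N.
Proof.
move=> hs; elim => [//|n IH]; apply: leq_ltn_trans IH _; exact: hs.
Qed.

(** Schottky's conclusion, uniformly in n: a bound at one point spreads to a disc about it. Read
    backwards, a large value at one point forces large values nearby. *)
Definition schottky_bounded p r (G : nat -> C -> C) := forall M : R, exists B : R,
  forall n x, disc p (r / 2) x -> md (G n x) <= M ->
  forall y, disc x (r / 4) y -> md (G n y) <= B.

(** Either the values at p stay bounded along infinitely many indices, and Montel's theorem applies,
    or they tend to infinity, and Schottky's bound carried from w back to p forces uniform
    divergence. The sequence [k] is arbitrary because a sequence of iterates may repeat them in any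
    order. *)
Lemma schottky_normal p r (G : nat -> C -> C) (k : nat -> nat) : 0 < r ->
  (forall n, holo (disc p r) (G n)) -> schottky_bounded p r G ->
  exists (s : nat -> nat) (h : S -> S), {homo s : m n / (m < n)%N} /\
    forall e : R, 0 < e -> exists N, forall n w, (N <= n)%N -> disc p (r / 8) w ->
      spherical_dist (Some (G (k (s n)) w)) (h (Some w)) < e.
Proof.
move=> r0 hG hB; have pp : disc p (r / 2) p by apply: disc_center; lra.
have [[M /unbounded_subsequence[t [tinc tM]]]|nM] :=
    pselect (exists M : R, unbounded [set n | md (G (k n) p) <= M]).
  have [B hB'] := hB M.
  have r40 : 0 < r / 4 by lra.
  have [||s [h [sinc hs]]] := montel_bounded (u := fun n => G (k (t n))) (p := p) (M := B) r40.
  - by move=> n; apply: holoW (hG _); apply: disc_sub; lra.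
  - by move=> n w wp; apply: (hB' _ p pp (tM n)).
  exists (t \o s), (fun z => Some (h (affine z))); split.
    by move=> m n mn; apply: tinc; exact: sinc.
  move=> e /(spherical_uniform (R := R))[d d0 hd]; have [N hN] := hs d d0.
  exists N => n w Nn wp; apply: hd; apply: hN => //.
  have -> : r / 4 / 2 = r / 8 by field.
  exact: wp.
exists id, (fun=> None); split => // e /(spherical_infinity (R := R))[M hM].
have [B hB'] := hB M.
have [N hN] : exists N, forall n, (N <= n)%N -> B < md (G (k n) p).
  apply: contrapT => nN; apply: nM; exists B => N.
  apply: contrapT => nn; apply: nN; exists N => n Nn.
  by rewrite ltNge; apply/negP => nB; apply: nn; exists n.
exists N => n w Nn wp; apply: hM; rewrite ltNge; apply/negP => GM.
have wp' : disc p (r / 2) w by apply: disc_sub wp; lra.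
have pw : disc w (r / 4) p by rewrite /disc /= mdBC in wp *; lra.
by have := hB' _ w wp' GM p pw; have := hN n Nn; lra.
Qed.

(** If G n omits b and b + c, then (G n - b) / c omits 0 and 1. The list is finite so that a maximum
    of the bounds over b serves all n. *)
Lemma omit_schottky_bounded p r (G : nat -> C -> C) c (l : seq C) : 0 < r -> c != 0 ->
  (forall n, holo (disc p r) (G n)) ->
  (forall n, exists2 b, b \in l & forall w, disc p r w -> G n w <> b /\ G n w <> b + c) ->
  schottky_bounded p r G.
Proof.
move=> r0 c0 hG om M.
have c1 : 0 < md c by rewrite md_gt0.
suff [B hB] : exists B : R, forall b, b \in l -> forall n,
    (forall w, disc p r w -> G n w <> b /\ G n w <> b + c) ->
    forall x, disc p (r / 2) x -> md (G n x) <= M ->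
    forall y, disc x (r / 4) y -> md (G n y) <= B.
  by exists B => n; have [b bl ob] := om n; exact: hB bl n ob.
elim: l {om} => [|b l [B hB]]; first by exists 0.
have [B' hB'] := schottky (R := R) ((M + md b) / md c).
exists (Num.max B (md c * B' + md b)) => b'; rewrite inE => /orP[/eqP->|b'l] n ob x xp GM y yx; last first.
  by rewrite le_max (hB b' b'l n ob x xp GM y yx).
rewrite le_max; apply/orP; right.
have r20 : 0 < r / 2 by lra.
have sub : disc x (r / 2) `<=` disc p r.
  by move=> w; rewrite /disc /= in xp *; have := md_tri w x p; lra.
pose H w := c^-1 * (G n w - b).
have GH w : G n w = c * H w + b by rewrite /H mulVKf// subrK.
have : md (H y) <= B'.
  apply: (hB' x (r / 2)) => //.
  - by apply: holoZ; apply: holoB (@holo_cst _ _ _); apply: holoW (hG n).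
  - by move=> w /sub /ob[nb _]; apply/eqP => H0; apply: nb; rewrite GH H0 mulr0 add0r.
  - by move=> w /sub /ob[_ nb]; apply/eqP => H0; apply: nb; rewrite GH H0 mulr1 addrC.
  - rewrite /H mdM mdV mulrC ler_pM2r ?invr_gt0//; apply: le_trans (mdB _ _) _; lra.
  - by have -> : r / 2 / 2 = r / 4 by field.
move=> Hy; rewrite GH; apply: le_trans (mdD _ _) _; rewrite mdM.
by rewrite lerD2r ler_pM2l.
Qed.

End MontelNormality.

(** * Fatou sets *)

Section FatouBasics.
Context {R : realType}.
Notation C := (cplx R).
Notation S := (sphere R).
Notation sh := sphere_shift.
Implicit Types (f g : sphere_map R) (p d : C) (z : S).

Lemma normal_iterates f (U : set S) :
  (forall k : nat -> nat, exists (s : nat -> nat) (h : S -> S),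
     {homo s : m n / (m < n)%N} /\
     locally_uniformly_cvg U (fun n => iter (k (s n)) f) h) ->
  normal_family U (range (fun n => iter n f)).
Proof.
move=> hk u hu.
have /choice[k ku] : forall n, exists k, u n = iter k f by move=> n; have [k _ <-] := hu n; exists k.
have [s [h [sinc hs]]] := hk k; exists s, h; split => //.
by have -> : u \o s = (fun n => iter (k (s n)) f) by apply/funext => n /=; rewrite ku.
Qed.

Lemma uniform_locally (U : set S) (u : nat -> S -> S) h : open U ->
  (forall e : R, 0 < e -> exists N, forall n w, (N <= n)%N -> U w ->
     spherical_dist (u n w) (h w) < e) ->
  locally_uniformly_cvg U u h.
Proof.
move=> oU hN z Uz; exists U; split => // e e0; have [N hN'] := hN e e0.
by exists N => // n Nn w Uw _; exact: hN'.
Qed.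

Lemma cst_cvg (U : set S) (u : nat -> S -> S) h : open U ->
  (forall n w, U w -> u n w = h w) -> locally_uniformly_cvg U u h.
Proof.
move=> oU uh; apply: uniform_locally => // e e0; exists 0%N => n w _ Uw.
by rewrite uh// spherical_xx.
Qed.

Lemma cvg_ext (U : set S) (u v : nat -> S -> S) h :
  (forall n w, U w -> u n w = v n w) ->
  locally_uniformly_cvg U u h -> locally_uniformly_cvg U v h.
Proof.
move=> uv hu z Uz; have [V [oV Vz hV]] := hu z Uz; exists V; split => // e /hV[N _ hN].
by exists N => // n Nn w Vw Uw; rewrite -uv//; exact: hN.
Qed.

Lemma fatou_same f g : sing f = sing g -> (forall z, ~ sing g z -> f z = g z) ->
  fatou_set g `<=` fatou_set f.
Proof.
move=> fg E z [U [oU Uz def nor]].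
have it n w : U w -> iter n f w = iter n g w.
  move=> Uw; elim: n => //= n ->; apply: E.
  exact: (def n.+1 w Uw).
exists U; split => //.
  by move=> n w Uw k kn; rewrite it// fg; exact: def kn.
apply: normal_iterates => k; have [|s [h [sinc hs]]] := nor (fun n => iter (k n) g).
  by move=> n; exists (k n).
exists s, h; split => //; apply: cvg_ext hs => n w Uw /=; by rewrite it.
Qed.

Lemma fatou_constant f q : (forall z, ~ sing f z) -> (forall z, f z = q) ->
  fatou_set f = setT.
Proof.
move=> nf fq; rewrite -subTset => z _; exists setT; split => //; first exact: openT.
  by move=> n w _ k _; exact: nf.
apply: normal_iterates => k.
(* The zeroth iterate is the identity, not the constant, so index sequences that hit 0 infinitely
   often form a case of their own. *)
have [/unbounded_subsequence[s [sinc s0]]|n0] := pselect (unbounded [set n | k n = 0%N]).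
  by exists s, id; split => //; apply: cst_cvg => [|n w _]; [exact: openT|rewrite s0].
have [s [sinc s0]] : exists s : nat -> nat, {homo s : m n / (m < n)%N} /\
    forall n, [set n | k n <> 0%N] (s n).
  apply: unbounded_subsequence => N; apply: contrapT => nN; apply: n0 => M.
  exists (maxn M N); first exact: leq_maxl.
  apply: contrapT => k0; apply: nN; exists (maxn M N) => //; exact: leq_maxr.
exists s, (fun=> q); split => //; apply: cst_cvg => [|n w _]; first exact: openT.
by have /= := s0 n; case: (k (s n)) => // m _; rewrite iterS fq.
Qed.

Lemma iter_shift f d n z : (forall z, f z = sh z d) -> iter n f z = sh z (n%:R * d).
Proof.
move=> fd; elim: n => [|n IH]; first by rewrite mul0r shift0.
by rewrite iterS IH fd shiftD -natr1 mulrDl mul1r.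
Qed.

Lemma natmul_large (d : C) (M : R) : d != 0 -> exists N : nat, forall n, (N <= n)%N ->
  M < md (n%:R * d).
Proof.
move=> d0; have dp : 0 < md d by rewrite md_gt0.
exists (Num.truncn (M / md d)).+1 => n Nn; rewrite mdM md_nat -ltr_pdivrMr//.
apply: lt_le_trans (truncnS_gt _) _; by rewrite ler_nat.
Qed.

Lemma open_finite_disc p (r : R) : open ([set z | exists2 w, disc p r w & z = Some w] : set S).
Proof.
rewrite openE => _ [w wp ->]; have [d d0 hd] := disc_open wp.
by apply/nbhs_Some; exists d => // v vw; exists v => //; exact: hd.
Qed.

(** On bounded sets the iterates tend uniformly to infinity. Every neighbourhood of infinity,
    however, contains points -n d, which the n-th iterate sends to 0 although their orbits tend to
    infinity, so no limit is approached uniformly there. *)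
Lemma fatou_translation f d : d != 0 -> (forall z, ~ sing f z) ->
  (forall z, f z = sh z d) -> fatou_set f = [set z | z <> None].
Proof.
move=> d0 nf fd; rewrite eqEsubset; split; last first.
  move=> [p|] //= _; pose U : set S := [set z | exists2 w, disc p 1 w & z = Some w].
  have oU : open U by exact: open_finite_disc.
  exists U; split => //; first by exists p => //; exact: disc_center.
    by move=> n w _ k _; exact: nf.
  apply: normal_iterates => k.
  have [[m /unbounded_subsequence[s [sinc sm]]]|nm] :=
      pselect (exists m, unbounded [set n | k n = m]).
    exists s, (iter m f); split => //; apply: cst_cvg => // n w _; by rewrite sm.
  have kinf m : exists N, forall n, (N <= n)%N -> (m <= k n)%N.
    elim: m => [|m [N hN]]; first by exists 0%N.
    have [N' hN'] : exists N', forall n, (N' <= n)%N -> k n <> m.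
      apply: contrapT => nN; apply: nm; exists m => N'; apply: contrapT => nn.
      by apply: nN; exists N' => n Nn kn; apply: nn; exists n.
    exists (maxn N N') => n; rewrite geq_max => /andP[/hN h1 /hN' h2].
    by rewrite ltn_neqAle h1 andbT; apply/eqP => E; apply: h2.
  exists id, (fun=> None); split => //; apply: uniform_locally => // e.
  move=> /(spherical_infinity (R := R))[M hM].
  have [N1 hN1] := natmul_large (M + md p + 1) d0.
  have [N hN] := kinf N1; exists N => n _ Nn [w wp ->] /=.
  rewrite (iter_shift _ _ fd) /=; apply: hM.
  have := hN1 _ (hN n Nn); have := md_subr ((k n)%:R * d) w; rewrite [_ * d + w]addrC.
  by have := md_subl w p; rewrite /disc /= in wp; lra.
move=> [p|] //= [U [oU UN _ nor]] _.
have [|s [h [sinc hs]]] := nor (fun n => iter n f); first by move=> n; exists n.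
have [V [oV VN hV]] := hs None UN.
have /nbhs_None[_ [M hM]] : nbhs (None : S) (V `&` U).
  by apply: filterI; apply: open_nbhs_nbhs.
have [N1 hN1] := natmul_large M d0.
have [N _ hN] := hV 1 ltr01.
(* The iterate of index [s n] sends this point to 0, at spherical distance pi from the limit
   infinity. *)
pose n := maxn N N1; pose w : C := - ((s n)%:R * d).
have wM : M < md w.
  rewrite mdN; apply: hN1; apply: leq_trans (homo_ge_id sinc n); exact: leq_maxr.
have [Vw Uw] := hM w wM.
have hw : h (Some w) = None.
  case E : (h (Some w)) => [v|//]; exfalso.
  have v0 : 0 < (2 * (1 + md v))^-1 by rewrite invr_gt0; have := md_ge0 v; lra.
  have [e e0 he] := chordal_lt v0.
  have [N2 _ hN2] := hV e e0.
  have [N3 hN3] := natmul_large (2 * md v + 2 + md w) d0.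
  pose m := maxn N2 N3.
  have := hN2 m (leq_maxl _ _) (Some w) Vw Uw.
  rewrite /= E (iter_shift _ _ fd) /= => /he.
  rewrite chordal_sym ltNge => /negP; apply; apply: chordal_separated => //.
  have := hN3 (s m) (leq_trans (leq_maxr N2 N3) (homo_ge_id sinc m)).
  by have := md_subr ((s m)%:R * d) w; rewrite [_ * d + w]addrC; lra.
have := hN n (leq_maxl _ _) (Some w) Vw Uw.
rewrite hw /= (iter_shift _ _ fd) /= /w addNr spherical_0oo.
by have := pi_ge2 R; lra.
Qed.

(** The limit h is not assumed continuous, so offending iterates are compared, through h at w and at
    p, with one fixed iterate [n0] that is continuous at p; the total is below 4 * e / 8 + e / 4. *)
Lemma equicontinuous_iterates g (U : set S) p (G : nat -> C -> C) : open U -> U (Some p) ->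
  (forall n w, U (Some w) -> iter n g (Some w) = Some (G n w)) ->
  (forall n, cont_within setT (G n) p) ->
  normal_family U (range (fun n => iter n g)) ->
  forall e : R, 0 < e -> exists2 r : R, 0 < r & forall n w, disc p r w ->
    chordal_dist (Some (G n w)) (Some (G n p)) < e.
Proof.
move=> oU Up gG Gc nor e e0; apply: contrapT => nr.
have /choice[x hx] : forall j : nat, exists x : nat * C,
    disc p (j.+1%:R : R)^-1 x.2 /\ e <= chordal_dist (Some (G x.1 x.2)) (Some (G x.1 p)).
  move=> j; apply: contrapT => nx; apply: nr; exists (j.+1%:R : R)^-1; first by rewrite invr_gt0.
  by move=> n w wp; rewrite ltNge; apply/negP => ew; apply: nx; exists (n, w).
have [|s [h [sinc hs]]] := nor (fun j => iter (x j).1 g); first by move=> j; exists (x j).1.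
have [V [oV Vp hV]] := hs _ Up.
have /nbhs_Some[r r0 hr] : nbhs (Some p : S) (V `&` U).
  by apply: filterI; apply: open_nbhs_nbhs.
have e8 : 0 < e / 8 by lra.
have [e' e'0 he'] := chordal_lt e8.
have [N _ hN] := hV e' e'0.
have close j w : (N <= j)%N -> md (w - p) < r ->
    chordal_dist (Some (G (x (s j)).1 w)) (h (Some w)) < e / 8.
  move=> Nj wr; have [Vw Uw] := hr w wr; apply: he'; rewrite -gG//; exact: hN.
pose n0 := (x (s N)).1.
have [d d0 hd] := Gc n0 (e / 8) e8.
have m0 : 0 < Num.min r d by rewrite lt_min r0.
pose j := maxn N (Num.truncn (Num.min r d)^-1).
have [xp xe] := hx (s j).
have : md ((x (s j)).2 - p) < Num.min r d.
  apply: lt_le_trans xp _; rewrite -[leRHS]invrK lef_pV2 ?posrE ?invr_gt0//.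
  apply: le_trans (ltW (truncnS_gt _)) _; rewrite ler_nat ltnS.
  exact: leq_trans (leq_maxr _ _) (homo_ge_id sinc j).
rewrite lt_min => /andP[xr xd]; set w := (x (s j)).2 in xe xr xd.
set n := (x (s j)).1 in xe.
have pr : md (p - p) < r by rewrite subrr md0.
have c1 := close j w (leq_maxl _ _) xr; have c2 := close N w (leqnn _) xr.
have c3 := close N p (leqnn _) pr; have c4 := close j p (leq_maxl _ _) pr.
rewrite -/n in c1 c4; rewrite -/n0 in c2 c3.
have c5 : chordal_dist (Some (G n0 w)) (Some (G n0 p)) <= e / 4.
  by apply: le_trans (chordal_le_md _ _) _; have := hd w I xd; lra.
have t1 := chordal_triangle (G n w) (h (Some w)) (G n0 w).
have t2 := chordal_triangle (G n0 p) (h (Some p)) (G n p).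
have t3 := chordal_triangle (G n w) (Some (G n0 w)) (G n p).
have t4 := chordal_triangle (G n0 w) (Some (G n0 p)) (G n p).
rewrite (chordal_sym (h (Some w))) in t1; rewrite (chordal_sym (h (Some p))) in t2.
lra.
Qed.

End FatouBasics.

(** * A criterion for Fatou points by omitted pairs *)

Section Omission.
Context {R : realType}.
Notation C := (cplx R).
Notation S := (sphere R).
Implicit Types (f g : sphere_map R) (b c p : C).

Lemma iter_defined_le f m n z : (m <= n)%N -> iter_defined f n z -> iter_defined f m z.
Proof. by move=> mn h k km; apply: h; exact: leq_trans mn. Qed.

Lemma holo_finite_rep (h : S -> S) w y : holomorphic_at h (Some w) -> h (Some w) = Some y ->
  exists l, cdiff (fun v => affine (h (Some v))) w l.
Proof.
move=> /holomorphic_rep[r [phi [r0 hphi dphi]]] hw; rewrite hw in hphi.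
apply: (holo_disc_ext (f := phi)) dphi _ (disc_center w r0) => v vr.
by have := hphi v vr; rewrite !ch_Some => ->.
Qed.

Lemma holomorphic_iter g n z : class_K g -> iter_defined g n z -> holomorphic_at (iter n g) z.
Proof.
move=> [_ _ gh _]; elim: n => [|n IH] dn.
  apply: (holomorphic_near (g := fun z => sphere_shift z 0)) (holomorphic_shift 0 z).
  by apply: filterS filterT => y _ /=; rewrite shift0.
apply: (holomorphic_comp (g := iter n g) (h := g)).
  by apply: IH; apply: iter_defined_le dn.
by apply: gh; apply: dn.
Qed.

(* The first N maps are bounded near p, hence omit a large b3 together with b3 + c. *)
Lemma fatou_omission f p (r : R) (F : nat -> C -> C) c b1 b2 N : 0 < r -> c != 0 ->
  (forall n w, disc p r w -> iter_defined f n (Some w)) ->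
  (forall n w, disc p r w -> iter n f (Some w) = Some (F n w)) ->
  (forall n, holo (disc p r) (F n)) ->
  (forall n, (N <= n)%N -> exists2 b, b \in [:: b1; b2] &
     forall w, disc p r w -> F n w <> b /\ F n w <> b + c) ->
  fatou_set f (Some p).
Proof.
move=> r0 c0 def fF hF om.
have [s [B [s0 sr hB]]] : exists s B : R, [/\ 0 < s, s <= r &
    forall n w, (n < N)%N -> disc p s w -> md (F n w) <= B].
  elim: N {om} => [|N [s [B [s0 sr hB]]]]; first by exists r, 0.
  have [l hl] := hF N p (disc_center p r0).
  have [d d0 hd] := diff_cont hl ltr01.
  exists (Num.min s d), (Num.max B (md (F N p) + 1)); split.
  - by rewrite lt_min s0.
  - by rewrite ge_min sr.
  move=> n w; rewrite ltnS leq_eqVlt le_max => /orP[/eqP->|nN];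
    rewrite /disc /= lt_min => /andP[ws wd].
    by have := hd w I wd; have := md_subl (F N w) (F N p); lra.
  by rewrite (hB n w nN ws).
pose b3 : C := rc (`|B| + 1 + md c).
have B0 := ler_norm B; have nB0 := normr_ge0 B; have mc := md_ge0 c.
have b3E : md b3 = `|B| + 1 + md c by rewrite md_rc ger0_norm//; lra.
have sub : disc p s `<=` disc p r by exact: disc_sub.
have hFs n : holo (disc p s) (F n) by apply: holoW (hF n).
have sch : schottky_bounded p s F.
  apply: (omit_schottky_bounded (c := c) (l := [:: b1; b2; b3])) => // n.
  have [nN|Nn] := ltnP n N.
    exists b3; first by rewrite !inE eqxx !orbT.
    move=> w ws; have h := hB n w nN ws; split=> E; rewrite E in h; first lra.
    by have := md_subr b3 c; lra.
  have [b bl hb] := om n Nn; exists b.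
    by move: bl; rewrite !inE => /orP[] ->; rewrite ?orbT.
  by move=> w /sub /hb.
pose U : set S := [set z | exists2 w, disc p (s / 8) w & z = Some w].
have oU : open U by exact: open_finite_disc.
have sub8 : disc p (s / 8) `<=` disc p r by apply: disc_sub; lra.
exists U; split => //.
- by exists p => //; apply: disc_center; lra.
- by move=> n _ [w /sub8 ws ->]; exact: def.
apply: normal_iterates => k.
have [t [h [tinc ht]]] := schottky_normal k s0 hFs sch.
exists t, h; split => //; apply: uniform_locally => // e /ht[M hM].
by exists M => n _ Mn [w ws ->]; rewrite fF; [exact: hM|exact: sub8].
Qed.

End Omission.

(** * Iterates of commuting translates *)

Section Dynamics.
Context {R : realType}.
Notation C := (cplx R).
Notation S := (sphere R).
Notation sh := sphere_shift.
Variables (f g : sphere_map R) (c : C).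
Hypotheses (Kf : class_K f) (Kg : class_K g).
Hypotheses (fg : is_translate f g c) (comm : commutes f g) (c0 : c != 0).
Hypothesis nconst : ~ exists p, forall z, ~ sing g z -> g z = p.

Let A := sing g.
Let fA : sing f = A. Proof. exact: sing_translate_eq fg. Qed.
Let fE z : ~ A z -> f z = sh (g z) c.
Proof. by move=> Az; apply: fg => //; rewrite fA. Qed.

Lemma sing_shift_nat n z : A z <-> A (sh z (n%:R * c)).
Proof.
elim: n => [|n IH]; first by rewrite mul0r shift0.
rewrite -natr1 mulrDl mul1r -shiftD; apply: iff_trans IH _.
exact: (sing_shift Kf Kg fg comm nconst).
Qed.

Lemma equivariance_nat n z : ~ A z -> g (sh z (n%:R * c)) = sh (g z) (n%:R * c).
Proof.
move=> Az; elim: n => [|n IH]; first by rewrite mul0r !shift0.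
rewrite -natr1 mulrDl mul1r -!shiftD (equivariance Kf Kg fg comm nconst) ?IH//.
by move=> /(proj2 (sing_shift_nat n z)).
Qed.

Lemma iter_translate n z : iter_defined g n z ->
  iter_defined f n z /\ iter n f z = sh (iter n g z) (n%:R * c).
Proof.
elim: n => [|n IH] dn; first by rewrite mul0r shift0; split.
have [df E] := IH (iter_defined_le (leqnSn n) dn).
have An : ~ A (iter n g z) by exact: dn.
have Afn : ~ A (iter n f z) by rewrite E => /(proj2 (sing_shift_nat _ _)).
split.
  by move=> k; rewrite ltnS leq_eqVlt => /orP[/eqP->|/df//]; rewrite fA.
by rewrite !iterS fE// E equivariance_nat// shiftD -natr1 mulrDl mul1r.
Qed.

Lemma regular_infinity_sing z : ~ A None -> ~ A z.
Proof.
move=> AN; case: z => [a|//] Aa.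
have /nbhs_None[_ [M hM]] := open_nbhs_sphere (class_K_open Kg) AN.
have [N hN] := natmul_large (M + md a) c0.
apply: (hM (a + N%:R * c)); last exact: (proj1 (sing_shift_nat N (Some a)) Aa).
by have := hN N (leqnn N); have := md_subr (N%:R * c) a; rewrite [_ * c + a]addrC; lra.
Qed.

(** At the points n c, which accumulate at infinity, equivariance determines g from g(0): it agrees
    there with a translation, or with the constant infinity if g(0) is infinite, which is
    excluded. *)
Lemma regular_infinity : ~ A None -> exists d, forall z, g z = sh z d.
Proof.
move=> AN; have An z : ~ A z by exact: regular_infinity_sing.
have [cA _ gh _] := Kg; have oA := class_K_open Kg.
have uniq (T : S -> S) : (forall z, holomorphic_at T z) ->
    (forall n, sh (g (Some 0)) (n%:R * c) = T (Some (n%:R * c))) -> forall z, g z = T z.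
  move=> hT gT z; apply: (identity_theorem cA oA gh (fun z _ => hT z) AN) (An z).
  move=> V /nbhs_None[_ [M hM]]; have [N hN] := natmul_large M c0.
  exists (Some (N%:R * c)); split => //; first by apply: hM; exact: hN.
  by rewrite -gT -equivariance_nat//= add0r.
case E : (g (Some 0)) => [d|].
  exists d; apply: uniq => [z|n]; first exact: holomorphic_shift.
  by rewrite E /= addrC.
case: nconst; exists None => z _; apply: (uniq (fun=> None)) => [y|n].
  exact: holomorphic_cst.
by rewrite E.
Qed.

Lemma fatou_regular_infinity : ~ A None -> ~ is_identity f -> ~ is_identity g ->
  fatou_set f = fatou_set g.
Proof.
move=> AN nf ng; have An z : ~ A z by exact: regular_infinity_sing.
have [d gd] := regular_infinity AN.
have fd z : f z = sh z (d + c) by rewrite fE// gd shiftD.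
have fn z : ~ sing f z by rewrite fA.
have d0 : d != 0 by apply/eqP => d0; apply: ng => z _; rewrite gd d0 shift0.
have dc0 : d + c != 0 by apply/eqP => d0'; apply: nf => z _; rewrite fd d0' shift0.
by rewrite (fatou_translation dc0 fn fd) (fatou_translation d0 An gd).
Qed.

Section Entire.
Hypothesis AN : A None.
Variable ga : C -> C.
Hypothesis gaE : forall u, ~ A (Some u) /\ g (Some u) = Some (ga u).

Lemma entire_holo : holo setT ga.
Proof.
move=> w _; have [Aw gw] := gaE w; have [_ _ gh _] := Kg.
have [l hl] := holo_finite_rep (gh _ Aw) gw; exists l.
by have -> : ga = fun v => affine (g (Some v)) by apply/funext => v; rewrite (gaE v).2.
Qed.

(** Otherwise (g(z) - z) / c - m omits 0 and 1 and is constant by Picard's theorem; then g is a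
    translation on the plane, which continues holomorphically to infinity, against [AN]. *)
Lemma entire_displacement (m : nat) : exists b, exists2 j : nat, (m <= j <= m.+1)%N &
  ga b = b + j%:R * c.
Proof.
apply: contrapT => nb; pose H u := c^-1 * (ga u - u) - m%:R.
have gaH u : ga u = u + (H u + m%:R) * c by rewrite /H; field.
have hH : holo setT H.
  by apply: holoB (@holo_cst _ _ _); apply: holoZ; apply: holoB entire_holo (@holo_id _ _).
have H0 u : H u != 0.
  apply/eqP => E; apply: nb; exists u, m; first by rewrite leqnn leqnSn.
  by rewrite gaH E add0r.
have H1 u : H u != 1.
  apply/eqP => E; apply: nb; exists u, m.+1; first by rewrite leqnSn leqnn.
  by rewrite gaH E nat1r.
have Hc := little_picard hH H0 H1; pose d := (H 0 + m%:R) * c.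
have /(_ None AN)[] : A `<=` set0.
apply: (sing_minimal (h := fun z => sh z d) Kg).
- by rewrite setC0; exact: openT.
- by move=> z _; exact: holomorphic_shift.
- move=> [u|] Az _; last by case: Az.
  by rewrite (gaE u).2 gaH Hc.
Qed.

End Entire.

Lemma fatou_translate_subset : A None -> fatou_set g `<=` fatou_set f.
Proof.
move=> AN [p|]; last first.
  by move=> [U [_ UN def _]]; case: (def 1%N None UN 0%N).
move=> [U [oU Up def nor]].
have /nbhs_Some[r r0 hr] := open_nbhs_sphere oU Up.
pose G n w := affine (iter n g (Some w)).
pose F n w := G n w + n%:R * c.
have An n w : U (Some w) -> ~ A (iter n g (Some w)) by move=> Uw; exact: (def n.+1 _ Uw n).
have gG n w : U (Some w) -> iter n g (Some w) = Some (G n w).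
  by move=> Uw; rewrite /G; case E : (iter n g (Some w)) => //; case: (An n w Uw); rewrite E.
have fF n w : U (Some w) -> iter n f (Some w) = Some (F n w).
  by move=> Uw; rewrite (iter_translate (def n _ Uw)).2 gG.
have deff n w : U (Some w) -> iter_defined f n (Some w).
  by move=> Uw; have [] := iter_translate (def n _ Uw).
have AF n w : U (Some w) -> ~ A (Some (F n w)).
  by move=> Uw; rewrite -fF// -fA; exact: (deff n.+1 w Uw n).
have hG n w : U (Some w) -> exists l, cdiff (G n) w l.
  by move=> Uw; apply: holo_finite_rep (gG n w Uw); apply: holomorphic_iter => //; exact: def.
have hF n : holo (disc p r) (F n).
  by apply: holoD (@holo_cst _ _ _) => w /hr /hG.
have main (s : R) b1 b2 N : 0 < s -> s <= r ->
  (forall n, (N <= n)%N -> exists2 b, b \in [:: b1; b2] &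
     forall w, disc p s w -> F n w <> b /\ F n w <> b + c) ->
  fatou_set f (Some p).
  move=> s0 sr; have sub : disc p s `<=` disc p r by exact: disc_sub.
  apply: (fatou_omission (F := F) s0 c0).
  - by move=> n w /sub /hr; exact: deff.
  - by move=> n w /sub /hr; exact: fF.
  - by move=> n; apply: holoW (hF n).
have main1 b : (forall n w, U (Some w) -> F n w <> b /\ F n w <> b + c) -> fatou_set f (Some p).
  move=> hb; apply: (main r b b 0%N) => // n _; exists b; first by rewrite inE eqxx.
  by move=> w /hr; exact: hb.
have [[a Aa]|nA] := pselect (exists a, A (Some a)).
  apply: (main1 a) => n w Uw; split=> E; apply: (AF n w Uw); rewrite E//.
  exact: (proj1 (sing_shift Kf Kg fg comm nconst (Some a)) Aa).
have Afin u : ~ A (Some u) by move=> Au; apply: nA; exists u.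
have [[u gu]|ng] := pselect (exists u, g (Some u) = None).
  (* Both u and u + c are poles of f, so an iterate taking either value would make the next one
     infinite. *)
  have next n w : U (Some w) -> f (Some (F n w)) <> None.
    by move=> Uw; rewrite -(fF n w Uw) -iterS fF.
  apply: (main1 u) => n w Uw; split=> E; apply: (next n w Uw); rewrite E fE// ?gu//.
  by rewrite -[Some _]/(sh (Some u) c) (equivariance Kf Kg fg comm nconst) ?gu.
pose ga u := affine (g (Some u)).
have gaE u : ~ A (Some u) /\ g (Some u) = Some (ga u).
  by split => //; rewrite /ga; case E : (g (Some u)) => //; case: ng; exists u.
(* Only one of two consecutive integers is guaranteed, so 1 and 3 are used: m1 is 1 or 2 and m2 is 3
   or 4, which ensures 0 < m1 < m2. *)
have [b1 [m1 /andP[m10 m13] gb1]] := entire_displacement AN gaE 1.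
have [b2 [m2 /andP[m23 _] gb2]] := entire_displacement AN gaE 3.
(* Each application of f adds (m + 1) c on this orbit: m c is the displacement under g and c the
   translation. *)
have orbit b m n j x k : ga b = b + m%:R * c -> U (Some x) -> F n x = b + j%:R * c ->
    F (n + k)%N x = b + (j + k * m.+1)%:R * c.
  move=> gb Ux Fj; elim: k => [|k IH]; first by rewrite addn0 mul0n addn0.
  have : Some (F (n + k.+1)%N x) = f (Some (F (n + k)%N x)) by rewrite -!fF// addnS iterS.
  rewrite IH fE// -[Some (b + _)]/(sh (Some b) _) equivariance_nat// (gaE b).2 gb /=.
  by case=> ->; rewrite !natrD !natrM -!natr1; ring.
(* It bounds b1 + (j - t) c for j <= 1 and t < m1. By [chordal_separated], values below B and above
   2 * B + 2 are at chordal distance at least [e0], whereas equicontinuity with [e0 / 2] at both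
   points allows less. *)
pose B := md b1 + (m1.+1)%:R * md c.
have B0 : 0 <= B by rewrite addr_ge0 ?mulr_ge0 ?md_ge0.
pose e0 := (2 * (1 + B))^-1; have e00 : 0 < e0 / 2.
  by rewrite divr_gt0// invr_gt0; lra.
have Gcont n : cont_within setT (G n) p by have [l hl] := hG n p Up; exact: diff_cont hl.
have [s s0 hs] := equicontinuous_iterates oU Up gG Gcont nor e00.
have [K0 hK] := natmul_large (2 * B + 2 + md b2) c0.
have m0 : 0 < Num.min s r by rewrite lt_min s0.
(* For such n the quotient k = n div m1 is at least K0 + m1, so i + k m2 - n >= k - (n mod m1) >=
   K0, as m2 > m1. *)
apply: (main (Num.min s r) b1 b2 ((K0 + m1) * m1)%N) => //; first by rewrite ge_min lexx orbT.
move=> n Nn; apply: contrapT => nom.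
have hits b : b \in [:: b1; b2] -> exists x j, [/\ disc p s x, U (Some x), (j <= 1)%N &
    F n x = b + j%:R * c].
  move=> bl; apply: contrapT => nx; apply: nom; exists b => // w.
  rewrite /disc /= lt_min => /andP[ws wr].
  by split=> E; apply: nx; exists w; [exists 0%N|exists 1%N];
    split => //; [exact: hr|rewrite mul0r addr0|exact: hr|rewrite mul1r].
have [|x [j [xs Ux j1 Fx]]] := hits b1; first by rewrite !inE eqxx.
have [|y [i [ys Uy i1 Fy]]] := hits b2; first by rewrite !inE eqxx orbT.
pose k := (n %/ m1)%N; pose t := (n %% m1)%N.
have nE : n = (k * m1 + t)%N by exact: divn_eq.
have nR : n%:R = k%:R * m1%:R + t%:R :> C by rewrite {1}nE natrD natrM.
have tm : (t < m1)%N by rewrite ltn_mod.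
have kK : (K0 + m1 <= k)%N by rewrite leq_divRL.
have GF l w : G l w = F l w - l%:R * c by rewrite /F addrK.
have Gx : md (G (n + k)%N x) <= B.
  have -> : G (n + k)%N x = b1 + (j%:R * c - t%:R * c).
    by rewrite GF (orbit _ _ _ _ _ _ gb1 Ux Fx) !natrD !natrM -!natr1 nR; ring.
  apply: le_trans (mdD _ _) _; rewrite /B lerD2l.
  apply: le_trans (mdB _ _) _; rewrite !mdM !md_nat -mulrDl; apply: ler_wpM2r (md_ge0 c) _ _ _.
  by rewrite -natrD ler_nat; lia.
have [q qE Kq] : exists2 q, (i + k * m2 = q + n)%N & (K0 <= q)%N.
  exists (i + k * m2 - n)%N.
    rewrite subnK//; nia.
  nia.
have Gy : 2 * B + 2 <= md (G (n + k)%N y).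
  have -> : G (n + k)%N y = b2 + q%:R * c.
    have -> : q%:R = (i + k * m2)%:R - n%:R :> C by rewrite qE natrD addrK.
    by rewrite GF (orbit _ _ _ _ _ _ gb2 Uy Fy) !natrD !natrM -!natr1; ring.
  by have := hK q Kq; have := md_subr (q%:R * c) b2; rewrite [_ * c + b2]addrC; lra.
have h1 := chordal_separated Gx Gy; have h2 := hs (n + k)%N x xs; have h3 := hs (n + k)%N y ys.
have h4 := chordal_triangle (G (n + k)%N x) (Some (G (n + k)%N p)) (G (n + k)%N y).
rewrite (chordal_sym (Some (G (n + k)%N p))) in h4; rewrite -/e0 in h1.
clear - h1 h2 h3 h4; lra.
Qed.

End Dynamics.

(** * Equality of the Fatou sets *)

Section Fatou.
Context {R : realType}.
Implicit Types (f g : sphere_map R) (c : cplx R).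

Lemma constant_sing f p : class_K f -> (forall z, ~ sing f z -> f z = p) ->
  forall z, ~ sing f z.
Proof.
move=> Kf fp z fz; suff /(_ z fz) : sing f `<=` set0 by [].
apply: (sing_minimal (h := fun=> p) Kf).
- by rewrite setC0; exact: openT.
- by move=> y _; exact: holomorphic_cst.
- by move=> y /fp ->.
Qed.

Lemma fatou_translate f g c : class_K f -> class_K g -> commutes f g ->
  is_translate f g c -> (c <> 0 -> ~ is_identity f /\ ~ is_identity g) ->
  fatou_set f = fatou_set g.
Proof.
move=> Kf Kg fg_comm fg fg_id; have fgA := sing_translate_eq Kf Kg fg.
have fE z : ~ sing g z -> f z = sphere_shift (g z) c by move=> gz; apply: fg; rewrite ?fgA.
have [cE|c0] := eqVneq c 0.
  rewrite eqEsubset; split; apply: fatou_same => // z.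
    by rewrite fgA => /fE ->; rewrite cE shift0.
  by move=> /fE ->; rewrite cE shift0.
have [[p gp]|nconst] := pselect (exists p, forall z, ~ sing g z -> g z = p).
  have gs := constant_sing Kg gp.
  rewrite (fatou_constant (q := p) gs) => [|z]; last exact: gp.
  apply: (fatou_constant (q := sphere_shift p c)) => z; first by rewrite fgA.
  by rewrite fE ?gp.
have [AN|AN] := pselect (sing g None); last first.
  have [nf ng] := fg_id (elimN eqP c0).
  exact: (fatou_regular_infinity Kf Kg fg fg_comm c0 nconst).
rewrite eqEsubset; split; last exact: (fatou_translate_subset Kf Kg fg fg_comm c0 nconst).
(* [g] is the translate of [f] by -c, so the same inclusion holds with the roles exchanged. *)
apply: (fatou_translate_subset Kg Kf (translate_sym fg) (commutes_sym fg_comm)).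
- by rewrite oppr_eq0.
- move=> [p fp]; apply: nconst; exists (sphere_shift p (- c)) => z gz.
  by rewrite -(fp z) ?fgA// fE// shiftK.
- by rewrite fgA.
Qed.

End Fatou.

Theorem theoremA (R : realType) (f g : sphere_map R) (c : cplx R)
  (hf : class_K f) (hg : class_K g)
  (hcomm : commutes f g)
  (hfg : is_translate f g c)
  (hid : c <> 0 -> ~ is_identity f /\ ~ is_identity g) :
  julia_set f = julia_set g /\ fatou_set f = fatou_set g.
Proof.
have E := fatou_translate hf hg hcomm hfg hid.
by split => //; rewrite /julia_set E.
Qed.
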